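(* Let $\alpha,\beta,\gamma>0$, $n\ge1$, and let $E\to\mathbb{D}^3$ be the hermitian holomorphic line bundle associated to $\mathscr{M}=\mathcal{H}^{(\alpha,\beta,\gamma)}(\mathbb{D}^3)$. Let $\Delta=\{z\in\mathbb{D}^3:z_1=z_2=z_3\}$, and let $J^{(n)}E|_\Delta$ be the jet bundle of order $n$ of $E$ relative to $\Delta$ (the bundle associated to the quotient of $\mathscr{M}$ by the submodule of functions vanishing to order $n$ along $\Delta$). Then $$J^{(n)}E|_\Delta=\bigoplus_{l=0}^{n-1}J^{(n-l)}E_l|_\Delta$$ as an orthogonal direct sum of hermitian holomorphic vector bundles over $\Delta$. Moreover, for $0\le l\le n-1$, the jet bundle $J^{(n-l)}E_l|_\Delta\to\Delta$ is irreducible as a hermitian holomorphic vector bundle.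
   Context: $\mathcal{H}^{(\alpha,\beta,\gamma)}(\mathbb{D}^3)$ is the reproducing kernel Hilbert space on $\mathbb{D}^3$ with kernel $K(z,w)=(1-z_1\bar w_1)^{-\alpha}(1-z_2\bar w_2)^{-\beta}(1-z_3\bar w_3)^{-\gamma}$. $E\to\mathbb{D}^3$ is the line bundle with global holomorphic frame $s(w)=K(\cdot,\bar w)\in\mathscr{M}$ and metric inherited from $\mathscr{M}$. Write $\partial_i=\partial/\partial w_i$; derivatives of $s$ are $\mathscr{M}$-valued holomorphic functions. $J^{(n)}E|_\Delta$ is the hermitian holomorphic bundle over $\Delta$ with global holomorphic frame $\{\partial_2^a\partial_3^bs(w):a,b\ge0,\ a+b\le n-1\}$, $w\in\Delta$, with metric inherited from $\mathscr{M}$. Let $\mathcal{Z}=\{z\in\mathbb{D}^3:z_2=z_3\}\supset\Delta$. With $(x)_k=x(x+1)\cdots(x+k-1)$, define for $w\in\mathbb{D}^3$ $$\sigma_l(w)=\sum_{j=0}^l(-1)^j\binom lj\frac{(\beta)_l(\gamma)_l}{(\beta)_{l-j}(\gamma)_j}\,\partial_2^{l-j}\partial_3^js(w).$$ $E_l\to\mathcal{Z}$ is the hermitian holomorphic line bundle with frame $\sigma_l|_{\mathcal{Z}}$ and metric inherited from $\mathscr{M}$ (equivalently, the line bundle associated to the reproducing kernel on $\mathcal{Z}$ obtained by polarizing $\|\sigma_l(w)\|^2$, a positive multiple of $(1-z_1\bar w_1)^{-\alpha}(1-z_2\bar w_2)^{-\beta-\gamma-2l}$). $J^{(n-l)}E_l|_\Delta$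 is the hermitian holomorphic bundle over $\Delta$ with frame $\{(\partial_2+\partial_3)^i\sigma_l(w):0\le i\le n-l-1\}$, $w\in\Delta$, and metric inherited from $\mathscr{M}$. A hermitian holomorphic vector bundle is irreducible if it is not the orthogonal direct sum of two nonzero holomorphic subbundles. *)

(* Defs.v *)
From HB Require Import structures.
From mathcomp Require Import all_boot all_order all_algebra.
From mathcomp Require Import complex.
From mathcomp Require Import all_classical all_reals all_analysis.

Set Implicit Arguments.
Unset Strict Implicit.
Unset Printing Implicit Defensive.

Import Order.TTheory GRing.Theory Num.Theory.
Import numFieldNormedType.Exports.

Local Open Scope classical_set_scope.
Local Open Scope ring_scope.
Local Open Scope complex_scope.

(* The library attaches the metric topology to the sort of an abstract
   numFieldType; R[i] is not syntactically one, so copy that structure. *)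
HB.instance Definition _ (R : realType) :=
  GRing.ComAlgebra.copy R[i] (R[i])^o.
HB.instance Definition _ (R : realType) := Vector.copy R[i] (R[i])^o.
HB.instance Definition _ (R : realType) := NormedModule.copy R[i] (R[i])^o.

(* Principal branch of x^c for 0 < Re x: there the principal argument of x is
   atan (Im x / Re x).  Only this half-plane is used below, since
   0 < Re (1 - z w^* ) whenever |z|, |w| < 1. *)
Definition cpow (R : realType) (x : R[i]) (c : R) : R[i] :=
  let r := Num.sqrt (complex.Re x ^+ 2 + complex.Im x ^+ 2) in
  let t := atan (complex.Im x / complex.Re x) in
  (r `^ c)%:C * (cos (c * t) +i* sin (c * t)).

Definition pochhammer (R : realType) (x : R) (k : nat) : R :=
  \prod_(i < k) (x + i%:R).

(* Points of C^3; the paper's coordinates z_1, z_2, z_3 are z 0 i1, z 0 i2,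
   z 0 i3. *)
Notation pt R := 'rV[R[i]]_3.

Definition i1 : 'I_3 := inord 0.
Definition i2 : 'I_3 := inord 1.
Definition i3 : 'I_3 := inord 2.

Definition D3 (R : realType) : set (pt R) :=
  [set z | forall i, `|z 0 i| < 1].

Definition Delta (R : realType) : set (pt R) :=
  [set z | D3 z /\ z 0 i1 = z 0 i2 /\ z 0 i2 = z 0 i3].

Definition K3 (R : realType) (alpha beta gamma : R) (z w : pt R) : R[i] :=
  cpow (1 - z 0 i1 * conjc (w 0 i1)) (- alpha) *
  cpow (1 - z 0 i2 * conjc (w 0 i2)) (- beta) *
  cpow (1 - z 0 i3 * conjc (w 0 i3)) (- gamma).

(* A Hilbert space of functions on D with reproducing kernel K.  An element f
   stands for the function [ev f] restricted to D; the values of [ev f] and of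
   [kernel_fun] outside D are irrelevant. *)
Record rkhs (R : realType) (T : Type) (D : set T) (K : T -> T -> R[i]) := RKHS {
  rkhs_space :> completeNormedModType R[i];
  ip : rkhs_space -> rkhs_space -> R[i];
  ev : rkhs_space -> T -> R[i];
  kernel_fun : T -> rkhs_space;
  ip_linearl : forall a f g h, ip (a *: f + g) h = a * ip f h + ip g h;
  ip_conj : forall f g, ip g f = conjc (ip f g);
  ip_norm : forall f, ip f f = `|f| ^+ 2;
  ev_linear : forall a f g z, D z -> ev (a *: f + g) z = a * ev f z + ev g z;
  ev_inj : forall f g, (forall z, D z -> ev f z = ev g z) -> f = g;
  ev_kernel : forall w z, D w -> D z -> ev (kernel_fun w) z = K z w;
  reproducing : forall f w, D w -> ip f (kernel_fun w) = ev f w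
}.

(* s w = K(., conj w), which is holomorphic in w. *)
Definition frameE (R : realType) (K : pt R -> pt R -> R[i])
    (M : rkhs (@D3 R) K) (w : pt R) : M :=
  kernel_fun M (map_mx (@conjc R) w).
Arguments frameE {R K} M w.

(* Partial derivative with respect to w_i, as a norm limit in M (with complex
   increments). *)
Definition pd (R : realType) (M : completeNormedModType R[i]) (i : 'I_3)
    (f : pt R -> M) (w : pt R) : M :=
  'D_(delta_mx 0 i) f w.

(* Hermitian holomorphic bundles over Delta whose metric is inherited from M
   are given by their fibres, i.e. as families of subspaces of M.
   A section is holomorphic when it is complex differentiable, as an M-valued
   function, along the direction (1, 1, 1) of the complex line containing
   Delta; this depends only on its values on Delta. *)
Definition hol_on_Delta_at (R : realType) (M : completeNormedModType R[i])
    (f : pt R -> M) (w : pt R) : Prop :=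
  derivable f w (const_mx 1).

Definition lin_span (R : realType) (M : completeNormedModType R[i])
    (I : finType) (e : I -> M) : set M :=
  [set x | exists c : I -> R[i], x = \sum_i c i *: e i].

Definition lin_indep (R : realType) (M : completeNormedModType R[i])
    (I : finType) (e : I -> M) : Prop :=
  forall c : I -> R[i], \sum_i c i *: e i = 0 -> forall i, c i = 0.

Definition hol_frame (R : realType) (M : completeNormedModType R[i])
    (U : set (pt R)) (F : pt R -> set M) (I : finType) (e : I -> pt R -> M) :
    Prop :=
  forall v, Delta v -> U v ->
    [/\ forall i, hol_on_Delta_at (e i) v,
        lin_indep (fun i => e i v) &
        F v = lin_span (fun i => e i v)].

Definition hol_bundle (R : realType) (M : completeNormedModType R[i])
    (F : pt R -> set M) (r : nat) : Prop :=
  forall w : pt R, Delta w ->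
    exists U : set (pt R), exists e : 'I_r -> pt R -> M,
      open_nbhs w U /\ hol_frame U F e.

Definition orth_direct_sum (R : realType) (K : pt R -> pt R -> R[i])
    (M : rkhs (@D3 R) K) (I : finType) (F : pt R -> set M)
    (G : I -> pt R -> set M) : Prop :=
  forall w : pt R, Delta w ->
    (forall i j, i != j ->
       forall x y, G i w x -> G j w y -> ip x y = 0) /\
    F w = [set x | exists g : I -> M,
             (forall i, G i w (g i)) /\ x = \sum_i g i].
Arguments orth_direct_sum {R K} M {I} F G.

Definition irreducible_bundle (R : realType) (K : pt R -> pt R -> R[i])
    (M : rkhs (@D3 R) K) (F : pt R -> set M) : Prop :=
  ~ exists (r : bool -> nat) (G : bool -> pt R -> set M),
      (forall b, (0 < r b)%N /\ hol_bundle (G b) (r b)) /\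
      orth_direct_sum M F G.
Arguments irreducible_bundle {R K} M F.

Definition jet_index (n : nat) : finType :=
  {p : 'I_n * 'I_n | (p.1 + p.2 <= n.-1)%N}.

Definition jetE_frame (R : realType) (K : pt R -> pt R -> R[i])
    (M : rkhs (@D3 R) K) (n : nat) (p : jet_index n) : pt R -> M :=
  iter (val p).1 (pd i2) (iter (val p).2 (pd i3) (frameE M)).
Arguments jetE_frame {R K} M n p w.

(* The fibres of J^(n) E over Delta. *)
Definition jetE (R : realType) (K : pt R -> pt R -> R[i])
    (M : rkhs (@D3 R) K) (n : nat) (w : pt R) : set M :=
  lin_span (fun p : jet_index n => jetE_frame M n p w).
Arguments jetE {R K} M n w.

(* sigma_l, the frame over {z_2 = z_3} of the line bundle E_l. *)
Definition sigma (R : realType) (K : pt R -> pt R -> R[i]) (beta gamma : R)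
    (M : rkhs (@D3 R) K) (l : nat) (w : pt R) : M :=
  \sum_(j < l.+1)
    ((-1) ^+ j * 'C(l, j)%:R *
     (pochhammer beta l * pochhammer gamma l /
      (pochhammer beta (l - j) * pochhammer gamma j)))%:C *:
    iter (l - j) (pd i2) (iter j (pd i3) (frameE M)) w.
Arguments sigma {R K} beta gamma M l w.

Definition jetEl_frame (R : realType) (K : pt R -> pt R -> R[i])
    (beta gamma : R) (M : rkhs (@D3 R) K) (l k : nat) (i : 'I_k) :
    pt R -> M :=
  iter i (fun f w => pd i2 f w + pd i3 f w) (sigma beta gamma M l).
Arguments jetEl_frame {R K} beta gamma M l k i w.

(* The fibres of J^(k) E_l over Delta. *)
Definition jetEl (R : realType) (K : pt R -> pt R -> R[i])
    (beta gamma : R) (M : rkhs (@D3 R) K) (l k : nat) (w : pt R) : set M :=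
  lin_span (fun i : 'I_k => jetEl_frame beta gamma M l k i w).
Arguments jetEl {R K} beta gamma M l k w.

(* Main.v *)
Require Import Defs.
From HB Require Import structures.
From mathcomp Require Import all_boot all_order all_algebra.
From mathcomp Require Import complex.
From mathcomp Require Import all_classical all_reals all_analysis.
From mathcomp Require Import ring lra.

Set Implicit Arguments.
Unset Strict Implicit.
Unset Printing Implicit Defensive.

Import Order.TTheory GRing.Theory Num.Theory.
Import numFieldNormedType.Exports.

Local Open Scope classical_set_scope.
Local Open Scope ring_scope.
Local Open Scope complex_scope.

(* At a point w of Delta the derivative d_1^a d_2^b d_3^c s(w) is, up
   to Pochhammer factors, the function K_w(z) X_1^a X_2^b X_3^c with
   X_i = z_i / (1 - z_i w_i), and the jets of sigma_l are K_w (X_2 - X_3)^l times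
   a polynomial in X_2, X_3.  Hence sigma_m(v) vanishes to order m along z_2 = z_3, so
   it is orthogonal to the jets of order < m there; differentiating along
   z_2 = z_3 gives the orthogonality of the summands, and counting dimensions in
   each homogeneous degree gives that they fill the jet bundle.

   Irreducibility.  Let u_i be the frame of the jet bundle of rank k, so that
   u_i' = u_(i+1) + d_i along Delta, with d_i coming from z_1, and suppose that
   it splits as an orthogonal sum, with holomorphic projections u_i = x_i + y_i.
   As <x_i, y_j> = 0 on Delta, holomorphy in one argument and antiholomorphy in
   the other give <x_i', y_j> = <x_i, y_j'> = 0, and then <x_i', y_j'> = 0.  In
   <x_i', y_j'> the d-terms contribute a multiple of <x_i, y_j> = 0 because the
   z_1-factor of K splits off, so all that is left is the product of the
   u_(k-1)-coefficients of x_i and y_j times the squared distance of u_k to the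
   span of u_0, ..., u_(k-1).  One of the summands therefore has no
   u_(k-1)-component near a given point.  Being orthogonal to the other summand
   together with its derivatives, it then has no u_(k-2)-component either, and
   so on, hence it vanishes. *)

(** Holomorphy means only that complex derivatives exist, and no Cauchy theory is developed, so
    neither continuity of a derivative nor a second derivative comes for free. Two places need a
    substitute. Differentiability of the kernel jets in the norm of [M] is read off their Gram
    functions: the inner product of two difference quotients is a mixed second difference, so its
    convergence makes the quotients Cauchy. In the irreducibility argument, <x_i', y_j'> = 0 cannot
    be obtained by differentiating <x_i', y_j> = 0 in the holomorphic slot again. Instead y_j is
    frozen at t: the function <x_i'(t + h), y_j(t)> of h is a complex derivative, and it equals -
    conj h <x_i'(t), y_j'(t)> + o(h); no complex derivative behaves like a nonzero multiple of conj
    h. The o(h) uses continuity of x_i', which is obtained by solving a linear Gram system for the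
    derivatives of the coefficients with Cramer's rule. *)

(** * Directional derivatives as little-o estimates *)

Lemma is_derive_nearP (K : numFieldType) (V W : normedModType K) (f : V -> W)
    (x v : V) (d : W) :
  is_derive x v f d <->
  forall e : K, 0 < e ->
    \forall h \near 0, `|f (x + h *: v) - f x - h *: d| <= e * `|h|.
Proof.
split=> [[df <-] e e0|H].
  have /eqaddoP/(_ e e0) := derivable_nbhs df.
  apply: filterS => h /=.
  by rewrite !fctE/= opprD addrA /shift/= (addrC (h *: v)).
have H' : (fun h => h^-1 *: ((f \o shift x) (h *: v) - f x)) @ 0^' --> d.
  apply/cvgrPdist_le => e e0; have := H e e0.
  rewrite /= !(near_simpl, near_withinE); apply: filter_app; near=> h => Hh h0.
  rewrite /= /shift (addrC _ x) distrC.
  rewrite -[d](scalerK h0) -scalerBr normrZ normfV ler_pdivrMl ?normr_gt0//.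
  by rewrite mulrC.
split; first by apply/cvg_ex; exists d.
by apply: cvg_lim H'; exact: norm_hausdorff.
Unshelve. all: by end_near. Qed.

Lemma is_derive_line (K : numFieldType) (V W : normedModType K) (f : V -> W)
    (x v : V) (d : W) :
  is_derive x v f d <-> is_derive (0 : K^o) 1 (fun h : K^o => f (x + h *: v)) d.
Proof.
split=> /is_derive_nearP H; apply/is_derive_nearP => e /H; apply: filterS => h;
  by rewrite scale0r addr0 add0r [_%:A]mulr1.
Qed.

Lemma is_derive_chain1 (K : numFieldType) (W : normedModType K) (f : K -> K)
    (g : K -> W) (x : K) (a : K) (b : W) :
  is_derive x 1 f a -> is_derive (f x) 1 g b -> is_derive x 1 (g \o f) (a *: b).
Proof.
move=> [df <-] [dg <-].
move/derivable1_diffP in df; move/derivable1_diffP in dg.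
have dgf := differentiable_comp df dg.
split; first exact/derivable1_diffP.
rewrite (deriveE _ dgf).
have /(congr1 (fun h => h 1)) -> := diff_comp df dg.
rewrite (deriveE _ df).
rewrite (deriveE _ dg).
rewrite /comp.
rewrite -[X in 'd g _ X](mulr1 ('d f x 1)).
exact: linearZ.
Qed.

Lemma is_derive_chain (K : numFieldType) (V W : normedModType K) (f : V -> K)
    (g : K -> W) (x v : V) (a : K) (b : W) :
  is_derive x v f a -> is_derive (f x) 1 g b -> is_derive x v (g \o f) (a *: b).
Proof.
move=> /is_derive_line Hf Hg; apply/is_derive_line.
apply: (is_derive_chain1 Hf); by rewrite scale0r addr0.
Qed.


Lemma cvg_at_comp (T V U : topologicalType) (f : T -> V) (h : V -> U) (x : T) (a : V) :
  {for a, continuous h} -> f y @[y --> x] --> a -> h (f y) @[y --> x] --> h a.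
Proof. exact: continuous_cvg. Qed.
Arguments cvg_at_comp {T V U} f h {x a}.

Lemma cvg_at_distP (T : topologicalType) (K : numFieldType) (V : normedModType K)
    (f : T -> V) (x : T) (a : V) :
  f y @[y --> x] --> a <->
  forall e : K, 0 < e -> \forall y \near x, `|a - f y| <= e.
Proof. exact: cvgrPdist_le. Qed.

(** * Complex derivatives and the principal power *)

Section ComplexLine.
Variable R : realType.
Local Notation C := R[i].
Implicit Types (x y z : C) (a b c : R).

Lemma normc_real a : `|a%:C| = `|a|%:C :> C.
Proof. by rewrite normc_def/= expr0n addr0 sqrtr_sqr. Qed.

Lemma normc_i : `|'i| = 1 :> C.
Proof. by rewrite normc_def/= expr0n add0r expr1n sqrtr1. Qed.

Lemma normc_le_ReIm x : `|x| <= (`|complex.Re x| + `|complex.Im x|)%:C.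
Proof.
rewrite {1}[x]complexE (le_trans (ler_normD _ _))// normrM normc_i mul1r.
by rewrite !normc_real rmorphD.
Qed.

Lemma normc_ge_Im x : `|complex.Im x|%:C <= `|x|.
Proof.
have -> : complex.Im x = complex.Re (x * - 'i) by case: x => a b; simpc.
by rewrite (le_trans (normc_ge_Re _))// normrM normrN normc_i mulr1.
Qed.

Lemma gt0c_real (e : C) : 0 < e -> exists2 r : R, 0 < r & e = r%:C.
Proof.
move=> e0; have /complex_realP[r er] : e \is Num.real by exact: gtr0_real.
by exists r => //; rewrite er ltcR in e0.
Qed.

Lemma near0_Re (P : R -> Prop) :
  (\forall a \near 0, P a) -> \forall z \near (0 : C), P (complex.Re z).
Proof.
move/nbhs_norm0P => [e /= e0 H]; apply/nbhs_norm0P; exists e%:C => /=.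
  by rewrite ltcR.
move=> z /= ze; apply: H => /=; rewrite -ltcR.
exact: le_lt_trans (normc_ge_Re _) ze.
Qed.

Lemma near0_Im (P : R -> Prop) :
  (\forall a \near 0, P a) -> \forall z \near (0 : C), P (complex.Im z).
Proof.
move/nbhs_norm0P => [e /= e0 H]; apply/nbhs_norm0P; exists e%:C => /=.
  by rewrite ltcR.
move=> z /= ze; apply: H => /=; rewrite -ltcR.
exact: le_lt_trans (normc_ge_Im _) ze.
Qed.

Lemma continuous_Re : continuous (@complex.Re R : C -> R).
Proof.
move=> x; apply/cvg_at_distP => e e0.
apply/nbhs_normP; exists e%:C => /=; first by rewrite ltcR.
move=> y /= xy; rewrite -lecR; apply: le_trans (ltW xy).
by rewrite -raddfB; exact: normc_ge_Re.
Qed.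

Lemma continuous_Im : continuous (@complex.Im R : C -> R).
Proof.
move=> x; apply/cvg_at_distP => e e0.
apply/nbhs_normP; exists e%:C => /=; first by rewrite ltcR.
move=> y /= xy; rewrite -lecR; apply: le_trans (ltW xy).
by rewrite -raddfB; exact: normc_ge_Im.
Qed.

Definition cexp z : C := (expR (complex.Re z))%:C * (cos (complex.Im z) +i* sin (complex.Im z)).

(** The principal logarithm on the half-plane 0 < Re z, written so that [cpow x c] becomes
    [cexp (c%:C * clog x)] there. *)
Definition clog z : C :=
  ln (Num.sqrt (complex.Re z ^+ 2 + complex.Im z ^+ 2)) +i* atan (complex.Im z / complex.Re z).

Lemma cexpD x y : cexp (x + y) = cexp x * cexp y.
Proof.
rewrite /cexp; case: x y => a b [c d]; simpc => /=.
rewrite expRD cosD sinD.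
by apply/eqP; rewrite eq_complex/=; apply/andP; split; apply/eqP; ring.
Qed.

Lemma clogK x : 0 < complex.Re x -> cexp (clog x) = x.
Proof.
case: x => a b/= a0; rewrite /cexp/clog/=.
have ab0 : 0 < a ^+ 2 + b ^+ 2 by rewrite ltr_pwDl ?exprn_gt0 ?sqr_ge0.
rewrite lnK ?posrE ?sqrtr_gt0// cos_atan.
have -> : sin (atan (b / a)) = (b / a) / Num.sqrt (1 + (b / a) ^+ 2).
  have c0 : cos (atan (b / a)) != 0.
    by rewrite cos_atan invr_eq0 gt_eqF// sqrtr_gt0 ltr_pwDl// sqr_ge0.
  by rewrite -cos_atan -[X in _ = X * _](atanK (b / a)) /tan divfK.
have -> : 1 + (b / a) ^+ 2 = (a ^+ 2 + b ^+ 2) / a ^+ 2.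
  by rewrite mulrDl mulfV ?expf_neq0 ?gt_eqF// expr_div_n.
rewrite sqrtrM ?ltW// sqrtrV ?sqr_ge0// sqrtr_sqr gtr0_norm//.
have r0 : Num.sqrt (a ^+ 2 + b ^+ 2) != 0 by rewrite gt_eqF ?sqrtr_gt0.
have {}a0 : a != 0 by rewrite gt_eqF.
set r := Num.sqrt _ in r0 *.
by simpc; apply/eqP; rewrite eq_complex/=; apply/andP; split; apply/eqP; field; rewrite a0 r0.
Qed.

Lemma cpowE x c : 0 < complex.Re x -> cpow x c = cexp (c%:C * clog x).
Proof.
case: x => a b/= a0; rewrite /cpow/cexp/clog/=.
have ab0 : 0 < a ^+ 2 + b ^+ 2 by rewrite ltr_pwDl ?exprn_gt0 ?sqr_ge0.
by rewrite /powR gt_eqF ?sqrtr_gt0// !mul0r subr0 addr0.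
Qed.

Lemma is_derive_real_near (f : R -> R) (a b e : R) : is_derive a 1 f b -> 0 < e ->
  \forall h \near (0 : R), `|f (a + h) - f a - h * b| <= e * `|h|.
Proof.
move=> /is_derive_nearP H e0; apply: filterS (H e e0) => h.
by rewrite [_ *: 1]mulr1.
Qed.

Lemma cexp_derive0 : is_derive (0 : C) 1 cexp 1.
Proof.
apply/is_derive_nearP => _ /gt0c_real[e e0 ->].
(* Seven error terms of size at most d |z| are collected below, hence the 8; d <= 1 allows a factor
   |Re z| <= d to be dropped from the mixed products. *)
pose d := Num.min 1 (e / 8).
have d0 : 0 < d by rewrite lt_min ltr01 divr_gt0.
have d1 : d <= 1 by rewrite ge_min lexx.
have d8 : d <= e / 8 by rewrite ge_min lexx orbT.
have He := near0_Re (is_derive_real_near (is_derive_expR 0) d0).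
have Hs := near0_Im (is_derive_real_near (is_derive_sin 0) d0).
have Hc := near0_Im (is_derive_real_near (is_derive_cos 0) d0).
have Hb : \forall z \near (0 : C), `|complex.Re z| <= d.
  by apply: (@near0_Re (fun b => `|b| <= d)); apply: nbhs0_le.
near=> z.
have := normc_ge_Re z; have := normc_ge_Im z.
have /complex_realP[r rE] : `|z| \is Num.real by exact: normr_real.
rewrite rE => /[!lecR] H1 H2.
have Ha : `|complex.Re z| <= d by near: z.
have : `|cos (0 + complex.Im z) - cos 0 - complex.Im z * - sin 0| <= d * `|complex.Im z|.
  by near: z.
rewrite add0r cos0 sin0 oppr0 mulr0 subr0 => Hc1.
have : `|sin (0 + complex.Im z) - sin 0 - complex.Im z * cos 0| <= d * `|complex.Im z|.
  by near: z.
rewrite add0r cos0 sin0 mulr1 subr0 => Hs1.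
have : `|expR (0 + complex.Re z) - expR 0 - complex.Re z * expR 0| <= d * `|complex.Re z|.
  by near: z.
rewrite add0r expR0 mulr1 => He1.
rewrite !add0r [_ *: 1]mulr1 [cexp 0]/cexp/= expR0 sin0 cos0 mul1r /cexp.
rewrite [X in _ - _ - X](_ : z = complex.Re z +i* complex.Im z); last by case: (z).
move: (complex.Re z) (complex.Im z) H1 H2 Ha Hc1 Hs1 He1 => a b H1 H2 Ha Hc1 Hs1 He1.
apply: le_trans (normc_le_ReIm _) _; rewrite -rmorphM/= lecR; simpc => /=.
have -> : expR a * cos b - 1 - a = (expR a - 1 - a) * cos b + a * (cos b - 1) + (cos b - 1) by
  ring.
have -> : expR a * sin b - b = (expR a - 1 - a) * sin b + a * (sin b - b) + a * b + (sin b - b)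
  by ring.
have r0 : 0 <= r by rewrite (le_trans _ H1).
have dr : d * r <= e / 8 * r by rewrite ler_wpM2r.
have da : d * `|a| <= d * r by rewrite ler_wpM2l// ltW.
have db : d * `|b| <= d * r by rewrite ler_wpM2l// ltW.
have A1 : `|(expR a - 1 - a) * cos b| <= d * r.
  by rewrite normrM (le_trans (ler_piMr _ _))// ?(le_trans He1)// ler_norml cos_geN1 cos_le1.
have A2 : `|(expR a - 1 - a) * sin b| <= d * r.
  by rewrite normrM (le_trans (ler_piMr _ _))// ?(le_trans He1)// ler_norml sin_geN1 sin_le1.
have A3 : `|a * (cos b - 1)| <= d * r.
  by rewrite normrM (le_trans (ler_piMl _ _))// ?(le_trans Hc1)// (le_trans Ha).
have A4 : `|a * (sin b - b)| <= d * r.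
  by rewrite normrM (le_trans (ler_piMl _ _))// ?(le_trans Hs1)// (le_trans Ha).
have A5 : `|a * b| <= d * r by rewrite normrM ler_pM.
have A6 := le_trans Hc1 db; have A7 := le_trans Hs1 db.
apply: (@le_trans _ _ ((d * r + d * r + d * r) + (d * r + d * r + d * r + d * r))).
  apply: lerD; first by rewrite (le_trans (ler_normD _ _))// lerD// (le_trans (ler_normD _ _))//
    lerD.
  rewrite (le_trans (ler_normD _ _))// lerD// (le_trans (ler_normD _ _))// lerD//.
  by rewrite (le_trans (ler_normD _ _))// lerD.
have er : 0 <= e * r by rewrite mulr_ge0// ltW.
move: dr er; clear; rewrite mulrAC; move: (d * r) (e * r) => u v; lra.
Unshelve. all: by end_near. Qed.

Lemma cexp_derive z : is_derive z 1 cexp (cexp z).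
Proof.
have /is_derive_nearP H := cexp_derive0.
apply/is_derive_nearP => e e0.
have n0 : 0 < `|cexp z| + 1 by rewrite ltr_wpDl.
apply: filterS (H _ (divr_gt0 e0 n0)) => h.
have c0 : cexp 0 = 1 by rewrite /cexp/= expR0 cos0 sin0 mul1r.
rewrite add0r [_ *: 1]mulr1 cexpD c0 => Hh.
have -> : cexp z * cexp h - cexp z - h *: cexp z = cexp z * (cexp h - 1 - h).
  by rewrite mulrBr mulrBr mulr1 (mulrC _ h).
rewrite normrM; apply: le_trans (ler_wpM2l _ Hh) _ => //.
rewrite mulrA ler_wpM2r// mulrCA ler_piMr ?ltW//.
by rewrite ltr_pdivrMr// mul1r ltrDl.
Qed.

Lemma clog_continuous x : 0 < complex.Re x -> clog y @[y --> x] --> clog x.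
Proof.
move=> x0.
have cR := @continuous_Re x; have cI := @continuous_Im x.
have c1 : ln (Num.sqrt (complex.Re y ^+ 2 + complex.Im y ^+ 2)) @[y --> x] --> ln (Num.sqrt
  (complex.Re x ^+ 2 + complex.Im x ^+ 2)).
  apply: (cvg_at_comp (fun y : C => Num.sqrt (complex.Re y ^+ 2 + complex.Im y ^+ 2)) (@ln R)).
    by apply: continuous_ln; rewrite sqrtr_gt0 ltr_pwDl ?exprn_gt0 ?sqr_ge0.
  apply: (cvg_at_comp (fun y : C => complex.Re y ^+ 2 + complex.Im y ^+ 2) (@Num.sqrt R)).
    exact: sqrt_continuous.
  exact: (cvgD (cvgM cR cR) (cvgM cI cI)).
have c2 : atan (complex.Im y / complex.Re y) @[y --> x] --> atan (complex.Im x / complex.Re x).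
  apply: (cvg_at_comp (fun y : C => complex.Im y / complex.Re y) (@atan R)).
    exact: continuous_atan.
  by apply: (cvgM cI); apply: cvgV => //; rewrite gt_eqF.
apply/cvg_at_distP => _ /gt0c_real[e e0 ->].
have e2 : 0 < e / 2 by rewrite divr_gt0.
move/cvg_at_distP/(_ _ e2) in c1; move/cvg_at_distP/(_ _ e2) in c2.
near=> y; apply: le_trans (normc_le_ReIm _) _; rewrite lecR (splitr e) lerD//.
  by near: y.
by near: y.
Unshelve. all: by end_near. Qed.

Lemma near_halfplane x : 0 < complex.Re x -> \forall h \near (0 : C), 0 < complex.Re (x + h).
Proof.
move=> x0; have : \forall a \near (0 : R), `|a| < complex.Re x by exact: nbhs0_lt.
move/near0_Re; apply: filterS => h; rewrite raddfD/= ltr_norml => /andP[+ _].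
by rewrite -subr_gt0 opprK addrC.
Qed.

(** The logarithm is differentiated as a continuous inverse. With k = clog (x + h) - clog x, the
    expansion of [cexp] at [clog x] says that h - k x is o(k), and this bound itself yields |k| =
    O(|h|). *)
Lemma clog_derive x : 0 < complex.Re x -> is_derive x 1 clog x^-1.
Proof.
move=> x0; apply/is_derive_nearP => e e0.
have xn0 : x != 0 by apply: contraTN x0 => /eqP ->; rewrite ltxx.
have nx0 : 0 < `|x| by rewrite normr_gt0.
have /is_derive_nearP E := cexp_derive (clog x).
have [N NE] : exists N, `|x| = N%:C by apply/complex_realP/normr_real.
have [e' e'0 eE] := gt0c_real e0.
have N0 : 0 < N by rewrite -ltcR -NE.
(* With N = |x|, the bound d <= N / 2 gives |k| N <= 2 |h|, and d <= N (e' N) / 2 then turns the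
   error d |k| into e' N |h|. *)
pose d := N * Num.min 1 (e' * N) / 2.
have d0 : 0 < d by rewrite !mulr_gt0// lt_min ltr01 mulr_gt0.
have d1 : d <= N / 2 by rewrite ler_wpM2r// ler_piMr ?ge_min ?lexx// ltW.
have d2 : d <= N * (e' * N) / 2.
  by rewrite ler_wpM2r// ler_wpM2l ?ge_min ?lexx ?orbT// ltW.
have ck : clog (x + h) - clog x @[h --> (0:C)] --> (0:C).
  have c1 : x + h @[h --> (0 : C)] --> x.
    apply/cvg_at_distP => e1 e10; apply: filterS (nbhs0_le e10) => h.
    by rewrite opprD addNKr normrN.
  have /cvg_at_distP c2 := cvg_at_comp (fun h : C => x + h) clog (clog_continuous x0) c1.
  apply/cvg_at_distP => e1 /c2; apply: filterS => h.
  by rewrite sub0r opprB.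
have dC : 0 < d%:C :> C by rewrite ltcR.
have Hk := ck _ (E d%:C dC).
have Hx := near_halfplane x0.
near=> h.
rewrite [_ *: 1]mulr1 eE.
have : `|cexp (clog x + (clog (x + h) - clog x) *: 1) - cexp (clog x) - (clog (x + h) - clog x)
  *: cexp (clog x)| <= d%:C * `|clog (x + h) - clog x|.
  by near: h; exact: Hk.
have xh0 : 0 < complex.Re (x + h) by near: h.
set k := clog (x + h) - clog x.
rewrite [_ *: 1]mulr1 (addrC (clog x) k) {1}/k subrK !clogK// [_ *: x]/(_ * _) (addrC x) addrK.
have [r rE] : exists r, `|k| = r%:C by apply/complex_realP/normr_real.
have [s sE] : exists s, `|h| = s%:C by apply/complex_realP/normr_real.
have [t tE] : exists t, `|k - h *: x^-1| = t%:C by apply/complex_realP/normr_real.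
have [u uE] : exists u, `|h - k * x| = u%:C by apply/complex_realP/normr_real.
rewrite rE sE uE tE -!rmorphM/= !lecR => H1.
have tu : u = t * N.
  apply: complexI; rewrite rmorphM/= -NE -tE -uE -normrM distrC [in RHS]mulrBl.
  by rewrite -scalerAl mulVf ?[_ *: 1]mulr1.
have H2 : r * N <= s + u.
  rewrite -lecR rmorphM rmorphD/= -NE -rE -sE -uE -normrM.
  by rewrite -[X in `|X| <= _](subrK h) addrC (le_trans (ler_normD _ _))// lerD2l distrC.
have r0 : 0 <= r by rewrite -ler0c -rE.
have s0 : 0 <= s by rewrite -ler0c -sE.
have H3 : d * r <= N / 2 * r by rewrite ler_wpM2r.
have H4 : r * N <= 2 * s by move: H1 H2 H3; clear; lra.
have H5 : d * r <= N * (e' * N) / 2 * r by rewrite ler_wpM2r.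
rewrite -(ler_pM2r N0) -tu.
have H6 : e' * N * (r * N) <= e' * N * (2 * s) by rewrite ler_wpM2l// mulr_ge0 ?ltW.
by move: H1 H5 H6; clear; lra.
Unshelve. all: by end_near. Qed.

Lemma cpow_neq0 x c : 0 < complex.Re x -> cpow x c != 0.
Proof.
move=> x0; rewrite cpowE//; apply: contra_eq_neq (cexpD (c%:C * clog x) (- (c%:C * clog x))) =>
  ->.
by rewrite subrr mul0r /cexp/= expR0 cos0 sin0 mul1r oner_neq0.
Qed.

Lemma cpowS x c : 0 < complex.Re x -> cpow x (c + 1) = x * cpow x c.
Proof.
move=> x0; rewrite !cpowE// rmorphD mulrDl cexpD rmorph1 mul1r clogK//.
by rewrite mulrC.
Qed.

Lemma cpow1 c : cpow (1 : C) c = 1.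
Proof.
rewrite /cpow/= mul0r expr1n expr0n/= addr0 sqrtr1 powR1 atan0 mulr0 cos0 sin0.
by rewrite mul1r.
Qed.

Lemma cpow_conj x c : conjc (cpow x c) = cpow (conjc x) c.
Proof.
case: x => a b; rewrite /cpow/= sqrrN mulNr atanN mulrN cosN sinN.
by apply/eqP; rewrite eq_complex/= !mul0r ?subr0 ?addr0 mulrN !eqxx.
Qed.
Lemma cpow_derive x c : 0 < complex.Re x ->
  is_derive x 1 (fun y => cpow y c) (c%:C * cpow x (c - 1)).
Proof.
move=> x0.
have D : is_derive x 1 (cexp \o (fun y => c%:C * clog y)) ((c%:C * x^-1) *: cexp (c%:C * clog x)).
  apply: is_derive_chain; last exact: cexp_derive.
  have -> : (fun y => c%:C * clog y) = c%:C *: (clog : C -> C) by [].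
  apply: is_deriveZ; exact: clog_derive.
have -> : c%:C * cpow x (c - 1) = (c%:C * x^-1) *: cexp (c%:C * clog x).
  have E : cpow x c = x * cpow x (c - 1) by rewrite -cpowS// subrK.
  rewrite -cpowE// E -[_ *: _]/(c%:C / x * (x * cpow x (c - 1))) mulrA divfK//.
  by apply: contraTneq x0 => ->; rewrite ltxx.
move/is_derive_nearP in D; apply/is_derive_nearP => e /D H.
have Hx := near_halfplane x0.
near=> h.
have xh : 0 < complex.Re (x + h) by near: h.
have : `|cexp (c%:C * clog (x + h *: 1)) - cexp (c%:C * clog x) -
    h *: ((c%:C / x) *: cexp (c%:C * clog x))| <= e * `|h| by near: h.
by rewrite [_ *: 1]mulr1 !cpowE.
Unshelve. all: by end_near. Qed.

End ComplexLine.

(** * Mean value estimates over the complex numbers *)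

Section MeanValue.
Variable R : realType.
Local Notation C := R[i].

Lemma normc_realE (K : normedZmodType C) (x : K) : exists2 r : R, 0 <= r & `|x| = r%:C.
Proof.
have /complex_realP[r rE] : `|x| \is Num.real by exact: normr_real.
by exists r => //; rewrite -ler0c -rE.
Qed.

Lemma nearC0P (P : C -> Prop) : (\forall h \near (0 : C), P h) <->
  exists2 d : R, 0 < d & forall h, `|h| < d%:C -> P h.
Proof.
split=> [/nbhs_norm0P[_ /= /gt0c_real[d d0 ->] H]|[d d0 H]].
  by exists d => // h hd; exact: H.
by apply/nbhs_norm0P; exists d%:C => //=; rewrite ltcR.
Qed.

Lemma near_shiftC (P : C -> Prop) (x : C) :
  (\forall y \near x, P y) <-> (\forall h \near (0 : C), P (x + h)).
Proof.
split=> [/nbhs_normP[_ /= /gt0c_real[d d0 ->] H]|/nearC0P[d d0 H]].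
  by apply/nearC0P; exists d => // h hd; apply: H => /=; rewrite opprD addNKr normrN.
apply/nbhs_normP; exists d%:C => /=; first by rewrite ltcR.
by move=> y /=; rewrite distrC => /H; rewrite addrC subrK.
Qed.

Lemma rcM (a b : R) : (a * b)%:C = a%:C * b%:C :> C.
Proof. exact: rmorphM. Qed.

Lemma rcD (a b : R) : (a + b)%:C = a%:C + b%:C :> C.
Proof. exact: rmorphD. Qed.

(** The mean value equality fails for complex values, so the real theorem is applied to the real
    part along the segment. *)
Lemma mean_value_Re (f df : C -> C) (p d : C) (B : R) :
  (forall s : R, 0 <= s <= 1 -> is_derive (p + s%:C * d) 1 f (df (p + s%:C * d))) ->
  (forall s : R, 0 <= s <= 1 -> `|df (p + s%:C * d)| <= B%:C) ->
  `|complex.Re (f (p + d) - f p)|%:C <= B%:C * `|d|.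
Proof.
move=> Hf HB; have [D D0 DE] := normc_realE d.
pose g (s : R) : R := complex.Re (f (p + s%:C * d)).
have Hg (s : R) : 0 <= s <= 1 -> is_derive s 1 g (complex.Re (d * df (p + s%:C * d))).
  move=> s01; apply/is_derive_nearP => e e0.
  have D1 : 0 < D + 1 by rewrite ltr_wpDl.
  have eD : 0 < (e / (D + 1))%:C by rewrite ltcR divr_gt0.
  have /is_derive_nearP/(_ _ eD)/nearC0P[r r0 H] := Hf _ s01.
  have : \forall h \near (0 : R), `|h| < r / (D + 1) by apply: nbhs0_lt; rewrite divr_gt0.
  apply: filterS => h hr; rewrite [_ *: 1]mulr1 /g.
  have nh : `|h%:C * d| = (`|h| * D)%:C by rewrite normrM normc_real DE rmorphM.
  have /H : `|h%:C * d| < r%:C.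
    rewrite nh ltcR; apply: (@le_lt_trans _ _ (`|h| * (D + 1))).
      by rewrite ler_wpM2l// lerDl.
    by rewrite -ltr_pdivlMr.
  rewrite nh [_ *: 1]mulr1 => H1.
  have -> : (s + h)%:C * d = s%:C * d + h%:C * d by rewrite rmorphD mulrDl.
  rewrite addrA -lecR; apply: le_trans.
    have E : h *: complex.Re (d * df (p + s%:C * d)) = complex.Re ((h%:C * d) *: df (p + s%:C *
      d)).
      rewrite -[X in _ = complex.Re X]/(_ * _) -mulrA.
      by move: (d * _) => [a b] /=; rewrite mul0r subr0.
    by rewrite E -!raddfB; exact: normc_ge_Re.
  apply: le_trans H1 _; rewrite -rmorphM/= lecR.
  by rewrite mulrCA mulrC ler_wpM2r// -mulrA ler_piMr ?ltW// mulrC ltr_pdivrMr// mul1r ltrDl.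
have cg : {within `[0%R, 1%R], continuous g}.
  apply: derivable_within_continuous => s; rewrite in_itv/= => s01.
  by case: (Hg s s01).
have [] := @MVT R g (fun s => complex.Re (d * df (p + s%:C * d))) 0 1 ltr01 _ cg.
  by move=> s; rewrite in_itv/= => /andP[s0 s1]; apply: Hg; rewrite !ltW.
move=> s; rewrite in_itv/= => /andP[s0 s1]; rewrite subr0 mulr1 /g mul0r addr0 mul1r => E.
rewrite raddfB E; apply: le_trans (normc_ge_Re _) _.
by rewrite normrM mulrC ler_wpM2r// HB// !ltW.
Qed.

(** The imaginary part of f is the real part of - i f; adding the two bounds costs the factor 2. *)
Lemma mean_value (f df : C -> C) (p d : C) (B : R) :
  (forall s : R, 0 <= s <= 1 -> is_derive (p + s%:C * d) 1 f (df (p + s%:C * d))) ->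
  (forall s : R, 0 <= s <= 1 -> `|df (p + s%:C * d)| <= B%:C) ->
  `|f (p + d) - f p| <= (2 * B)%:C * `|d|.
Proof.
move=> Hf HB.
have H1 := mean_value_Re Hf HB.
have := @mean_value_Re ((- 'i) *: f) (fun x => (- 'i) *: df x) p d B _ _.
have -> : ((- 'i) *: f) (p + d) - ((- 'i) *: f) p = (f (p + d) - f p) * (- 'i).
  by rewrite mulrC mulrBr.
have -> : complex.Re ((f (p + d) - f p) * (- 'i)) = complex.Im (f (p + d) - f p).
  by case: (f (p + d) - f p) => a b; simpc.
move=> H2; apply: le_trans (normc_le_ReIm _) _.
rewrite rmorphD -[2]/(1 + 1) mulrDl mul1r rmorphD mulrDl lerD//; apply: H2.
  by move=> s s01; apply: is_deriveZ; exact: Hf.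
by move=> s s01; rewrite normrZ normrN normc_i mul1r HB.
Qed.

Lemma is_derive_cmul (c x : C) : is_derive x 1 (fun v : C => c * v) c.
Proof.
apply/is_derive_nearP => e e0; near=> h.
rewrite [_ *: 1]mulr1 -[h *: c]/(h * c).
have -> : c * (x + h) - c * x - h * c = 0 by ring.
by rewrite normr0 mulr_ge0// ltW.
Unshelve. all: by end_near. Qed.

(** Two nested mean value estimates, in t and then in s, after subtracting c s t. The error has to
    carry the product |s| |t| because [derivable_of_mixed] divides it by s and t. *)
Lemma mixed_difference (F F1 F12 : C -> C -> C) (r : R) : 0 < r ->
  (forall s t : C, `|s| < r%:C -> `|t| < r%:C -> is_derive s 1 (F ^~ t) (F1 s t)) ->
  (forall s t : C, `|s| < r%:C -> `|t| < r%:C -> is_derive t 1 (F1 s) (F12 s t)) ->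
  (forall e : R, 0 < e -> exists2 d : R, 0 < d &
     forall s t : C, `|s| < d%:C -> `|t| < d%:C -> `|F12 s t - F12 0 0| <= e%:C) ->
  forall e : R, 0 < e -> exists2 d : R, 0 < d &
    forall s t : C, `|s| < d%:C -> `|t| < d%:C ->
      `|F s t - F s 0 - F 0 t + F 0 0 - F12 0 0 * s * t| <= e%:C * `|s| * `|t|.
Proof.
move=> r0 H1 H12 Hc e e0; set c := F12 0 0.
(* Each of the two mean value estimates doubles the bound. *)
have e4 : 0 < e / 4 by rewrite divr_gt0.
have [d1 d10 Hd1] := Hc _ e4.
exists (Num.min r d1); first by rewrite lt_min r0.
have small (x : C) : `|x| < (Num.min r d1)%:C -> `|x| < r%:C /\ `|x| < d1%:C.
  have [a _ ->] := normc_realE x; rewrite !ltcR lt_min; by move/andP.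
have scale (x : C) (a : R) (b : R) : 0 <= a <= 1 -> `|x| < b%:C -> `|a%:C * x| < b%:C.
  move=> /andP[a0 a1]; apply: le_lt_trans.
  by rewrite normrM normc_real (ger0_norm a0) ler_piMl// lecR.
move=> s t /small[sr sd] /small[tr td].
have r0c : `|0 : C| < r%:C by rewrite normr0 ltcR.
have d0c : `|0 : C| < d1%:C by rewrite normr0 ltcR.
have [n n0 nE] := normc_realE t.
have B1 (u : C) : `|u| < r%:C -> `|u| < d1%:C -> `|F1 u t - F1 u 0 - c * t| <= (2 * (e / 4) *
  n)%:C.
  move=> ur ud.
  have := @mean_value (fun v => F1 u v - c * v) (fun v => F12 u v - c) 0 t (e / 4) _ _.
  rewrite !add0r mulr0 subr0 addrAC nE -rmorphM; apply.
    move=> a a01; rewrite add0r; apply: is_deriveB; first by apply: H12 => //; apply: (scale _ a).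
    exact: is_derive_cmul.
  by move=> a a01; rewrite add0r; apply: Hd1 => //; exact: scale.
have := @mean_value (fun u => F u t - F u 0 - c * t * u) (fun u => F1 u t - F1 u 0 - c * t) 0 s
  (2 * (e / 4) * n) _ _.
rewrite !add0r mulr0 subr0.
have -> : F s t - F s 0 - c * t * s - (F 0 t - F 0 0) = F s t - F s 0 - F 0 t + F 0 0 - c * s * t
  by ring.
have -> : 2 * (2 * (e / 4) * n) = e * n by field.
have -> : e%:C * `|s| * `|t| = (e * n)%:C * `|s| by rewrite nE rmorphM mulrAC.
apply.
  move=> a a01; rewrite add0r.
  have Hs := scale _ _ _ a01 sr.
  apply: is_deriveB; first by apply: is_deriveB; exact: H1.
  exact: is_derive_cmul.
by move=> a a01; rewrite add0r; apply: B1; exact: scale.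
Qed.

Lemma is_derive_quad (a b p x : C) :
  is_derive x 1 (fun h : C => a * (h - p) + b * (h - p) ^+ 2) (a + 2 * b * (x - p)).
Proof.
apply/is_derive_nearP => e e0.
have b1 : 0 < `|b| + 1 by rewrite ltr_wpDl.
have : \forall h \near (0 : C), `|h| <= e / (`|b| + 1) by apply: nbhs0_le; rewrite divr_gt0.
apply: filterS => h hb; rewrite [_ *: 1]mulr1 -[h *: _]/(h * _).
have -> : a * (x + h - p) + b * (x + h - p) ^+ 2 - (a * (x - p) + b * (x - p) ^+ 2) - h * (a + 2
  * b * (x - p)) = b * h * h by ring.
rewrite !normrM ler_wpM2r//; apply: le_trans (ler_wpM2l _ hb) _ => //.
by rewrite mulrCA ler_piMr ?ltW// ltr_pdivrMr// mul1r ltrDl.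
Qed.

Lemma conjc_half (x : C) : conjc (x / 2) = conjc x / 2.
Proof. by rewrite rmorphM fmorphV rmorph_nat. Qed.

Lemma conjcD (x y : C) : conjc (x + y) = conjc x + conjc y.
Proof. exact: rmorphD. Qed.

Lemma conjcN (x : C) : conjc (- x) = - conjc x.
Proof. exact: rmorphN. Qed.

Lemma conjcM (x y : C) : conjc (x * y) = conjc x * conjc y.
Proof. exact: rmorphM. Qed.

(** The last term is c times the integral of conj h over the segment, which is d times the conjugate
    of the midpoint. *)
Lemma segment_estimate (f df : C -> C) (c p d : C) (B : R) : d != 0 ->
  (forall s : R, 0 <= s <= 1 -> is_derive (p + s%:C * d) 1 f (df (p + s%:C * d))) ->
  (forall s : R, 0 <= s <= 1 ->
     `|df (p + s%:C * d) + c * conjc (p + s%:C * d)| <= B%:C) ->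
  `|f (p + d) - f p + c * d * conjc (p + d / 2)| <= (2 * B)%:C * `|d|.
Proof.
move=> d0 Hf HB.
(* On the line through p with direction d, conj h is the affine function conj p + (conj d / d) (h -
   p). Its multiple by c has the holomorphic primitive [q], so the small quantity in the hypothesis
   is the derivative of f + q on the segment. *)
pose q (h : C) : C := c * conjc p * (h - p) + c * (conjc d / d) / 2 * (h - p) ^+ 2.
pose dq (h : C) : C := c * conjc p + 2 * (c * (conjc d / d) / 2) * (h - p).
have n2 : (2 : C) != 0 by rewrite pnatr_eq0.
have Hq (x : C) : is_derive x 1 q (dq x) by exact: is_derive_quad.
have H1 (s : R) : 0 <= s <= 1 ->
    is_derive (p + s%:C * d) 1 (f + q) ((fun h => df h + dq h) (p + s%:C * d)).
  move=> s01.
  have Hfs := Hf s s01.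
  have Hqs := Hq (p + s%:C * d).
  exact: is_deriveD Hfs Hqs.
have H2 (s : R) : 0 <= s <= 1 -> `|(fun h => df h + dq h) (p + s%:C * d)| <= B%:C.
  move=> s01.
  have -> // : df (p + s%:C * d) + dq (p + s%:C * d) = df (p + s%:C * d) + c * conjc (p + s%:C *
    d).
    rewrite /dq (addrC p) addrK conjcD conjcM conjc_real.
    by field; rewrite ?d0 ?n2.
  exact: HB.
apply: le_trans (@mean_value (f + q) (fun h => df h + dq h) p d B H1 H2).
have -> : (f + q) (p + d) - (f + q) p = f (p + d) - f p + c * d * conjc (p + d / 2).
  rewrite !fctE /q subrr mulr0 expr0n mulr0 addr0 addr0.
  rewrite (addrC p d) addrK conjcD conjc_half.
  by field; rewrite ?d0 ?n2.
exact: lexx.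
Qed.

(* Around the triangle 0, r, ir the form [conj h dh] integrates to [i r^2]
   (twice its area times [i]), while [df dh] integrates to 0. *)
Lemma antiholomorphic_derivative_eq0 (f df : C -> C) (c : C) :
  (\forall h \near (0 : C), is_derive (h : C) 1 f (df h)) ->
  (forall e : C, 0 < e -> \forall h \near (0 : C), `|df h + c * conjc h| <= e * `|h|) ->
  c = 0.
Proof.
move=> /nearC0P[d1 d10 H1] H2; apply/eqP; rewrite -normr_eq0.
have [n n0 nE] := normc_realE c.
suff : n <= 0 by rewrite nE => n1; have -> : n = 0 by apply/le_anti/andP.
apply/ler_addgt0Pl => e e0; rewrite addr0.
(* Every side has length at most 2 r, so it contributes at most 2 (e / 16) r times 2 r, that is e
   r^2 / 4; the three sides stay below e r^2. *)
have e16 : 0 < e / 16 by rewrite divr_gt0.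
have e8C : 0 < (e / 16)%:C :> C by rewrite ltcR.
have /nearC0P[d2 d20 H3] := H2 _ e8C.
pose r := Num.min d1 d2 / 2.
have r0 : 0 < r by rewrite divr_gt0// lt_min d10.
have rm : r < Num.min d1 d2 by rewrite ltr_pdivrMr// ltr_pMr ?lt_min ?d10// ltr1n.
have rd1 : r < d1 by apply: lt_le_trans rm _; rewrite ge_min lexx.
have rd2 : r < d2 by apply: lt_le_trans rm _; rewrite ge_min lexx orbT.
clearbody r.
have rC0 : r%:C != 0 :> C by rewrite gt_eqF// ltcR.
have seg (p d : C) : d != 0 -> (forall s : R, 0 <= s <= 1 -> `|p + s%:C * d| <= r%:C) ->
    `|d| <= (2 * r)%:C ->
    `|f (p + d) - f p + c * d * conjc (p + d / 2)| <= (e / 4 * r * r)%:C.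
  move=> dn0 Hr dr.
  have rlt x : `|x : C| <= r%:C -> `|x| < d1%:C /\ `|x| < d2%:C.
    by move=> xr; split; apply: le_lt_trans xr _; rewrite ltcR.
  have := @segment_estimate f df c p d (e / 16 * r) dn0 _ _.
  have -> : (e / 4 * r * r)%:C = (2 * (e / 16 * r))%:C * (2 * r)%:C.
    by rewrite -rmorphM/=; congr (_%:C); field.
  move=> H; apply: le_trans (H _ _) _.
  - by move=> s /Hr/rlt[? _]; exact: H1.
  - move=> s /Hr hr; have [_ ?] := rlt _ hr; apply: le_trans (H3 _ _) _ => //.
    have -> : (e / 16 * r)%:C = (e / 16)%:C * r%:C :> C by rewrite -rmorphM.
    by rewrite ler_wpM2l// ltW.
  - by rewrite ler_wpM2l// ler0c mulr_ge0// mulr_ge0 ?(ltW r0) ?(ltW e16).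
have i0 : 'i != 0 :> C by rewrite -normr_eq0 normc_i oner_neq0.
have s1 := seg 0 r%:C rC0 _ _.
have s2 := seg r%:C (('i - 1) * r%:C) _ _ _.
have s3 := seg ('i * r%:C) (- ('i * r%:C)) _ _ _.
have {}s1 : `|f r%:C - f 0 + c * r%:C * conjc (r%:C / 2)| <= (e / 4 * r * r)%:C.
  move: s1; rewrite !add0r; apply.
    move=> s /andP[s0 s1]; rewrite add0r normrM !normc_real -rmorphM lecR.
    by rewrite !ger0_norm// ?ler_piMl// ltW.
  by rewrite normc_real lecR gtr0_norm// ler_peMl ?ler1n ?(ltW r0).
have {}s2 : `|f ('i * r%:C) - f r%:C + c * (('i - 1) * r%:C) * conjc (r%:C + ('i - 1) * r%:C /
  2)| <= (e / 4 * r * r)%:C.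
  have E : r%:C + ('i - 1) * r%:C = 'i * r%:C by ring.
  move: s2; rewrite E; apply.
  - rewrite mulf_neq0// subr_eq0; apply/eqP => -[/eqP].
    by rewrite eq_sym oner_eq0.
  - move=> s /andP[s0 s_1].
    have -> : r%:C + s%:C * (('i - 1) * r%:C) = (1 - s)%:C * r%:C + s%:C * r%:C * 'i.
      by rewrite rmorphB rmorph1; ring.
    apply: le_trans (ler_normD _ _) _.
    rewrite !normrM normc_i mulr1 !normc_real -!rcM -rcD lecR.
    rewrite (@ger0_norm _ (1 - s)) ?subr_ge0// (ger0_norm s0) gtr0_norm//.
    by rewrite -mulrDl subrK mul1r.
    rewrite normrM normc_real (gtr0_norm r0) (rcM 2 r) ler_wpM2r ?ler0c ?(ltW r0)//.
    apply: le_trans (ler_normB _ _) _.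
    by rewrite normc_i normr1 -[2]/(1 + 1) rcD.
have {}s3 : `|f 0 - f ('i * r%:C) + c * (- ('i * r%:C)) * conjc ('i * r%:C + - ('i * r%:C) / 2)|
  <= (e / 4 * r * r)%:C.
  move: s3; rewrite subrr; apply.
  - by rewrite oppr_eq0 mulf_neq0.
  - move=> s /andP[s0 s_1].
    have -> : 'i * r%:C + s%:C * - ('i * r%:C) = (1 - s)%:C * r%:C * 'i.
      by rewrite rmorphB rmorph1; ring.
    rewrite !normrM normc_i mulr1 !normc_real -!rcM lecR.
    rewrite (@ger0_norm _ (1 - s)) ?subr_ge0// gtr0_norm//.
    by rewrite ler_piMl ?(ltW r0)// lerBlDr lerDl.
  - by rewrite normrN normrM normc_i mul1r normc_real lecR gtr0_norm// ler_peMl ?ler1n ?(ltW r0).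
have := ler_normD (f r%:C - f 0 + c * r%:C * conjc (r%:C / 2)) (f ('i * r%:C) - f r%:C + c * (('i
  - 1) * r%:C) * conjc (r%:C + ('i - 1) * r%:C / 2)).
move/le_trans/(_ (lerD s1 s2)) => s12.
have := ler_normD (f r%:C - f 0 + c * r%:C * conjc (r%:C / 2) + (f ('i * r%:C) - f r%:C + c *
  (('i - 1) * r%:C) * conjc (r%:C + ('i - 1) * r%:C / 2))) (f 0 - f ('i * r%:C) + c * (- ('i *
  r%:C)) * conjc ('i * r%:C + - ('i * r%:C) / 2)).
move/le_trans/(_ (lerD s12 s3)).
have -> : f r%:C - f 0 + c * r%:C * conjc (r%:C / 2) + (f ('i * r%:C) - f r%:C + c * (('i - 1) *
  r%:C) * conjc (r%:C + ('i - 1) * r%:C / 2)) + (f 0 - f ('i * r%:C) + c * (- ('i * r%:C)) *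
  conjc ('i * r%:C + - ('i * r%:C) / 2)) = c * ('i * (r * r)%:C).
  have -> : conjc (r%:C / 2) = r%:C / 2 :> C by rewrite conjc_half conjc_real.
  have ci : conjc 'i = - 'i :> C by simpc.
  have -> : conjc (r%:C + ('i - 1) * r%:C / 2) = r%:C + (- 'i - 1) * r%:C / 2 :> C.
    by rewrite conjcD conjc_half conjcM conjcD conjcN ci conjc_real conjc1.
  have -> : conjc ('i * r%:C + - ('i * r%:C) / 2) = - 'i * r%:C + 'i * r%:C / 2 :> C.
    by rewrite conjcD conjc_half conjcN conjcM ci conjc_real mulNr opprK.
  rewrite (rcM r r).
  move: (f 0) (f r%:C) (f ('i * r%:C)) => a1 a2 a3.
  by move: ('i : C) (r%:C : C) => i z; field.
rewrite !normrM normc_i mul1r nE normc_real -!rcD -rcM lecR.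
rewrite ger0_norm ?mulr_ge0 ?(ltW r0)// => Hn.
have : n * (r * r) <= e * (r * r).
  have : 0 <= e * (r * r) by rewrite !mulr_ge0 ?ltW.
  by move: Hn; clear; lra.
by rewrite ler_pM2r ?mulr_gt0.
Qed.
End MeanValue.

(** * Differentiating inner products *)

Section InnerProduct.
Variables (R : realType) (T : Type) (D : set T) (K : T -> T -> R[i]).
Variable M : rkhs D K.
Local Notation C := R[i].
Implicit Types (f g h : M) (a : C).

Lemma ipDl f g h : ip (f + g) h = ip f h + ip g h.
Proof. by have := ip_linearl 1 f g h; rewrite scale1r mul1r. Qed.

Lemma ip0l h : ip 0 h = 0.
Proof. by have := ipDl 0 0 h; rewrite addr0 => /eqP; rewrite -subr_eq0 opprD addNKr oppr_eq0 =>
  /eqP. Qed.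

Lemma ipZl a f h : ip (a *: f) h = a * ip f h.
Proof. by have := ip_linearl a f 0 h; rewrite addr0 ip0l addr0. Qed.

Lemma ipNl f h : ip (- f) h = - ip f h.
Proof. by rewrite -scaleN1r ipZl mulN1r. Qed.

Lemma ipBl f g h : ip (f - g) h = ip f h - ip g h.
Proof. by rewrite ipDl ipNl. Qed.

Lemma ip_suml (I : Type) (r : seq I) (P : pred I) (F : I -> M) h :
  ip (\sum_(i <- r | P i) F i) h = \sum_(i <- r | P i) ip (F i) h.
Proof.
elim: r => [|i r IH]; first by rewrite !big_nil ip0l.
by rewrite !big_cons; case: (P i); rewrite ?ipDl IH.
Qed.

Lemma ipDr f g h : ip h (f + g) = ip h f + ip h g.
Proof. by rewrite ip_conj ipDl conjcD -!ip_conj. Qed.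

Lemma ip0r h : ip h 0 = 0.
Proof. by rewrite ip_conj ip0l conjc0. Qed.

Lemma ipZr a f h : ip h (a *: f) = conjc a * ip h f.
Proof. by rewrite ip_conj ipZl conjcM -ip_conj. Qed.

Lemma ipNr f h : ip h (- f) = - ip h f.
Proof. by rewrite ip_conj ipNl conjcN -ip_conj. Qed.

Lemma ipBr f g h : ip h (f - g) = ip h f - ip h g.
Proof. by rewrite ipDr ipNr. Qed.

Lemma ip_sumr (I : Type) (r : seq I) (P : pred I) (F : I -> M) h :
  ip h (\sum_(i <- r | P i) F i) = \sum_(i <- r | P i) ip h (F i).
Proof.
elim: r => [|i r IH]; first by rewrite !big_nil ip0r.
by rewrite !big_cons; case: (P i); rewrite ?ipDr IH.
Qed.

Lemma ip_eq0 f : ip f f = 0 -> f = 0.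
Proof. by rewrite ip_norm => /eqP; rewrite expf_eq0/= normr_eq0 => /eqP. Qed.

Lemma ip_eq0C f g : ip f g = 0 -> ip g f = 0.
Proof. by rewrite (ip_conj f g) => ->; rewrite conjc0. Qed.

Lemma cauchy_schwarz f g : `|ip f g| <= `|f| * `|g|.
Proof.
have [->|g0] := eqVneq g 0; first by rewrite ip0r normr0 mulr_ge0.
have ng : 0 < `|g| by rewrite normr_gt0.
have ng2 : `|g| ^+ 2 != 0 by rewrite expf_neq0// gt_eqF.
rewrite -(@ler_pXn2r _ 2)// ?nnegrE ?mulr_ge0//.
have : 0 <= ip (f - (ip f g / `|g| ^+ 2) *: g) (f - (ip f g / `|g| ^+ 2) *: g).
  by rewrite ip_norm exprn_ge0.
rewrite !(ipBl, ipBr, ipZl, ipZr) !ip_norm (ip_conj f g) exprMn.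
have cg : conjc (`|g| ^+ 2) = `|g| ^+ 2 by rewrite -ip_norm -ip_conj.
have -> : conjc (ip f g / `|g| ^+ 2) = conjc (ip f g) / `|g| ^+ 2.
  by rewrite conjcM; congr (_ * _); rewrite -[in RHS]cg; exact: fmorphV.
rewrite sqr_normc; move: (ip f g) (`|f| ^+ 2) ng2 => u v ng2.
have -> : v - conjc u / `|g| ^+ 2 * u - u / `|g| ^+ 2 * (conjc u - conjc u / `|g| ^+ 2 * `|g| ^+
  2) = v - u * conjc u / `|g| ^+ 2.
  by rewrite divfK// subrr mulr0 subr0 mulrAC (mulrC u).
by rewrite subr_ge0 ler_pdivrMr ?exprn_gt0.
Qed.

Lemma is_derive_ipl (V : normedModType C) (f : V -> M) (x v : V) (d g : M) :
  is_derive x v f d -> is_derive x v (fun y => ip (f y) g) (ip d g).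
Proof.
move=> /is_derive_nearP H; apply/is_derive_nearP => e e0.
have g1 : 0 < `|g| + 1 by rewrite ltr_wpDl.
apply: filterS (H _ (divr_gt0 e0 g1)) => h Hh.
rewrite -[h *: ip d g]/(h * ip d g) -ipZl -!ipBl.
apply: le_trans (cauchy_schwarz _ _) _; apply: le_trans (ler_wpM2r _ Hh) _ => //.
by rewrite mulrAC ler_wpM2r// mulrAC ler_pdivrMr// ler_wpM2l ?lerDl// ltW.
Qed.

Lemma cvg_ip (S : topologicalType) (f g : S -> M) (x : S) (a b : M) :
  f y @[y --> x] --> a -> g y @[y --> x] --> b -> ip (f y) (g y) @[y --> x] --> ip a b.
Proof.
move=> /cvg_at_distP Hf /cvg_at_distP Hg; apply/cvg_at_distP => e e0.
have a1 : 0 < `|a| + 1 by rewrite ltr_wpDl.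
have b1 : 0 < `|b| + 1 by rewrite ltr_wpDl.
have [n n0 nE] := normc_realE a; have [m m0 mE] := normc_realE b.
have [r r0 rE] := gt0c_real e0.
pose d := Num.min 1 (r / (n + m + 1)).
have nm : 0 < n + m + 1 by rewrite ltr_wpDl// addr_ge0.
have d0 : 0 < d by rewrite lt_min ltr01 divr_gt0.
have dC : 0 < d%:C :> C by rewrite ltcR.
have d1 : d <= 1 by rewrite ge_min lexx.
have d2 : d * (n + m + 1) <= r by rewrite -ler_pdivlMr// ge_min lexx orbT.
near=> y.
have fy : `|a - f y| <= d%:C by near: y; exact: Hf.
have gy : `|b - g y| <= d%:C by near: y; exact: Hg.
have -> : ip a b - ip (f y) (g y) = ip (a - f y) b + ip a (b - g y) - ip (a - f y) (b - g y).
  by rewrite !(ipBl, ipBr); ring.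
apply: le_trans (ler_normB _ _) _.
apply: (@le_trans _ _ ((d * m + n * d + d * d)%:C)); last first.
  rewrite rE lecR; apply: le_trans d2.
  have : d * d <= d * 1 by rewrite ler_wpM2l// ltW.
  by lra.
rewrite rcD; apply: lerD; last first.
  by apply: le_trans (cauchy_schwarz _ _) _; rewrite rcM ler_pM.
apply: le_trans (ler_normD _ _) _; rewrite rcD; apply: lerD.
  by apply: le_trans (cauchy_schwarz _ _) _; rewrite rcM mE ler_wpM2r// ler0c.
by apply: le_trans (cauchy_schwarz _ _) _; rewrite rcM nE ler_wpM2l// ler0c.
Unshelve. all: by end_near. Qed.

Lemma ip_expansion (f g : C -> M) (t : C) (df dg : M) :
  is_derive t 1 f df -> is_derive t 1 g dg ->
  forall e : C, 0 < e -> \forall h \near (0 : C),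
    `|ip (f (t + h)) (g (t + h)) - ip (f t) (g t) - h * ip df (g t)
      - conjc h * ip (f t) dg| <= e * `|h|.
Proof.
move=> Hf Hg e e0.
have cg : g (t + h) @[h --> (0 : C)] --> g t.
  have /differentiable_continuous : differentiable g t by apply/derivable1_diffP.
  move/cvg_at_distP => H; apply/cvg_at_distP => d /H /near_shiftC.
  by [].
move/is_derive_nearP in Hf; move/is_derive_nearP in Hg; move/cvg_at_distP in cg.
pose n := `|g t| + 1 + `|f t| + `|df|.
have n0 : 0 < n by rewrite ltr_wpDr// ltr_wpDr// ltr_wpDl.
have en : 0 < e / n by rewrite divr_gt0.
near=> h.
have F : `|f (t + h *: 1) - f t - h *: df| <= e / n * `|h| by near: h; exact: Hf.
have G : `|g (t + h *: 1) - g t - h *: dg| <= e / n * `|h| by near: h; exact: Hg.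
have c1 : `|g t - g (t + h)| <= 1 by near: h; exact: cg.
have c2 : `|g t - g (t + h)| <= e / n by near: h; exact: cg.
rewrite [_ *: 1]mulr1 in F G.
have -> : ip (f (t + h)) (g (t + h)) - ip (f t) (g t) - h * ip df (g t) - conjc h * ip (f t) dg
  = ip (f (t + h) - f t - h *: df) (g (t + h)) + ip (f t) (g (t + h) - g t - h *: dg)
    - h * ip df (g t - g (t + h)).
  by rewrite !(ipBl, ipBr, ipZl, ipZr); ring.
apply: le_trans (ler_normB _ _) _.
apply: (@le_trans _ _ (e / n * `|h| * (`|g t| + 1) + `|f t| * (e / n * `|h|) + `|h| * (`|df| * (e
  / n)))); last first.
  suff -> : e / n * `|h| * (`|g t| + 1) + `|f t| * (e / n * `|h|) + `|h| * (`|df| * (e / n)) = e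
    / n * n * `|h|.
    by rewrite divfK ?gt_eqF.
  by rewrite /n; move: (e / _) => w; ring.
apply: lerD; last first.
  by rewrite normrM ler_wpM2l//; apply: le_trans (cauchy_schwarz _ _) _; rewrite ler_wpM2l.
apply: le_trans (ler_normD _ _) _; apply: lerD.
  apply: le_trans (cauchy_schwarz _ _) _; apply: ler_pM => //.
  rewrite -[g (t + h)](subrK (g t)) addrC; apply: le_trans (ler_normD _ _) _.
  by rewrite lerD2l distrC.
by apply: le_trans (cauchy_schwarz _ _) _; rewrite ler_wpM2l.
Unshelve. all: by end_near. Qed.

(** To first order the pairing changes by h <f', g> + conj h <f, g'>. A real and a purely imaginary
    increment bound the sum and the difference of the two coefficients, so both vanish. *)
Lemma ip_derive_eq0 (f g : C -> M) (t : C) (df dg : M) :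
  is_derive t 1 f df -> is_derive t 1 g dg ->
  (\forall h \near (0 : C), ip (f (t + h)) (g (t + h)) = 0) ->
  ip df (g t) = 0 /\ ip (f t) dg = 0.
Proof.
move=> Hf Hg H0; have H00 : ip (f t) (g t) = 0.
  by have := nbhs_singleton H0; rewrite addr0.
have B (e : R) : 0 < e -> `|ip df (g t) + ip (f t) dg| <= e%:C /\ `|ip df (g t) - ip (f t) dg| <=
  e%:C.
  move=> e0; have eC : 0 < e%:C :> C by rewrite ltcR.
  have [d d0 Hd] := (nearC0P _).1 (filterI H0 (ip_expansion Hf Hg eC)).
  have d2 : 0 < d / 2 by rewrite divr_gt0.
  have dd : d / 2 < d by rewrite ltr_pdivrMr// ltr_pMr// ltr1n.
  have n1 : `|(d / 2)%:C : C| = (d / 2)%:C by rewrite normc_real gtr0_norm.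
  have n2 : `|'i * (d / 2)%:C : C| = (d / 2)%:C by rewrite normrM normc_i mul1r.
  have dC : 0 < (d / 2)%:C :> C by rewrite ltcR.
  split.
    have [] := Hd (d / 2)%:C _; first by rewrite n1 ltcR.
    move=> ->; rewrite H00 subrr sub0r conjc_real -opprD normrN -mulrDr normrM n1.
    by rewrite mulrC ler_pM2r.
  have [] := Hd ('i * (d / 2)%:C) _; first by rewrite n2 ltcR.
  move=> ->; rewrite H00 subrr sub0r conjcM conjc_real.
  have -> : conjc 'i = - 'i :> C by simpc.
  rewrite n2 -opprD normrN.
  have -> : 'i * (d / 2)%:C * ip df (g t) + - 'i * (d / 2)%:C * ip (f t) dg = 'i * (d / 2)%:C *
    (ip df (g t) - ip (f t) dg).
    move: ('i : C) => i; ring.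
  by rewrite normrM n2 mulrC ler_pM2r.
have eq0 (z : C) : (forall e : R, 0 < e -> `|z| <= e%:C) -> z = 0.
  move=> Hz; apply/eqP; rewrite -normr_eq0; have [n n0 nE] := normc_realE z.
  suff : n <= 0 by rewrite nE => n1; have -> : n = 0 by apply/le_anti/andP.
  by apply/ler_addgt0Pl => e e0; rewrite addr0 -lecR -nE; exact: Hz.
have s1 := eq0 _ (fun e e0 => (B e e0).1); have s2 := eq0 _ (fun e e0 => (B e e0).2).
have n2 : (2 : C) != 0 by rewrite pnatr_eq0.
split; apply: (mulfI n2); rewrite mulr0.
  by rewrite -[RHS](addr0 0) -{1}s1 -s2; ring.
by rewrite -[RHS](subr0 0) -{1}s1 -s2; ring.
Qed.

(** The inner product of the difference quotients at s and t is the mixed difference of F at s and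
    conj t divided by s conj t, hence close to c. The squared distance of two quotients is then
    close to c - c - c + c = 0, so they are Cauchy, and [M] is complete. *)
Lemma derivable_of_mixed (f : C -> M) (F : C -> C -> C) (c : C) (r : R) : 0 < r ->
  (forall s t : C, `|s| < r%:C -> `|t| < r%:C -> ip (f s) (f t) = F s (conjc t)) ->
  (forall e : R, 0 < e -> exists2 d : R, 0 < d &
    forall s t : C, `|s| < d%:C -> `|t| < d%:C ->
      `|F s t - F s 0 - F 0 t + F 0 0 - c * s * t| <= e%:C * `|s| * `|t|) ->
  derivable f 0 1.
Proof.
move=> r0 HF Hc.
pose q (s : C) : M := s^-1 *: (f s - f 0).
suff : cvg (q @ 0^').
  have E : (fun h : C => h^-1 *: ((f \o shift 0) (h *: 1) - f 0)) = q.
    by apply/funext => s; rewrite /q/= [_ *: 1]mulr1 addr0.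
  by rewrite /derivable E.
apply: cauchy_cvg; apply: cauchy_exP => _ /gt0c_real[e e0 ->].
(* Four terms of size at most e^2 / 5 add up to strictly less than e^2. *)
have e5 : 0 < e ^+ 2 / 5 by rewrite divr_gt0// exprn_gt0.
have [d d0 Hd] := Hc _ e5.
pose m := Num.min d r.
have m0 : 0 < m by rewrite lt_min d0.
have md (x : C) : `|x| < m%:C -> `|x| < d%:C /\ `|x| < r%:C.
  have [a _ ->] := normc_realE x; rewrite !ltcR lt_min; by move/andP.
have ipq (s t : C) : s != 0 -> t != 0 -> `|s| < m%:C -> `|t| < m%:C ->
    `|ip (q s) (q t) - c| <= (e ^+ 2 / 5)%:C.
  move=> sn0 tn0 /md[sd sr] /md[td tr].
  have z0 : `|0 : C| < r%:C by rewrite normr0 ltcR.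
  have ctd : `|conjc t| < d%:C by rewrite normcJ.
  have := Hd _ _ sd ctd.
  have ctn0 : conjc t != 0 by rewrite conjc_eq0.
  have -> : ip (q s) (q t) - c = s^-1 * (conjc t)^-1 * (F s (conjc t) - F s 0 - F 0 (conjc t) + F
    0 0 - c * s * conjc t).
    rewrite /q ipZl ipZr !(ipBl, ipBr) !HF// conjc0.
    have -> : conjc t^-1 = (conjc t)^-1 by exact: fmorphV.
    by field; rewrite sn0 ctn0.
  rewrite normrM => H; apply: le_trans (ler_wpM2l (normr_ge0 _) H) _.
  rewrite normrM !normfV -mulrA [X in _ * X]mulrCA [X in X <= _](_ : _ = (e ^+ 2 / 5)%:C)//.
  have n1 : `|s| != 0 by rewrite normr_eq0.
  have n2 : `|conjc t| != 0 by rewrite normr_eq0.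
  rewrite (mulVf n2) mulr1 mulrCA (mulVf n1) mulr1.
  done.
pose s0 : C := (m / 2)%:C.
have s0m : `|s0| < m%:C.
  by rewrite normc_real ltcR gtr0_norm ?divr_gt0// ltr_pdivrMr// ltr_pMr// ltr1n.
have s00 : s0 != 0 by rewrite gt_eqF// ltcR divr_gt0.
exists (q s0).
have : \forall t \near (0 : C), `|t| < m%:C by apply: nbhs0_lt; rewrite ltcR.
rewrite /= !(near_simpl, near_withinE); apply: filterS => t tm tn0.
rewrite /= -ball_normE/= -(@ltr_pXn2r _ 2)// ?nnegrE ?ler0c ?(ltW e0)//.
rewrite -ip_norm !(ipBl, ipBr).
have -> : ip (q s0) (q s0) - ip (q s0) (q t) - (ip (q t) (q s0) - ip (q t) (q t)) =
  (ip (q s0) (q s0) - c) - (ip (q s0) (q t) - c) - (ip (q t) (q s0) - c) + (ip (q t) (q t) - c)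
    by ring.
set x1 := ip (q s0) (q s0) - c; set x2 := _ (q s0) (q t) - c; set x3 := _ (q t) (q s0) - c; set
  x4 := _ (q t) (q t) - c.
have X1 : `|x1| <= (e ^+ 2 / 5)%:C by exact: ipq.
have X2 : `|x2| <= (e ^+ 2 / 5)%:C by exact: ipq.
have X3 : `|x3| <= (e ^+ 2 / 5)%:C by exact: ipq.
have X4 : `|x4| <= (e ^+ 2 / 5)%:C by exact: ipq.
have X : `|x1 - x2 - x3 + x4| < (e ^+ 2)%:C.
  apply: (@le_lt_trans _ _ ((e ^+ 2 / 5 + e ^+ 2 / 5 + e ^+ 2 / 5 + e ^+ 2 / 5)%:C)).
    rewrite !rcD; apply: le_trans (ler_normD _ _) _; apply: lerD => //.
    apply: le_trans (ler_normB _ _) _; apply: lerD => //.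
    by apply: le_trans (ler_normB _ _) _; apply: lerD.
  have : 0 < e ^+ 2 by rewrite exprn_gt0.
  by rewrite ltcR; move: (e ^+ 2) => u; lra.
rewrite [X in _ < X](_ : _ = (e ^+ 2)%:C); last by rewrite rmorphXn.
apply: le_lt_trans X; apply: real_ler_norm.
have -> : x1 - x2 - x3 + x4 = `|q s0 - q t| ^+ 2.
  by rewrite -ip_norm !(ipBl, ipBr) /x1 /x2 /x3 /x4; ring.
by rewrite realX// normr_real.
Qed.
End InnerProduct.

(** * The polydisc and a class of functions closed under differentiation *)

Section Jets.
Variable R : realType.
Local Notation C := R[i].
Local Notation pt := 'rV[C]_3.
Implicit Types (z w u v h : pt) (a b c : nat) (x y : C).

Lemma ord3P (P : 'I_3 -> Prop) : P i1 -> P i2 -> P i3 -> forall i, P i.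
Proof.
move=> P1 P2 P3 [[|[|[|//]]] Hi].
- by have -> : Ordinal Hi = i1 by apply/val_inj; rewrite /= inordK.
- by have -> : Ordinal Hi = i2 by apply/val_inj; rewrite /= inordK.
- by have -> : Ordinal Hi = i3 by apply/val_inj; rewrite /= inordK.
Qed.

Lemma i12 : (i1 == i2) = false. Proof. by rewrite -val_eqE /= !inordK. Qed.
Lemma i13 : (i1 == i3) = false. Proof. by rewrite -val_eqE /= !inordK. Qed.
Lemma i23 : (i2 == i3) = false. Proof. by rewrite -val_eqE /= !inordK. Qed.
Lemma i21 : (i2 == i1) = false. Proof. by rewrite eq_sym i12. Qed.
Lemma i31 : (i3 == i1) = false. Proof. by rewrite eq_sym i13. Qed.
Lemma i32 : (i3 == i2) = false. Proof. by rewrite eq_sym i23. Qed.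
Definition i_neq := (i12, i13, i23, i21, i31, i32).

Definition conjv w : pt := map_mx (@conjc R) w.

Lemma conjvE w i : conjv w 0 i = conjc (w 0 i).
Proof. by rewrite mxE. Qed.

Lemma conjvK w : conjv (conjv w) = w.
Proof. by apply/rowP => i; rewrite !conjvE conjcK. Qed.

Lemma conjvD w h x : conjv (w + x *: h) = conjv w + conjc x *: conjv h.
Proof. by apply/rowP => i; rewrite !mxE conjcD conjcM. Qed.

Lemma D3_conj w : D3 w -> D3 (conjv w).
Proof. by move=> Hw i; rewrite conjvE normcJ. Qed.

Lemma D3_line w h : D3 w -> exists2 r : R, 0 < r & forall x, `|x| < r%:C -> D3 (w + x *: h).
Proof.
move=> Hw.
have Hi (i : 'I_3) : exists2 r : R, 0 < r & forall x, `|x| < r%:C -> `|(w + x *: h) 0 i| < 1.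
  have [n n0 nE] := normc_realE (w 0 i); have [m m0 mE] := normc_realE (h 0 i).
  have n1 : n < 1 by rewrite -ltcR -nE; exact: Hw.
  have m1 : 0 < m + 1 by rewrite ltr_wpDl.
  exists ((1 - n) / (m + 1)); first by rewrite divr_gt0// subr_gt0.
  move=> x; have [k k0 kE] := normc_realE x; rewrite kE ltcR => kr.
  rewrite !mxE; apply: le_lt_trans (ler_normD _ _) _.
  rewrite normrM nE kE mE -rcM -rcD ltcR -ltrBrDl.
  apply: (@le_lt_trans _ _ (k * (m + 1))); first by rewrite ler_wpM2l// lerDl.
  by rewrite -ltr_pdivlMr.
have [r1 r10 H1] := Hi i1; have [r2 r20 H2] := Hi i2; have [r3 r30 H3] := Hi i3.
exists (Num.min r1 (Num.min r2 r3)); first by rewrite !lt_min r10 r20.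
move=> x; have [k k0 kE] := normc_realE x; rewrite kE ltcR !lt_min => /and3P[k1 k2 k3].
by apply: ord3P; [apply: H1|apply: H2|apply: H3]; rewrite kE ltcR.
Qed.

Lemma D3_near w h : D3 w -> \forall x \near (0 : C), D3 (w + x *: h).
Proof. by move=> /D3_line-/(_ h)[r r0 H]; apply/nearC0P; exists r. Qed.

Lemma halfplane x y : `|x| < 1 -> `|y| < 1 -> 0 < complex.Re (1 - x * y).
Proof.
move=> x1 y1; rewrite raddfB/= subr_gt0 -ltcR.
apply: le_lt_trans (_ : `|x * y| < 1); last by rewrite normrM mulr_ilt1.
apply: le_trans (normc_ge_Re _); rewrite lecR; exact: ler_norm.
Qed.

Lemma is_derive_coord w h i : is_derive w h (fun w : pt => w 0 i) (h 0 i).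
Proof.
apply/is_derive_nearP => e e0; near=> x.
by rewrite !mxE (addrC (w 0 i)) addrK subrr normr0 mulr_ge0// ltW.
Unshelve. all: by end_near. Qed.

Lemma is_derive_cpow_lin (c : R) x y : `|x| < 1 -> `|y| < 1 ->
  is_derive y 1 (fun t : C => cpow (1 - x * t) c) (- x * (c%:C * cpow (1 - x * y) (c - 1))).
Proof.
move=> x1 y1.
have D := cpow_derive c (halfplane x1 y1).
have L : is_derive y 1 (fun t : C => 1 - x * t) (- x).
  apply/is_derive_nearP => e e0; near=> t.
  rewrite [_ *: 1]mulr1 -[t *: - x]/(t * - x).
  have -> : 1 - x * (y + t) - (1 - x * y) - t * - x = 0 by ring.
  by rewrite normr0 mulr_ge0// ltW.
exact: (is_derive_chain L D).
Unshelve. all: by end_near. Qed.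

(* Functions of [(w, u)], where [u] stands for the conjugate of a second point:
   a class containing the kernel and stable under complex differentiation in
   either variable. *)
Inductive sm : (pt -> pt -> C) -> Prop :=
| sm_cst x : sm (fun _ _ => x)
| sm_l i : sm (fun w u => w 0 i)
| sm_r i : sm (fun w u => u 0 i)
| sm_pow i (c : R) : sm (fun w u => cpow (1 - w 0 i * u 0 i) c)
| sm_add F G : sm F -> sm G -> sm (fun w u => F w u + G w u)
| sm_mul F G : sm F -> sm G -> sm (fun w u => F w u * G w u).

Lemma sm_swap F : sm F -> sm (fun w u => F u w).
Proof.
elim=> [x|i|i|i c|F1 F2 _ H1 _ H2|F1 F2 _ H1 _ H2].
- exact: sm_cst.
- exact: sm_r.
- exact: sm_l.
- have -> : (fun w u : pt => cpow (1 - u 0 i * w 0 i) c) = (fun w u => cpow (1 - w 0 i * u 0 i)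
    c).
    by apply/funext => w; apply/funext => u; rewrite mulrC.
  exact: sm_pow.
- exact: (sm_add H1 H2).
- exact: (sm_mul H1 H2).
Qed.

(** This is what happens to a Gram function when its two vectors trade places: the value is
    conjugated, and each variable becomes the conjugate of the other point. *)
Lemma sm_adj F : sm F -> sm (fun w u => conjc (F (conjv u) (conjv w))).
Proof.
elim=> [x|i|i|i c|F1 F2 _ H1 _ H2|F1 F2 _ H1 _ H2].
- exact: sm_cst.
- have -> : (fun w u : pt => conjc (conjv u 0 i)) = (fun w u => u 0 i).
    by apply/funext => w; apply/funext => u; rewrite conjvE conjcK.
  exact: sm_r.
- have -> : (fun w u : pt => conjc (conjv w 0 i)) = (fun w u => w 0 i).
    by apply/funext => w; apply/funext => u; rewrite conjvE conjcK.
  exact: sm_l.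
- have -> : (fun w u : pt => conjc (cpow (1 - conjv u 0 i * conjv w 0 i) c)) = (fun w u => cpow
    (1 - w 0 i * u 0 i) c).
    by apply/funext => w; apply/funext => u; rewrite cpow_conj !conjvE conjcD conjc1 conjcN
      conjcM !conjcK mulrC.
  exact: sm_pow.
- have -> : (fun w u : pt => conjc (F1 (conjv u) (conjv w) + F2 (conjv u) (conjv w))) = (fun w u
    => conjc (F1 (conjv u) (conjv w)) + conjc (F2 (conjv u) (conjv w))).
    by apply/funext => w; apply/funext => u; rewrite conjcD.
  exact: (sm_add H1 H2).
- have -> : (fun w u : pt => conjc (F1 (conjv u) (conjv w) * F2 (conjv u) (conjv w))) = (fun w u
    => conjc (F1 (conjv u) (conjv w)) * conjc (F2 (conjv u) (conjv w))).
    by apply/funext => w; apply/funext => u; rewrite conjcM.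
  exact: (sm_mul H1 H2).
Qed.

Lemma sm_derive F h : sm F -> exists2 F', sm F' &
  forall w u, D3 w -> D3 u -> is_derive w h (F ^~ u) (F' w u).
Proof.
elim=> [x|i|i|i c|F1 F2 S1 [G1 T1 H1] S2 [G2 T2 H2]|F1 F2 S1 [G1 T1 H1] S2 [G2 T2 H2]].
- exists (fun _ _ => 0); first exact: sm_cst.
  by move=> w u _ _; exact: is_derive_cst.
- exists (fun _ _ => h 0 i); first exact: sm_cst.
  by move=> w u _ _; exact: is_derive_coord.
- exists (fun _ _ => 0); first exact: sm_cst.
  by move=> w u _ _; exact: is_derive_cst.
- exists (fun w u => (- h 0 i * c%:C) * (u 0 i * cpow (1 - w 0 i * u 0 i) (c - 1))).
    exact: (sm_mul (sm_cst _) (sm_mul (sm_r i) (sm_pow i _))).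
  move=> w u Hw Hu.
  have := is_derive_chain (is_derive_coord w h i) (is_derive_cpow_lin c (Hu i) (Hw i)).
  have -> : h 0 i *: (- u 0 i * (c%:C * cpow (1 - u 0 i * w 0 i) (c - 1))) =
      - h 0 i * c%:C * (u 0 i * cpow (1 - w 0 i * u 0 i) (c - 1)).
    rewrite -[_ *: _]/(h 0 i * (- u 0 i * (c%:C * cpow (1 - u 0 i * w 0 i) (c - 1)))).
    by rewrite (mulrC (u 0 i) (w 0 i)); ring.
  have -> // : (fun t : C => cpow (1 - u 0 i * t) c) \o (fun w : pt => w 0 i) =
      (fun w : pt => cpow (1 - w 0 i * u 0 i) c).
  by apply/funext => t /=; rewrite mulrC.
- exists (fun w u => G1 w u + G2 w u); first exact: sm_add.
  move=> w u Hw Hu; exact: (is_deriveD (H1 w u Hw Hu) (H2 w u Hw Hu)).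
- exists (fun w u => F1 w u * G2 w u + F2 w u * G1 w u).
    exact: (sm_add (sm_mul S1 T2) (sm_mul S2 T1)).
  move=> w u Hw Hu; exact: (is_deriveM (H1 w u Hw Hu) (H2 w u Hw Hu)).
Qed.

Lemma sm_continuous (T : topologicalType) (W U : T -> pt) (t : T) F :
  (forall i, W y 0 i @[y --> t] --> W t 0 i) -> (forall i, U y 0 i @[y --> t] --> U t 0 i) ->
  D3 (W t) -> D3 (U t) -> sm F -> F (W y) (U y) @[y --> t] --> F (W t) (U t).
Proof.
move=> HW HU DW DU; elim=> [x|i|i|i c|F1 F2 _ H1 _ H2|F1 F2 _ H1 _ H2].
- exact: cvg_cst.
- exact: HW.
- exact: HU.
- apply: (cvg_at_comp (fun y : T => 1 - W y 0 i * U y 0 i : C) (fun x : C => cpow x c : C)).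
    have D := cpow_derive c (halfplane (DW i) (DU i)).
    by apply: differentiable_continuous; apply/derivable1_diffP.
  exact: (cvgB (cvg_cst _) (cvgM (HW i) (HU i))).
- exact: (cvgD H1 H2).
- exact: (cvgM H1 H2).
Qed.

Lemma sm_continuous2 F w u h k : sm F -> D3 w -> D3 u ->
  forall e : R, 0 < e -> exists2 d : R, 0 < d &
    forall s t : C, `|s| < d%:C -> `|t| < d%:C ->
      `|F (w + s *: h) (u + t *: k) - F w u| <= e%:C.
Proof.
move=> SF Hw Hu e e0; have eC : 0 < e%:C :> C by rewrite ltcR.
have co (p q : pt) (f : C * C -> C) i : f (0, 0) = 0 -> f y @[y --> ((0, 0) : C * C)] --> (0 : C)
  ->
    (p + f y *: q) 0 i @[y --> ((0, 0) : C * C)] --> (p + f (0, 0) *: q) 0 i.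
  move=> f0 H; have -> : (fun y : C * C => (p + f y *: q) 0 i) = (fun y : C * C => p 0 i + f y *
    q 0 i).
    by apply/funext => y; rewrite !mxE.
  by rewrite !mxE f0; exact: (cvgD (cvg_cst _) (cvgM H (cvg_cst _))).
have := @sm_continuous _ (fun y : C * C => w + y.1 *: h) (fun y : C * C => u + y.2 *: k) (0, 0) F
  _ _ _ _ SF.
rewrite /= !scale0r !addr0 => H.
have /cvg_at_distP/(_ _ eC) : F (w + y.1 *: h) (u + y.2 *: k) @[y --> ((0, 0) : C * C)] --> F w u.
  apply: H => //.
    by move=> i; have := co w h fst i erefl; rewrite /= scale0r addr0; apply; exact: cvg_fst.
  by move=> i; have := co u k snd i erefl; rewrite /= scale0r addr0; apply; exact: cvg_snd.
case=> [[A B] /= [/nearC0P[d1 d10 HA] /nearC0P[d2 d20 HB]] HAB].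
exists (Num.min d1 d2); first by rewrite lt_min d10.
move=> s t; have [m _ mE] := normc_realE s; have [n _ nE] := normc_realE t.
rewrite mE nE !ltcR !lt_min => /andP[m1 _] /andP[_ n2].
rewrite distrC; apply: (HAB (s, t)); split => /=.
  by apply: HA; rewrite mE ltcR.
by apply: HB; rewrite nE ltcR.
Qed.
End Jets.

Lemma is_derive_cast (K : numFieldType) (V W : normedModType K) (f : V -> W)
    (x v : V) (d d' : W) : is_derive x v f d -> d = d' -> is_derive x v f d'.
Proof. by move=> H <-. Qed.

(** * Jets of the kernel *)

Section KernelJets.
Variables (R : realType) (alpha beta gamma : R).
Hypotheses (alpha_gt0 : 0 < alpha) (beta_gt0 : 0 < beta) (gamma_gt0 : 0 < gamma).
Variable M : rkhs (@D3 R) (K3 alpha beta gamma).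
Local Notation C := R[i].
Local Notation pt := 'rV[C]_3.
Implicit Types (z w u v h : pt) (a b c : nat) (x y : C).

(* z^a (1 - z w)^(-lam - a) is, up to the factor (lam)_a, the a-th derivative
   of (1 - z w)^(-lam) with respect to w. *)
Definition kjet1 (lam : R) a (x y : C) : C := x ^+ a * cpow (1 - x * y) (- lam - a%:R).

Definition kjet a b c z w : C :=
  kjet1 alpha a (z 0 i1) (w 0 i1) * kjet1 beta b (z 0 i2) (w 0 i2) *
  kjet1 gamma c (z 0 i3) (w 0 i3).

Lemma is_derive_kjet1 (lam : R) a x y : `|x| < 1 -> `|y| < 1 ->
  is_derive y 1 (kjet1 lam a x) ((lam + a%:R)%:C * kjet1 lam a.+1 x y).
Proof.
move=> x1 y1; have D := is_derive_cpow_lin (- lam - a%:R) x1 y1.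
have -> : (lam + a%:R)%:C * kjet1 lam a.+1 x y =
    x ^+ a *: (- x * ((- lam - a%:R)%:C * cpow (1 - x * y) (- lam - a%:R - 1))).
  rewrite /kjet1 -[_ *: _]/(x ^+ a * (- x * ((- lam - a%:R)%:C * cpow (1 - x * y) (- lam - a%:R -
    1)))).
  have -> : - lam - a.+1%:R = - lam - a%:R - 1 :> R by rewrite -natr1; ring.
  have -> : (- lam - a%:R)%:C = - (lam + a%:R)%:C :> C by rewrite -rmorphN/= opprD.
  by rewrite exprS; ring.
exact: is_deriveZ.
Qed.

Lemma is_derive_kjet a b c z w h : D3 z -> D3 w ->
  is_derive w h (kjet a b c z)
    (h 0 i1 * (alpha + a%:R)%:C * kjet a.+1 b c z w +
     h 0 i2 * (beta + b%:R)%:C * kjet a b.+1 c z w +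
     h 0 i3 * (gamma + c%:R)%:C * kjet a b c.+1 z w).
Proof.
move=> Hz Hw.
have D1 := is_derive_chain (is_derive_coord w h i1) (is_derive_kjet1 alpha a (Hz i1) (Hw i1)).
have D2 := is_derive_chain (is_derive_coord w h i2) (is_derive_kjet1 beta b (Hz i2) (Hw i2)).
have D3' := is_derive_chain (is_derive_coord w h i3) (is_derive_kjet1 gamma c (Hz i3) (Hw i3)).
have D := is_deriveM (is_deriveM D1 D2) D3'.
apply: (is_derive_cast D).
rewrite /kjet !fctE/=.
rewrite /GRing.scale/=; ring.
Qed.

(** Chosen by [xget] because it is not known beforehand that this function belongs to [M]; the
    default 0 is excluded on the polydisc by [jete_ok_all]. Without Pochhammer factors the jets are
    K_w times plain monomials in X_1, X_2, X_3. *)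
Definition jete a b c w : M := xget 0 [set f : M | forall z, D3 z -> ev f z = kjet a b c z w].

Definition jete_ok a b c := forall w z, D3 w -> D3 z -> ev (jete a b c w) z = kjet a b c z w.

Lemma jete_intro a b c w (f : M) : (forall z, D3 z -> ev f z = kjet a b c z w) ->
  jete a b c w = f.
Proof.
move=> Hf; apply: (@ev_inj _ _ _ _ M) => z Hz.
have := @xgetPex _ 0 [set f : M | forall z, D3 z -> ev f z = kjet a b c z w] (ex_intro _ f Hf).
by move=> ->//; rewrite Hf.
Qed.

Lemma jete000 w : D3 w -> jete 0 0 0 w = frameE M w.
Proof.
move=> Hw; apply: jete_intro => z Hz; rewrite /frameE ev_kernel//; last exact: D3_conj.
by rewrite /K3 /kjet /kjet1 !mxE !conjcK !expr0 !mul1r !subr0.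
Qed.

(** The invariant of the induction on jets: a Gram function in [sm] can be differentiated in both
    slots, which is what norm differentiability of the jet requires. *)
Definition gram_ok a b c a' b' c' := exists2 S : pt -> pt -> C, sm S &
  forall w v, D3 w -> D3 v -> ip (jete a b c w) (jete a' b' c' v) = S w (conjv v).

Lemma gram_adj a b c a' b' c' : gram_ok a b c a' b' c' -> gram_ok a' b' c' a b c.
Proof.
case=> S SS HS; exists (fun w u => conjc (S (conjv u) (conjv w))); first exact: sm_adj.
by move=> w v Hw Hv; rewrite ip_conj HS// conjvK.
Qed.

Definition djete a b c h w : M :=
  (h 0 i1 * (alpha + a%:R)%:C) *: jete a.+1 b c w +
  (h 0 i2 * (beta + b%:R)%:C) *: jete a b.+1 c w +
  (h 0 i3 * (gamma + c%:R)%:C) *: jete a b c.+1 w.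

(** Norm differentiability comes from the Gram function; the derivative is then identified by its
    values, since evaluation at z is the inner product with [kernel_fun M z]. *)
Lemma derivable_jete a b c w h : jete_ok a b c -> gram_ok a b c a b c -> D3 w ->
  exists d : M, is_derive w h (jete a b c) d /\
   forall z, D3 z -> ev d z = (h 0 i1 * (alpha + a%:R)%:C * kjet a.+1 b c z w +
     h 0 i2 * (beta + b%:R)%:C * kjet a b.+1 c z w +
     h 0 i3 * (gamma + c%:R)%:C * kjet a b c.+1 z w).
Proof.
move=> Hok [S SS HS] Hw.
suff Hd : derivable (jete a b c) w h.
  exists ('D_h (jete a b c) w); split; first exact: derivableP.
  move=> z Hz; rewrite -(reproducing _ Hz).
  have D1 := is_derive_ipl (kernel_fun M z) (derivableP Hd).
  have D2 := is_derive_kjet a b c h Hz Hw.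
  move/is_derive_line in D1; move/is_derive_line in D2.
  have /is_derive_nearP D1' := D1; have /is_derive_nearP D2' := D2.
  have D3'' : is_derive (0 : C) 1 (fun x : C => ip (jete a b c (w + x *: h)) (kernel_fun M z))
     (h 0 i1 * (alpha + a%:R)%:C * kjet a.+1 b c z w +
     h 0 i2 * (beta + b%:R)%:C * kjet a b.+1 c z w +
     h 0 i3 * (gamma + c%:R)%:C * kjet a b c.+1 z w).
    apply/is_derive_nearP => e e0.
    apply: filterS2 (D3_near h Hw) (D2' _ e0) => x Hx; rewrite !add0r [x *: 1]mulr1 scale0r addr0.
    by rewrite !(reproducing _ Hz) !Hok.
  by case: D1 => _ <-; case: D3'' => _ <-.
apply/derivable1P.
have -> : (fun x : C => jete a b c (x *: h + w)) = (fun x : C => jete a b c (w + x *: h)).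
  by apply/funext => x; rewrite addrC.
have [F1 S1 H1] := sm_derive h SS.
(* The second variable of S is the conjugate of a point, so moving that point along h moves the
   variable along [conjv h]; [sm_swap] brings it to the slot in which [sm_derive] acts. *)
have [F12 S12 H12] := sm_derive (conjv h) (sm_swap S1).
have [r1 r10 Hr1] := D3_line h Hw.
have [r2 r20 Hr2] := D3_line (conjv h) (D3_conj Hw).
have line (G : pt -> C) p q d x : is_derive (p + x *: q) q G d ->
    is_derive x 1 (fun s : C => G (p + s *: q)) d.
  move=> /is_derive_nearP Hg; apply/is_derive_nearP => e /Hg; apply: filterS => s.
  by rewrite [s *: 1]mulr1 scalerDl addrA.
pose r := Num.min r1 r2.
have r0 : 0 < r by rewrite lt_min r10.
have rr x : `|x| < r%:C -> `|x| < r1%:C /\ `|x| < r2%:C.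
  have [n _ ->] := normc_realE x; rewrite !ltcR lt_min; by move/andP.
apply: (@derivable_of_mixed _ _ _ _ M _ (fun s t => S (w + s *: h) (conjv w + t *: conjv h)) (F12
  (conjv w) w) r r0).
  move=> s t /rr[s1 s2] /rr[t1 t2]; rewrite HS; [|exact: Hr1|exact: Hr1].
  by rewrite conjvD.
have := @mixed_difference R (fun s t => S (w + s *: h) (conjv w + t *: conjv h))
  (fun s t => F1 (w + s *: h) (conjv w + t *: conjv h))
  (fun s t => F12 (conjv w + t *: conjv h) (w + s *: h)) r r0 _ _ _.
rewrite !scale0r !addr0; apply.
- move=> s t /rr[s1 s2] /rr[t1 t2].
  apply: (line (S ^~ (conjv w + t *: conjv h))); apply: H1; [exact: Hr1|exact: Hr2].
- move=> s t /rr[s1 s2] /rr[t1 t2].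
  apply: (line (F1 (w + s *: h))); apply: H12; [exact: Hr2|exact: Hr1].
- move=> e e0.
  have [d d0 Hd] := sm_continuous2 (conjv h) h S12 (D3_conj Hw) Hw e0.
  by exists d => // s t sd td; rewrite ?scale0r ?addr0; exact: Hd.
Qed.

Lemma delta_coord (i j : 'I_3) : (delta_mx 0 i : pt) 0 j = (j == i)%:R.
Proof. by rewrite mxE eqxx. Qed.

Lemma lam_neq0 (lam : R) a : 0 < lam -> (lam + a%:R)%:C != 0 :> C.
Proof. by move=> l0; rewrite gt_eqF// ltcR ltr_wpDr. Qed.

(** The partial derivative of a jet is a nonzero multiple of the next jet; this is why the next jet
    lies in [M] at all. *)
Lemma jete_next a b c a' b' c' (i : 'I_3) (lam : R) :
  (forall z w, (delta_mx 0 i : pt) 0 i1 * (alpha + a%:R)%:C * kjet a.+1 b c z w +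
     (delta_mx 0 i : pt) 0 i2 * (beta + b%:R)%:C * kjet a b.+1 c z w +
     (delta_mx 0 i : pt) 0 i3 * (gamma + c%:R)%:C * kjet a b c.+1 z w = lam%:C * kjet a' b' c' z
       w) ->
  lam%:C != 0 :> C ->
  jete_ok a b c -> gram_ok a b c a b c -> jete_ok a' b' c' /\ gram_ok a' b' c' a' b' c'.
Proof.
move=> E l0 Hok Hg.
have D w : D3 w -> is_derive w (delta_mx 0 i) (jete a b c) (lam%:C *: jete a' b' c' w) /\
    forall z, D3 z -> ev (jete a' b' c' w) z = kjet a' b' c' z w.
  move=> Hw; have [d [Hd Hz]] := derivable_jete (delta_mx 0 i) Hok Hg Hw.
  have Hd' z : D3 z -> ev (lam%:C^-1 *: d) z = kjet a' b' c' z w.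
    by move=> Dz; rewrite -(reproducing _ Dz) ipZl (reproducing _ Dz) Hz// E mulKf.
  have -> : jete a' b' c' w = lam%:C^-1 *: d by apply: jete_intro.
  by split => //; rewrite scalerA mulfV// scale1r.
split; first by move=> w z Hw; exact: (D w Hw).2.
(* Differentiation of the first slot stays in [sm]. Applied twice, with the slots exchanged in
   between, it advances both indices of the Gram function. *)
have step (p q r : nat) : gram_ok a b c p q r -> gram_ok a' b' c' p q r.
  case=> S SS HS; have [F1 S1 H1] := sm_derive (delta_mx 0 i) SS.
  exists (fun w u => lam%:C^-1 * F1 w u); first exact: (sm_mul (sm_cst _) S1).
  move=> w v Hw Hv; have [Dw _] := D w Hw.
  have := is_derive_ipl (jete p q r v) Dw; rewrite ipZl => /is_derive_line/is_derive_nearP D1.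
  have /is_derive_line := H1 _ _ Hw (D3_conj Hv) => -[_ <-].
  have D2 : is_derive (0 : C) 1 (fun s : C => S (w + s *: delta_mx 0 i) (conjv v))
      (lam%:C * ip (jete a' b' c' w) (jete p q r v)).
    apply/is_derive_nearP => e e0.
    apply: filterS2 (D3_near (delta_mx 0 i) Hw) (D1 _ e0) => s Hs; rewrite !add0r [s *: 1]mulr1
      scale0r addr0.
    by rewrite !HS.
  by case: D2 => _ ->; rewrite mulKf.
exact/step/gram_adj/step.
Qed.

Lemma jete_ok_all a b c : jete_ok a b c /\ gram_ok a b c a b c.
Proof.
elim: c => [|c [IH1 IH2]]; last first.
  apply: (@jete_next a b c _ _ _ i3 (gamma + c%:R)) => //; last exact: lam_neq0.
  by move=> z w; rewrite !delta_coord !i_neq !eqxx /= !mul0r mul1r ?add0r ?addr0.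
elim: b => [|b [IH1 IH2]]; last first.
  apply: (@jete_next a b 0 _ _ _ i2 (beta + b%:R)) => //; last exact: lam_neq0.
  by move=> z w; rewrite !delta_coord !i_neq !eqxx /= !mul0r mul1r ?add0r ?addr0.
elim: a => [|a [IH1 IH2]]; last first.
  apply: (@jete_next a 0 0 _ _ _ i1 (alpha + a%:R)) => //; last exact: lam_neq0.
  by move=> z w; rewrite !delta_coord !i_neq !eqxx /= !mul0r mul1r ?add0r ?addr0.
have ok : jete_ok 0 0 0.
  move=> w z Hw Hz; rewrite jete000// /frameE ev_kernel//; last exact: D3_conj.
  by rewrite /K3 /kjet /kjet1 !mxE !conjcK !expr0 !mul1r !subr0.
split => //; exists (fun w u => cpow (1 - w 0 i1 * u 0 i1) (- alpha) *
    cpow (1 - w 0 i2 * u 0 i2) (- beta) * cpow (1 - w 0 i3 * u 0 i3) (- gamma)).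
  exact: (sm_mul (sm_mul (sm_pow _ _) (sm_pow _ _)) (sm_pow _ _)).
move=> w v Hw Hv; rewrite (jete000 Hv) /frameE reproducing; last exact: D3_conj.
rewrite ok//; last exact: D3_conj.
rewrite /kjet /kjet1 !expr0 !mul1r !subr0 -/(conjv v).
by congr (cpow (1 - _) _ * cpow (1 - _) _ * cpow (1 - _) _); rewrite mulrC.
Qed.

Lemma ev_jete a b c w z : D3 w -> D3 z -> ev (jete a b c w) z = kjet a b c z w.
Proof. by move=> Hw Hz; have [+ _] := jete_ok_all a b c; apply. Qed.

Lemma is_derive_jete a b c w h : D3 w -> is_derive w h (jete a b c) (djete a b c h w).
Proof.
move=> Hw; have [H1 H2] := jete_ok_all a b c.
have [d [Hd Hz]] := derivable_jete h H1 H2 Hw.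
apply: (is_derive_cast Hd).
apply: (@ev_inj _ _ _ _ M) => z Dz; rewrite Hz// -(reproducing _ Dz) !ipDl !ipZl.
by rewrite !(reproducing _ Dz) !ev_jete.
Qed.
End KernelJets.

(** * Independence of monomials on a small bidisc *)

Lemma poly_small_eq0 (R : realType) (p : {poly R[i]}) :
  (forall x : R[i], `|x| < (2^-1)%:C -> p.[x] = 0) -> p = 0.
Proof.
move=> H; apply/eqP; apply/negPn/negP => p0.
(* The points 1/3, 1/4, ... lie in the disc of radius 1/2; [size p] of them are too many roots for a
   nonzero p. *)
pose s := [seq (n.+3%:R^-1 : R[i]) | n <- iota 0 (size p)].
have us : uniq s.
  rewrite map_inj_uniq ?iota_uniq// => m n /invr_inj/eqP.
  by rewrite eqr_nat => /eqP[].
have rs : all (root p) s.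
  apply/allP => x /mapP[n _ ->]; apply/rootP/H.
  rewrite normfV normr_nat -(rmorph_nat (real_complex R)) -fmorphV/= ltcR.
  by rewrite ltf_pV2 ?posrE ?ltr0n// ltr_nat.
by have := max_poly_roots p0 rs us; rewrite size_map size_iota ltnn.
Qed.

(** Coefficients are compared in x for fixed y, then in y. The radius 1/2 is the one for which the
    points [zpt w x y] remain in the polydisc. *)
Lemma monomials_indep (R : realType) (I : finType) (b c : I -> nat) (k : I -> R[i]) :
  injective (fun i => (b i, c i)) ->
  (forall x y : R[i], `|x| < (2^-1)%:C -> `|y| < (2^-1)%:C ->
     \sum_i k i * (x ^+ b i * y ^+ c i) = 0) ->
  forall i, k i = 0.
Proof.
move=> inj H i.
have H1 (y : R[i]) : `|y| < (2^-1)%:C -> \sum_(j | b j == b i) k j * y ^+ c j = 0.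
  move=> y2.
  have p0 : \sum_j (k j * y ^+ c j) *: 'X^(b j) = 0 :> {poly R[i]}.
    apply: poly_small_eq0 => x x2; rewrite horner_sum -[RHS](H x y x2 y2).
    by apply: eq_bigr => j _; rewrite hornerZ hornerXn -mulrA (mulrC (y ^+ _)).
  have := congr1 (fun p : {poly R[i]} => p`_(b i)) p0; rewrite coef_sum coef0 => H2.
  rewrite -[RHS]H2 big_mkcond; apply: eq_bigr => j _; rewrite coefZ coefXn eq_sym.
  by case: eqP => _; rewrite ?mulr1 ?mulr0.
have p0 : \sum_(j | b j == b i) k j *: 'X^(c j) = 0 :> {poly R[i]}.
  apply: poly_small_eq0 => y y2; rewrite horner_sum -[RHS](H1 y y2).
  by apply: eq_bigr => j _; rewrite hornerZ hornerXn.
have := congr1 (fun p : {poly R[i]} => p`_(c i)) p0; rewrite coef_sum coef0 => <-.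
rewrite (bigD1 i)//= coefZ coefXn eqxx mulr1 big1 ?addr0// => j /andP[/eqP bj ji].
rewrite coefZ coefXn; case: eqP => [cj|_]; last by rewrite mulr0.
by case/eqP: ji; apply: inj; rewrite bj cj.
Qed.

(** * Frames of the jet bundles *)

Section Frames.
Variables (R : realType) (alpha beta gamma : R).
Hypotheses (alpha_gt0 : 0 < alpha) (beta_gt0 : 0 < beta) (gamma_gt0 : 0 < gamma).
Variable M : rkhs (@D3 R) (K3 alpha beta gamma).
Local Notation C := R[i].
Local Notation pt := 'rV[C]_3.
Implicit Types (z w u v h : pt) (x y : C).
Local Notation jete := (jete M).

Let Djete := is_derive_jete alpha_gt0 beta_gt0 gamma_gt0 M.
Let evjete := ev_jete alpha_gt0 beta_gt0 gamma_gt0 M.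

Lemma is_derive_unique (V W : normedModType C) (f : V -> W) (w h : V) (d d' : W) :
  is_derive w h f d -> is_derive w h f d' -> d = d'.
Proof. by case=> _ <- [_ <-]. Qed.

Lemma is_derive_D3 (W : normedModType C) (f g : pt -> W) w h (d : W) : D3 w ->
  (forall u, D3 u -> f u = g u) -> is_derive w h f d -> is_derive w h g d.
Proof.
move=> Hw fg /is_derive_nearP H; apply/is_derive_nearP => e e0.
apply: filterS2 (D3_near h Hw) (H e e0) => x Hx.
by rewrite !fg.
Qed.

Lemma pd_jete i a b c w : D3 w ->
  pd i (jete a b c) w = djete M a b c (delta_mx 0 i) w.
Proof. by move=> Hw; have [_ <-] := Djete a b c (delta_mx 0 i) Hw. Qed.

Lemma pd2_jete a b c w : D3 w -> pd i2 (jete a b c) w = (beta + b%:R)%:C *: jete a b.+1 c w.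
Proof.
by move=> Hw; rewrite pd_jete// /djete !delta_coord !i_neq !eqxx /= !mul0r mul1r !scale0r ?add0r
  ?addr0.
Qed.

Lemma pd3_jete a b c w : D3 w -> pd i3 (jete a b c) w = (gamma + c%:R)%:C *: jete a b c.+1 w.
Proof.
by move=> Hw; rewrite pd_jete// /djete !delta_coord !i_neq !eqxx /= !mul0r mul1r !scale0r ?add0r
  ?addr0.
Qed.

(** The formulas for the jets hold only on the polydisc, while [pd] acts on functions on all of C^3;
    openness of the polydisc bridges the two. *)
Lemma pd_eq (W : completeNormedModType C) (f g : pt -> W) i w d : D3 w ->
  (forall u, D3 u -> f u = g u) -> is_derive w (delta_mx 0 i) g d -> pd i f w = d.
Proof.
move=> Hw fg Hd; have [_ <- //] : is_derive w (delta_mx 0 i) f d.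
by apply: is_derive_D3 Hd => // u Hu; rewrite fg.
Qed.

Lemma pochS (x : R) k : pochhammer x k.+1 = pochhammer x k * (x + k%:R).
Proof. by rewrite /pochhammer big_ord_recr. Qed.

Lemma poch_gt0 (x : R) k : 0 < x -> 0 < pochhammer x k.
Proof. by move=> x0; apply: prodr_gt0 => i _; rewrite ltr_wpDr. Qed.

Lemma iter_pd3 c w : D3 w ->
  iter c (pd i3) (frameE M) w = (pochhammer gamma c)%:C *: jete 0 0 c w.
Proof.
elim: c w => [|c IH] w Hw.
  by rewrite /= /pochhammer big_ord0 scale1r jete000.
have Hd : is_derive w (delta_mx 0 i3) ((pochhammer gamma c)%:C *: jete 0 0 c)
    ((pochhammer gamma c)%:C *: ((gamma + c%:R)%:C *: jete 0 0 c.+1 w)).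
  apply: is_deriveZ; rewrite -pd3_jete//; apply: derivableP.
  by case: (Djete 0 0 c (delta_mx 0 i3) Hw).
by rewrite iterS (pd_eq Hw IH Hd) scalerA -rcM pochS.
Qed.

Lemma iter_pd b c w : D3 w -> iter b (pd i2) (iter c (pd i3) (frameE M)) w =
  (pochhammer beta b * pochhammer gamma c)%:C *: jete 0 b c w.
Proof.
elim: b w => [|b IH] w Hw.
  by rewrite /= {1}/pochhammer big_ord0 mul1r iter_pd3.
have Hd : is_derive w (delta_mx 0 i2) ((pochhammer beta b * pochhammer gamma c)%:C *: jete 0 b c)
    ((pochhammer beta b * pochhammer gamma c)%:C *: ((beta + b%:R)%:C *: jete 0 b.+1 c w)).
  apply: is_deriveZ; rewrite -pd2_jete//; apply: derivableP.
  by case: (Djete 0 b c (delta_mx 0 i2) Hw).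
by rewrite iterS (pd_eq Hw IH Hd) scalerA -rcM pochS mulrAC.
Qed.

(** * Homogeneous jets and the derivatives of sigma_l *)

Definition hom d (p : nat -> C) a w : M := \sum_(b < d.+1) p b *: jete a b (d - b) w.

(** The action of the sum of the second and third partial derivatives on coefficients. The first
    summand raises the power of X_2, from b' to b' + 1; the second raises that of X_3, and its guard
    removes the source index d + 1, which does not exist in degree d. *)
Definition lift_coef d (p : nat -> C) : nat -> C := fun b =>
  (if b is b'.+1 then (beta + b'%:R)%:C * p b' else 0) +
  (if (b <= d)%N then (gamma + (d - b)%:R)%:C * p b else 0).

Lemma hom_lift d (p : nat -> C) a w : \sum_(b < d.+1) p b *:
    ((beta + b%:R)%:C *: jete a b.+1 (d - b) w + (gamma + (d - b)%:R)%:C *: jete a b (d - b).+1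
      w) =
  hom d.+1 (lift_coef d p) a w.
Proof.
rewrite /hom /lift_coef.
under [RHS]eq_bigr do rewrite scalerDl.
under [LHS]eq_bigr do rewrite scalerDr.
rewrite !big_split/=; congr (_ + _).
  rewrite [RHS]big_ord_recl scale0r add0r; apply: eq_bigr => b _.
  by rewrite lift0 subSS scalerA mulrC.
rewrite [RHS]big_ord_recr/= ltnn scale0r addr0; apply: eq_bigr => b _.
by rewrite -ltnS ltn_ord subSn -1?ltnS// scalerA mulrC.
Qed.

Lemma is_derive_hom d p a w h : D3 w -> h 0 i2 = h 0 i3 ->
  is_derive w h (hom d p a)
    (h 0 i1 *: ((alpha + a%:R)%:C *: hom d p a.+1 w) + h 0 i2 *: hom d.+1 (lift_coef d p) a w).
Proof.
move=> Hw h23.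
have -> : hom d p a = \sum_(b < d.+1) (p b *: jete a b (d - b)).
  by apply/funext => u; rewrite fct_sumE.
apply: (is_derive_cast (is_derive_sum (fun b : 'I_d.+1 => is_deriveZ (p b) (Djete a b (d - b) h
  Hw)))).
rewrite -hom_lift /hom !scaler_sumr -big_split/=; apply: eq_bigr => b _.
rewrite /djete -h23 -addrA scalerDr; congr (_ + _).
  by rewrite !scalerA; congr (_ *: _); ring.
by rewrite !scalerDr !scalerA; congr (_ *: _ + _ *: _); ring.
Qed.

(** For i = 0 these are the binomial coefficients of (beta)_l (gamma)_l (X_2 - X_3)^l: the
    Pochhammer denominators in [sigma] cancel the factors produced by the partial derivatives of the
    frame. *)
Fixpoint ucoef l i : nat -> C :=
  if i is i'.+1 then lift_coef (l + i') (ucoef l i')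
  else fun b => (pochhammer beta l * pochhammer gamma l)%:C * ((-1) ^+ (l - b) * 'C(l, b)%:R).

Definition ujet l i w : M := hom (l + i) (ucoef l i) 0 w.
Definition ujet1 l i w : M := alpha%:C *: hom (l + i) (ucoef l i) 1 w.

(** The pure power of X_2 arises only from the pure power one degree below, with the positive factor
    beta + l + i. *)
Lemma ucoef_top l i : ucoef l i (l + i) != 0.
Proof.
have P0 : (pochhammer beta l * pochhammer gamma l)%:C != 0 :> C.
  by rewrite gt_eqF// ltcR mulr_gt0// poch_gt0.
elim: i => [|i IH]; first by rewrite addn0/= subnn binn mulr1 expr0 mulr1.
by rewrite addnS/= /lift_coef ltnn addr0 mulf_neq0// lam_neq0.
Qed.

Lemma is_derive_ujet l i w h : D3 w -> h 0 i2 = h 0 i3 ->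
  is_derive w h (ujet l i) (h 0 i1 *: ujet1 l i w + h 0 i2 *: ujet l i.+1 w).
Proof.
move=> Hw h23; apply: (is_derive_cast (is_derive_hom (l + i) (ucoef l i) 0 Hw h23)).
by rewrite /ujet1 /ujet addr0 addnS.
Qed.

Lemma sigmaE l w : D3 w -> sigma beta gamma M l w = ujet l 0 w.
Proof.
(* [sigma] is indexed by the order in the third variable, [hom] by the order in the second. *)
move=> Hw; rewrite /sigma /ujet /hom addn0 (reindex_inj rev_ord_inj)/=.
apply: eq_bigr => j _; have jl : (j <= l)%N by rewrite -ltnS.
rewrite subSS subKn// iter_pd// scalerA; congr (_ *: _).
have B0 := poch_gt0 j beta_gt0; have G0 := poch_gt0 (l - j) gamma_gt0.
rewrite bin_sub// -rcM.
have -> : (-1) ^+ (l - j) * 'C(l, j)%:R = ((-1) ^+ (l - j) * 'C(l, j)%:R : R)%:C.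
  by rewrite rcM rmorphXn rmorphN1 rmorph_nat.
rewrite -rcM; congr (_%:C); field.
by rewrite !gt_eqF.
Qed.

Lemma pd23_hom d p w (f : pt -> M) : D3 w -> (forall u, D3 u -> f u = hom d p 0 u) ->
  pd i2 f w + pd i3 f w = hom d.+1 (lift_coef d p) 0 w.
Proof.
move=> Hw fg; rewrite -hom_lift.
have homE : hom d p 0 = \sum_(b < d.+1) (p b *: jete 0 b (d - b)).
  by apply/funext => u; rewrite fct_sumE.
have H2 : is_derive w (delta_mx 0 i2) (hom d p 0) (\sum_(b < d.+1) p b *: ((beta + b%:R)%:C *:
  jete 0 b.+1 (d - b) w)).
  rewrite homE; apply: (is_derive_cast (is_derive_sum (fun b : 'I_d.+1 => is_deriveZ (p b) (Djete
    0 b (d - b) (delta_mx 0 i2) Hw)))).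
  apply: eq_bigr => b _; rewrite /djete !delta_coord !i_neq !eqxx /=.
  by rewrite !mul0r mul1r !scale0r ?add0r ?addr0.
have H3 : is_derive w (delta_mx 0 i3) (hom d p 0) (\sum_(b < d.+1) p b *: ((gamma + (d -
  b)%:R)%:C *: jete 0 b (d - b).+1 w)).
  rewrite homE; apply: (is_derive_cast (is_derive_sum (fun b : 'I_d.+1 => is_deriveZ (p b) (Djete
    0 b (d - b) (delta_mx 0 i3) Hw)))).
  apply: eq_bigr => b _; rewrite /djete !delta_coord !i_neq !eqxx /=.
  by rewrite !mul0r mul1r !scale0r ?add0r ?addr0.
rewrite (pd_eq Hw fg H2) (pd_eq Hw fg H3) -big_split/=.
by apply: eq_bigr => b _; rewrite scalerDr.
Qed.

Lemma jetEl_frameE l k (i : 'I_k) w : D3 w -> jetEl_frame beta gamma M l k i w = ujet l i w.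
Proof.
rewrite /jetEl_frame; move: (nat_of_ord i) w => {}i; elim: i => [|i IH] w Hw.
  exact: sigmaE.
by rewrite iterS (pd23_hom Hw IH) /ujet addnS.
Qed.

(* [z / (1 - z w) = x] for [z = x / (1 + x w)]. *)
Definition zpt w x y : pt := \row_j (if j == i2 then x / (1 + x * w 0 i2)
  else if j == i3 then y / (1 + y * w 0 i3) else 0).

(** Since |x y| < 1/2, the modulus of 1 + x y exceeds 1/2, hence |x|. *)
Lemma small_frac x y : `|x| < (2^-1)%:C -> `|y| < 1 ->
  1 + x * y != 0 /\ `|x / (1 + x * y)| < 1.
Proof.
move=> x2 y1.
have xy : `|x * y| < (2^-1)%:C.
  by rewrite normrM (le_lt_trans _ x2)// ler_piMr// ltW.
have h2 : (2^-1)%:C < `|1 + x * y|.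
  have := lerB_normD 1 (x * y); rewrite normr1; apply: lt_le_trans.
  rewrite ltrBrDl -ltrBrDr (lt_le_trans xy)//.
  have E : 2^-1 + 2^-1 = 1 :> R by field.
  have -> : 1 = (2^-1 + 2^-1)%:C :> C by rewrite E.
  by rewrite rcD addrK.
have n0 : 0 < `|1 + x * y| by apply: lt_trans h2; rewrite ltcR.
split; first by rewrite -normr_gt0.
by rewrite normrM normfV ltr_pdivrMr// mul1r (lt_trans x2).
Qed.

Lemma D3_zpt w x y : D3 w -> `|x| < (2^-1)%:C -> `|y| < (2^-1)%:C -> D3 (zpt w x y).
Proof.
move=> Hw x2 y2; apply: ord3P; rewrite mxE !i_neq ?eqxx ?normr0 ?ltr01//.
  exact: (small_frac x2 (Hw i2)).2.
exact: (small_frac y2 (Hw i3)).2.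
Qed.

Lemma cpow_subn (t : C) (lam : R) a : 0 < complex.Re t ->
  cpow t (- lam - a%:R) = cpow t (- lam) / t ^+ a.
Proof.
move=> t0; have tn0 : t != 0 by apply: contraTneq t0 => ->; rewrite ltxx.
elim: a => [|a IH]; first by rewrite subr0 divr1.
have E : cpow t (- lam - a%:R) = t * cpow t (- lam - a.+1%:R).
  by rewrite -cpowS//; congr cpow; rewrite -natr1; ring.
apply: (mulfI tn0); rewrite -E IH exprS.
by field; rewrite tn0 expf_neq0.
Qed.

Lemma kjet1_small (lam : R) a x y : `|x| < (2^-1)%:C -> `|y| < 1 ->
  kjet1 lam a (x / (1 + x * y)) y = x ^+ a * cpow (1 - x / (1 + x * y) * y) (- lam).
Proof.
move=> x2 y1; have [n0 z1] := small_frac x2 y1.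
have hp := halfplane z1 y1.
have E : 1 - x / (1 + x * y) * y = (1 + x * y)^-1 by field.
rewrite /kjet1 cpow_subn// {2}E exprVn invrK expr_div_n.
by field; rewrite expf_neq0.
Qed.

(** At these points X_2 = x and X_3 = y, so all jets become monomials up to the common factor K_w;
    the first coordinate 0 contributes 1. *)
Lemma kjet_zpt w : D3 w -> forall x y, `|x| < (2^-1)%:C -> `|y| < (2^-1)%:C ->
  exists2 k : C, k != 0 & forall b c, kjet alpha beta gamma 0 b c (zpt w x y) w = k * (x ^+ b * y
    ^+ c).
Proof.
move=> Hw x y x2 y2.
exists (cpow (1 - x / (1 + x * w 0 i2) * w 0 i2) (- beta) *
        cpow (1 - y / (1 + y * w 0 i3) * w 0 i3) (- gamma)).
  have [_ ?] := small_frac x2 (Hw i2); have [_ ?] := small_frac y2 (Hw i3).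
  by rewrite mulf_neq0// cpow_neq0// halfplane.
move=> b c; rewrite /kjet !mxE !i_neq !eqxx !kjet1_small//.
by rewrite /kjet1 expr0 mul0r !subr0 cpow1 !mul1r; ring.
Qed.

Lemma ev_suml (I : finType) (F : I -> M) z : D3 z -> ev (\sum_i F i) z = \sum_i ev (F i) z.
Proof.
move=> Hz; rewrite -(reproducing _ Hz) ip_suml; apply: eq_bigr => i _.
by rewrite reproducing.
Qed.

Lemma ev_scale (a : C) (f : M) z : D3 z -> ev (a *: f) z = a * ev f z.
Proof. by move=> Hz; rewrite -(reproducing _ Hz) ipZl reproducing. Qed.

Lemma ev_zero z : D3 z -> ev (0 : M) z = 0.
Proof. by move=> Hz; rewrite -(reproducing _ Hz) ip0l. Qed.

Lemma jete_indep (I : finType) (b c : I -> nat) w (k : I -> C) : D3 w ->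
  injective (fun i => (b i, c i)) -> \sum_i k i *: jete 0 (b i) (c i) w = 0 ->
  forall i, k i = 0.
Proof.
move=> Hw inj E; apply: (monomials_indep inj) => x y x2 y2.
have Dz := D3_zpt Hw x2 y2.
have [q q0 Hq] := kjet_zpt Hw x2 y2.
have := congr1 (fun f => ev f (zpt w x y)) E; rewrite ev_zero// ev_suml// => H.
apply: (mulfI q0); rewrite mulr0 -[RHS]H mulr_sumr; apply: eq_bigr => i _.
by rewrite ev_scale// evjete// Hq mulrCA.
Qed.

(** At y = 0 only the pure power of X_2 survives, so the i-th jet becomes its nonzero top
    coefficient times x^(l + i), and these exponents are distinct. *)
Lemma ujet_indep l n w (k : 'I_n -> C) : D3 w -> \sum_i k i *: ujet l i w = 0 ->
  forall i, k i = 0.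
Proof.
move=> Hw E i.
suff : k i * ucoef l i (l + i) = 0.
  by move/eqP; rewrite mulf_eq0 (negbTE (ucoef_top _ _)) orbF => /eqP.
move: i; apply: (@monomials_indep _ _ (fun i : 'I_n => l + i)%N (fun=> 0%N)).
  by move=> i j [] /addnI/ord_inj.
move=> x y x2 _; have y2 : `|0 : C| < (2^-1)%:C by rewrite normr0 ltcR.
have Dz := D3_zpt Hw x2 y2.
have [q q0 Hq] := kjet_zpt Hw x2 y2.
have := congr1 (fun f => ev f (zpt w x 0)) E; rewrite ev_zero// ev_suml// => H.
apply: (mulfI q0); rewrite mulr0 -[RHS]H mulr_sumr; apply: eq_bigr => i _.
rewrite ev_scale// /ujet /hom ev_suml// (bigD1 ord_max)//= big1 ?addr0.
  by rewrite subnn ev_scale// evjete// Hq !expr0; ring.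
move=> b bm; rewrite ev_scale// evjete// Hq expr0n subn_eq0.
have -> : (l + i <= b)%N = false.
  apply: contra_neqF bm => lb; apply/val_inj/eqP; rewrite /= eqn_leq lb andbT.
  by rewrite -ltnS.
by rewrite !mulr0.
Qed.

(** * Orthogonality of the jets of different sigma_l *)

Lemma ev_ujet0 m v z : D3 v -> v 0 i2 = v 0 i3 -> D3 z -> ev (ujet m 0 v) z =
  (pochhammer beta m * pochhammer gamma m)%:C * cpow (1 - z 0 i1 * v 0 i1) (- alpha) *
  (z 0 i2 - z 0 i3) ^+ m *
  cpow (1 - z 0 i2 * v 0 i2) (- beta - m%:R) * cpow (1 - z 0 i3 * v 0 i3) (- gamma - m%:R).
Proof.
move=> Hv v23 Hz; rewrite /ujet /hom ev_suml// addn0.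
have h2 := halfplane (Hz i2) (Hv i2); have h3 := halfplane (Hz i3) (Hv i3).
set r2 := 1 - z 0 i2 * v 0 i2; set r3 := 1 - z 0 i3 * v 0 i3.
have r20 : r2 != 0 by apply: contraTneq h2; rewrite -/r2 => ->; rewrite ltxx.
have r30 : r3 != 0 by apply: contraTneq h3; rewrite -/r3 => ->; rewrite ltxx.
(* As v_2 = v_3, this is the numerator of X_2 - X_3 over the common denominator r2 r3; the binomial
   formula then matches the sum term by term. *)
have -> : z 0 i2 - z 0 i3 = z 0 i2 * r3 - z 0 i3 * r2 by rewrite /r2 /r3 v23; ring.
rewrite exprBn mulr_sumr !mulr_suml (reindex_inj rev_ord_inj)/=; apply: eq_bigr => j _.
have jm : (j <= m)%N by rewrite -ltnS.
rewrite subSS ev_scale// evjete// subKn// bin_sub// /kjet /kjet1 expr0 mul1r subr0 -/r2 -/r3.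
rewrite !(cpow_subn _ _ h2) !(cpow_subn _ _ h3) !exprMn.
rewrite -/r2 -/r3.
have E2 : r2 ^+ m = r2 ^+ (m - j) * r2 ^+ j by rewrite -exprD subnK.
have E3 : r3 ^+ m = r3 ^+ (m - j) * r3 ^+ j by rewrite -exprD subnK.
rewrite E2 E3 -mulr_natr.
by field; rewrite !expf_neq0.
Qed.

Lemma is_derive_sub23 w h : is_derive w h (fun w : pt => w 0 i2 - w 0 i3) (h 0 i2 - h 0 i3).
Proof. exact: is_deriveB (is_derive_coord w h i2) (is_derive_coord w h i3). Qed.

(** By reproduction, the pairing of s(w) with sigma_m(v) contains (w_2 - w_3)^m, and each derivative
    in w_2 or w_3 costs one factor. These derivatives leave w_2 = w_3, so w ranges over the whole
    polydisc; the cofactor stays in [sm] so that it can be differentiated again. *)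
Lemma ip_jete_ujet0 m v b c : D3 v -> v 0 i2 = v 0 i3 -> (b + c <= m)%N ->
  exists2 G, sm G & forall w, D3 w ->
    ip (jete 0 b c w) (ujet m 0 v) = (w 0 i2 - w 0 i3) ^+ (m - (b + c)) * G w (conjv v).
Proof.
move=> Hv v23.
pose P b c := exists2 G, sm G & forall w, D3 w ->
    ip (jete 0 b c w) (ujet m 0 v) = (w 0 i2 - w 0 i3) ^+ (m - (b + c)) * G w (conjv v).
have step (p q p' q' : nat) i (lam : R) : lam%:C != 0 :> C ->
    (p' + q' = (p + q).+1)%N -> (p + q < m)%N ->
    (forall w, D3 w -> djete M 0 p q (delta_mx 0 i) w = lam%:C *: jete 0 p' q' w) ->
    P p q -> P p' q'.
  move=> l0 bc bcm Dl [G SG HG].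
  have [G' SG' HG'] := sm_derive (delta_mx 0 i) SG.
  set n := (m - (p' + q'))%N.
  have nE : (m - (p + q))%N = n.+1 by rewrite /n bc subnSK.
  pose s : C := (delta_mx 0 i : pt) 0 i2 - (delta_mx 0 i : pt) 0 i3.
  (* The Leibniz rule for (w_2 - w_3)^(n + 1) G with the power n factored out; s is the derivative
     of w_2 - w_3. *)
  exists (fun w u => lam%:C^-1 * ((n.+1%:R * s) * G w u + (w 0 i2 + (-1) * w 0 i3) * G' w u)).
    apply: sm_mul; first exact: sm_cst.
    apply: sm_add; first exact: (sm_mul (sm_cst _) SG).
    have S23 : sm (fun w u : pt => w 0 i2 + (-1) * w 0 i3).
      by apply: sm_add; [exact: sm_l|apply: sm_mul; [exact: sm_cst|exact: sm_l]].
    exact: (sm_mul S23 SG').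
  move=> w Hw.
  have D1 := is_derive_ipl (ujet m 0 v) (Djete 0 p q (delta_mx 0 i) Hw).
  have D2 := is_deriveM (is_deriveX n.+1 (is_derive_sub23 w (delta_mx 0 i))) (HG' _ _ Hw (D3_conj
    Hv)).
  set dv := (X in is_derive _ _ _ X) in D2.
  have D3' : is_derive w (delta_mx 0 i) (fun w => ip (jete 0 p q w) (ujet m 0 v)) dv.
    apply: (is_derive_D3 Hw _ D2) => u Hu.
    by rewrite HG// nE !fctE.
  have := is_derive_unique D1 D3'; rewrite Dl// ipZl => E.
  apply: (mulfI l0); rewrite E /dv /= -/s mulN1r.
  rewrite !fctE/= -mulr_natl /GRing.scale/= exprS -/n.
  by field.
move: b c; suff H : forall b c, (b + c <= m)%N -> P b c by exact: H.
elim=> [|b IHb] c.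
  elim: c => [_|c IHc cm]; last first.
    apply: (@step 0%N c 0%N c.+1 i3 (gamma + c%:R)) => //.
    - exact: lam_neq0.
    - move=> w Hw; rewrite /djete !delta_coord !i_neq !eqxx /=.
      by rewrite !mul0r mul1r !scale0r ?add0r ?addr0.
    - by apply: IHc; exact: ltnW.
  exists (fun w u => (pochhammer beta m * pochhammer gamma m)%:C * (cpow (1 - w 0 i1 * u 0 i1) (-
    alpha) *
     (cpow (1 - w 0 i2 * u 0 i2) (- beta - m%:R) * cpow (1 - w 0 i3 * u 0 i3) (- gamma - m%:R)))).
    exact: (sm_mul (sm_cst _) (sm_mul (sm_pow _ _) (sm_mul (sm_pow _ _) (sm_pow _ _)))).
  move=> w Hw; rewrite jete000// /frameE ip_conj reproducing; last exact: D3_conj.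
  rewrite -/(conjv w) ev_ujet0//; last exact: D3_conj.
  have XE : conjc ((conjv w 0 i2 - conjv w 0 i3) ^+ m) = (w 0 i2 - w 0 i3) ^+ m.
    by rewrite rmorphXn rmorphB/= !conjvE !conjcK.
  rewrite 4!conjcM XE conjc_real !cpow_conj !conjcD conjc1 !conjcN !conjcM !conjvE !conjcK subn0.
  by ring.
move=> bm; apply: (@step b c b.+1 c i2 (beta + b%:R)) => //.
- exact: lam_neq0.
- move=> w Hw; rewrite /djete !delta_coord !i_neq !eqxx /=.
  by rewrite !mul0r mul1r !scale0r ?add0r ?addr0.
- by apply: IHb; exact: ltnW.
Qed.

Lemma ujet0_orth l m w v : (l < m)%N -> D3 w -> D3 v -> w 0 i2 = w 0 i3 -> v 0 i2 = v 0 i3 ->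
  ip (ujet l 0 w) (ujet m 0 v) = 0.
Proof.
move=> lm Hw Hv w23 v23; rewrite /ujet {1}/hom ip_suml big1// => b _.
have bl : (b + (l + 0 - b) = l)%N by rewrite subnKC ?addn0// -ltnS.
rewrite ipZl -/(ujet m 0 v).
have [|G _ ->//] := @ip_jete_ujet0 m v b (l + 0 - b) Hv v23; first by rewrite bl ltnW.
by rewrite bl w23 subrr expr0n subn_eq0 leqNgt lm mul0r mulr0.
Qed.

Lemma ip_tangent_eq0 (f : pt -> M) (g : M) w d : D3 w -> w 0 i2 = w 0 i3 ->
  (forall u, D3 u -> u 0 i2 = u 0 i3 -> ip (f u) g = 0) ->
  is_derive w (delta_mx 0 i2 + delta_mx 0 i3) f d -> ip d g = 0.
Proof.
move=> Hw w23 H0 Hd.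
have /is_derive_line D1 := is_derive_ipl g Hd.
apply: (is_derive_unique D1); apply/is_derive_nearP => e e0.
apply: filterS (D3_near (delta_mx 0 i2 + delta_mx 0 i3) Hw) => x Hx.
rewrite !add0r [x *: 1]mulr1 scale0r addr0 !H0// ?subrr ?scaler0 ?subr0 ?normr0 ?mulr_ge0//
  ?ltW//.
by rewrite !mxE !i_neq !eqxx w23 /= addr0 add0r.
Qed.

(** The direction (0, 1, 1) is tangent to z_2 = z_3 but not to Delta, hence the relation is carried
    on all of z_2 = z_3. As w and v are independent there, one slot is differentiated at a time, the
    other being held fixed. *)
Lemma ujet_orth l m i j w v : (l < m)%N -> D3 w -> D3 v -> w 0 i2 = w 0 i3 -> v 0 i2 = v 0 i3 ->
  ip (ujet l i w) (ujet m j v) = 0.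
Proof.
move=> lm Hw Hv w23 v23.
have D n k u : D3 u -> is_derive u (delta_mx 0 i2 + delta_mx 0 i3) (ujet n k) (ujet n k.+1 u).
  move=> Hu; have := @is_derive_ujet n k u (delta_mx 0 i2 + delta_mx 0 i3) Hu.
  rewrite !mxE !i_neq !eqxx /= ?addr0 ?add0r scale0r scale1r add0r; exact.
have H1 : forall w, D3 w -> w 0 i2 = w 0 i3 -> ip (ujet l i w) (ujet m 0 v) = 0.
  elim: i => [|i IH] u Hu u23; first exact: ujet0_orth.
  exact: (ip_tangent_eq0 Hu u23 IH (D _ _ _ Hu)).
move: v Hv v23 H1; elim: j => [|j IH] v Hv v23 H1; first exact: H1.
apply: ip_eq0C; apply: (ip_tangent_eq0 Hv v23 _ (D _ _ _ Hv)) => u Hu u23.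
apply: ip_eq0C; apply: IH => // w' Hw' w'23.
elim: i {H1} w' Hw' w'23 => [|i IH'] w' Hw' w'23; first exact: ujet0_orth.
exact: (ip_tangent_eq0 Hw' w'23 IH' (D _ _ _ Hw')).
Qed.

(** * Splitting off the first variable *)

Definition drop1 w : pt := \row_j (if j == i1 then 0 else w 0 j).

Lemma D3_drop1 w : D3 w -> D3 (drop1 w).
Proof. by move=> Hw i; rewrite mxE; case: eqP => // _; rewrite normr0 ltr01. Qed.

Lemma drop1D w x i : i != i1 -> drop1 (w + x *: delta_mx 0 i) = drop1 w + x *: delta_mx 0 i.
Proof.
move=> i1i; apply/rowP => j; rewrite !mxE; case: eqP => // ->.
by rewrite (eq_sym i1 i) (negbTE i1i) andbF mulr0 addr0.
Qed.

Lemma is_derive_drop1 (f : pt -> M) w i d : i != i1 -> is_derive (drop1 w) (delta_mx 0 i) f d ->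
  is_derive w (delta_mx 0 i) (f \o drop1) d.
Proof.
move=> ii /is_derive_nearP H; apply/is_derive_nearP => e /H; apply: filterS => x.
by rewrite /= drop1D.
Qed.

(** With a kernel function in the second slot, the pairing is an explicit value, from which the
    first variable splits off. Derivatives of the second slot in the other two variables do not
    touch the scalar factor. *)
Lemma ip_jete_factor b c b' c' w v : D3 w -> D3 v ->
  ip (jete 0 b c w) (jete 0 b' c' v) =
  cpow (1 - w 0 i1 * conjc (v 0 i1)) (- alpha) *
  ip (jete 0 b c (drop1 w)) (jete 0 b' c' (drop1 v)).
Proof.
have base : forall w v, D3 w -> D3 v -> ip (jete 0 b c w) (jete 0 0 0 v) =
  cpow (1 - w 0 i1 * conjc (v 0 i1)) (- alpha) *
  ip (jete 0 b c (drop1 w)) (jete 0 0 0 (drop1 v)).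
  move=> {w v} w v Hw Hv; rewrite !jete000//; last exact: D3_drop1.
  have Dw := D3_drop1 Hw; have Dv := D3_drop1 Hv.
  rewrite /frameE !reproducing -?/(conjv _); try exact: D3_conj.
  rewrite !evjete//; try exact: D3_conj.
  rewrite /kjet /kjet1 !conjvE !mxE !i_neq !eqxx conjc0 !mul0r !subr0 cpow1 !expr0 !mul1r.
  by rewrite (mulrC (conjc _) (w 0 i1)); ring.
have step (p q p' q' : nat) i (lam : R) : lam%:C != 0 :> C -> i != i1 ->
    (forall w, D3 w -> djete M 0 p q (delta_mx 0 i) w = lam%:C *: jete 0 p' q' w) ->
    (forall w v, D3 w -> D3 v -> ip (jete 0 b c w) (jete 0 p q v) =
      cpow (1 - w 0 i1 * conjc (v 0 i1)) (- alpha) * ip (jete 0 b c (drop1 w)) (jete 0 p q (drop1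
        v))) ->
    (forall w v, D3 w -> D3 v -> ip (jete 0 b c w) (jete 0 p' q' v) =
      cpow (1 - w 0 i1 * conjc (v 0 i1)) (- alpha) * ip (jete 0 b c (drop1 w)) (jete 0 p' q'
        (drop1 v))).
  move=> l0 ii Dl IH {w v} w v Hw Hv.
  have Dv := D3_drop1 Hv.
  have D1 := is_derive_ipl (jete 0 b c w) (Djete 0 p q (delta_mx 0 i) Hv).
  have D2 := is_derive_ipl (jete 0 b c (drop1 w)) (is_derive_drop1 ii (Djete 0 p q (delta_mx 0 i)
    Dv)).
  set k := cpow (1 - w 0 i1 * conjc (v 0 i1)) (- alpha).
  have D2' := is_deriveZ (conjc k) D2.
  have E : ip (djete M 0 p q (delta_mx 0 i) v) (jete 0 b c w) =
      conjc k *: ip (djete M 0 p q (delta_mx 0 i) (drop1 v)) (jete 0 b c (drop1 w)).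
    move/is_derive_line in D1; move/is_derive_line in D2'.
    apply: (is_derive_unique D1); apply/is_derive_nearP => e e0.
    have /is_derive_nearP/(_ e e0) := D2'.
    apply: filterS2 (D3_near (delta_mx 0 i) Hv) => x Hx.
    rewrite !add0r [x *: 1]mulr1 scale0r addr0.
    have F u : D3 u -> u 0 i1 = v 0 i1 -> ip (jete 0 p q u) (jete 0 b c w) =
       conjc k * ip (jete 0 p q (drop1 u)) (jete 0 b c (drop1 w)).
      by move=> Hu u1; rewrite ip_conj IH// conjcM -ip_conj u1.
    by rewrite !F// !mxE eq_sym (negbTE ii) mulr0 addr0.
  move: E; rewrite !Dl// !ipZl -[_ *: _]/(conjc k * _) mulrCA => /(mulfI l0) E.
  by rewrite ip_conj E conjcM conjcK -ip_conj.
elim: b' w v => [|b' IHb] w v; last first.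
  apply: (@step b' c' b'.+1 c' i2 (beta + b'%:R)) => //.
  - exact: lam_neq0.
  - by rewrite i21.
  - move=> u Hu; rewrite /djete !delta_coord !i_neq !eqxx /=.
    by rewrite !mul0r mul1r !scale0r ?add0r ?addr0.
elim: c' w v => [|c' IHc] w v; last first.
  apply: (@step 0%N c' 0%N c'.+1 i3 (gamma + c'%:R)) => //.
  - exact: lam_neq0.
  - by rewrite i31.
  - move=> u Hu; rewrite /djete !delta_coord !i_neq !eqxx /=.
    by rewrite !mul0r mul1r !scale0r ?add0r ?addr0.
exact: base.
Qed.

Lemma ip_derive_along1 (F : pt -> M) (g : M) (phi : C -> C) (c dphi : C) (d : M) w : D3 w ->
  is_derive w (delta_mx 0 i1) F d -> is_derive (w 0 i1) 1 phi dphi ->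
  (forall u, D3 u -> drop1 u = drop1 w -> ip (F u) g = phi (u 0 i1) * c) ->
  ip d g = dphi * c.
Proof.
move=> Hw HF Hphi E.
have /is_derive_line D1 := is_derive_ipl g HF.
have D2 : is_derive w (delta_mx 0 i1) (fun u : pt => phi (u 0 i1) * c) (dphi * c).
  apply: (is_derive_cast (is_deriveM (is_derive_chain (is_derive_coord w (delta_mx 0 i1) i1)
    Hphi) (is_derive_cst c w (delta_mx 0 i1)))).
  by rewrite delta_coord eqxx scale1r scaler0 add0r -[_ *: _]/(c * dphi) mulrC.
move/is_derive_line/is_derive_nearP in D2.
apply: (is_derive_unique D1); apply/is_derive_nearP => e e0.
apply: filterS2 (D3_near (delta_mx 0 i1) Hw) (D2 e e0) => x Hx.
have dr y : drop1 (w + y *: delta_mx 0 i1) = drop1 w.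
  apply/rowP => j; rewrite !mxE; case: (altP (j =P i1)) => // ji.
  by rewrite andbF mulr0 addr0.
have Ex : ip (F (w + x *: delta_mx 0 i1)) g = phi ((w + x *: delta_mx 0 i1) 0 i1) * c.
  by rewrite E.
by rewrite !add0r [x *: 1]mulr1 scale0r addr0 Ex E.
Qed.

(** A derivative in the first variable acts only on the factor (1 - w_1 conj v_1)^(- alpha). Up to
    powers of alpha, A and B are its derivatives in one slot and in both slots, divided by the
    factor itself; hence they do not depend on the other indices. *)
Lemma gram_level1 w : D3 w -> exists A B : C, forall b c b' c',
  ip (jete 1 b c w) (jete 0 b' c' w) = A * ip (jete 0 b c w) (jete 0 b' c' w) /\
  ip (jete 1 b c w) (jete 1 b' c' w) = B * ip (jete 0 b c w) (jete 0 b' c' w).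
Proof.
move=> Hw; have a0 : alpha%:C != 0 :> C by rewrite gt_eqF// ltcR.
have cw1 (v : pt) : D3 v -> `|conjc (v 0 i1)| < 1 by move=> Hv; rewrite normcJ; exact: Hv.
have Dl v : D3 v -> forall b c, djete M 0 b c (delta_mx 0 i1) v = alpha%:C *: jete 1 b c v.
  move=> Hv b c; rewrite /djete !delta_coord !i_neq !eqxx /=.
  by rewrite !mul0r mul1r !scale0r ?addr0.
have S2 : forall w v b c b' c', D3 w -> D3 v -> ip (jete 1 b c w) (jete 0 b' c' v) =
   (conjc (v 0 i1) * cpow (1 - conjc (v 0 i1) * w 0 i1) (- alpha - 1)) *
   ip (jete 0 b c (drop1 w)) (jete 0 b' c' (drop1 v)).
  move=> {Hw} {}w v b c b' c' Hw Hv; apply: (mulfI a0).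
  rewrite -(ipZl alpha%:C (jete 1 b c w)) -(Dl w Hw).
  rewrite (ip_derive_along1 Hw (Djete 0 b c (delta_mx 0 i1) Hw)
    (is_derive_cpow_lin (- alpha) (cw1 v Hv) (Hw i1)) (c := ip (jete 0 b c (drop1 w)) (jete 0 b'
      c' (drop1 v)))).
    by rewrite rmorphN/=; ring.
  by move=> u Hu uw; rewrite ip_jete_factor// uw (mulrC (u 0 i1)).
pose k0 := cpow (1 - w 0 i1 * conjc (w 0 i1)) (- alpha).
have k00 : k0 != 0 by rewrite cpow_neq0// halfplane ?cw1.
(* The conjugate of [S2], with the slots exchanged, shows that a first-variable derivative in the
   second slot leaves this function of the first coordinate of the first point. *)
pose D : C := 'D_1 (fun x : C => x * cpow (1 - conjc (w 0 i1) * x) (- alpha - 1)) (w 0 i1).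
exists (conjc (w 0 i1) * cpow (1 - conjc (w 0 i1) * w 0 i1) (- alpha - 1) / k0), (alpha%:C^-1 * D
  / k0).
move=> b c b' c'; rewrite [ip (jete 0 b c w) _]ip_jete_factor// -/k0; split.
  by rewrite S2// mulrA divfK.
rewrite mulrA divfK// -mulrA; apply: (mulfI a0); rewrite mulVKf//.
rewrite -(ipZl alpha%:C (jete 1 b c w)) -(Dl w Hw).
have Dm : is_derive (w 0 i1) 1 (fun x : C => x * cpow (1 - conjc (w 0 i1) * x) (- alpha - 1)) D.
  apply: derivableP.
  have [] // := is_deriveM (is_derive_id (w 0 i1) 1) (is_derive_cpow_lin (- alpha - 1) (cw1 w Hw)
    (Hw i1)).
apply: (ip_derive_along1 Hw (Djete 0 b c (delta_mx 0 i1) Hw) Dm) => u Hu uw.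
have := congr1 (@conjc R) (S2 w u b' c' b c Hw Hu).
rewrite -ip_conj conjcM [conjc (_ * cpow _ _)]conjcM conjcK cpow_conj conjcD conjc1 conjcN.
by rewrite [conjc (conjc _ * _)]conjcM conjcK -ip_conj uw (mulrC (u 0 i1) (conjc _)).
Qed.
End Frames.

(** * Linear systems with differentiable or continuous entries *)

Lemma is_derive_scale (K : numFieldType) (V : normedModType K) (a : K -> K) (g : K -> V)
    (t da : K) (dg : V) :
  is_derive t 1 a da -> is_derive t 1 g dg ->
  is_derive t 1 (fun s => a s *: g s) (da *: g t + a t *: dg).
Proof.
move=> Ha Hg.
have cg : g (t + h) @[h --> (0 : K)] --> g t.
  have /differentiable_continuous cgt : differentiable g t by apply/derivable1_diffP.
  apply: (cvg_at_comp (fun h : K => t + h) g cgt).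
  apply/cvg_at_distP => e e0; apply: filterS (nbhs0_le e0) => h.
  by rewrite opprD addNKr normrN.
move/cvg_at_distP in cg; move/is_derive_nearP in Ha; move/is_derive_nearP in Hg.
apply/is_derive_nearP => e e0.
pose n := `|g t| + 1 + `|da| + `|a t|.
have n0 : 0 < n by rewrite ltr_wpDr// ltr_wpDr// ltr_wpDl.
have en : 0 < e / n by rewrite divr_gt0.
near=> h.
have A : `|a (t + h *: 1) - a t - h *: da| <= e / n * `|h| by near: h; exact: Ha.
have G : `|g (t + h *: 1) - g t - h *: dg| <= e / n * `|h| by near: h; exact: Hg.
have c1 : `|g t - g (t + h)| <= 1 by near: h; exact: cg.
have c2 : `|g t - g (t + h)| <= e / n by near: h; exact: cg.
rewrite [_ *: 1]mulr1 in A G *.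
have -> : a (t + h) *: g (t + h) - a t *: g t - h *: (da *: g t + a t *: dg) =
  (a (t + h) - a t - h *: da) *: g (t + h) - (h * da) *: (g t - g (t + h)) +
  a t *: (g (t + h) - g t - h *: dg).
  rewrite -[h *: da]/(h * da) !scalerBl !scalerBr scalerDr !scalerA (mulrC h (a t)).
  rewrite !opprB !opprD !addrA.
  move: (a (t + h) *: g (t + h)) (a t *: g t) ((h * da) *: g t) ((a t * h) *: dg) (a t *: g (t +
    h)) ((h * da) *: g (t + h)) => X1 X2 X3 X4 X5 X6.
  rewrite [in RHS](addrAC _ (- X6)) addrK.
  by rewrite [in RHS](addrAC _ (- X3) X5) subrK [in RHS](addrAC X1).
apply: le_trans (ler_normD _ _) _.
apply: (@le_trans _ _ (e / n * `|h| * (`|g t| + 1) + `|h| * `|da| * (e / n) + `|a t| * (e / n *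
  `|h|))); last first.
  suff -> : e / n * `|h| * (`|g t| + 1) + `|h| * `|da| * (e / n) + `|a t| * (e / n * `|h|) = e /
    n * n * `|h|.
    by rewrite divfK ?gt_eqF.
  by rewrite /n; move: (e / _) => w; ring.
apply: lerD; last by rewrite normrZ ler_wpM2l.
apply: le_trans (ler_normB _ _) _; apply: lerD.
  rewrite normrZ; apply: ler_pM => //.
  rewrite -[g (t + h)](subrK (g t)) addrC; apply: le_trans (ler_normD _ _) _.
  by rewrite lerD2l distrC.
by rewrite normrZ normrM ler_wpM2l// mulr_ge0.
Unshelve. all: by end_near. Qed.

Section CvgAt.
Variables (T : topologicalType) (K : numFieldType) (V : normedModType K) (x : T).

Lemma cvg_at_cst (U : topologicalType) (c : U) : c @[_ --> x] --> c.
Proof. exact: cvg_cst. Qed.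

Lemma cvg_atD (f g : T -> V) (a b : V) : f y @[y --> x] --> a -> g y @[y --> x] --> b ->
  f y + g y @[y --> x] --> a + b.
Proof. exact: cvgD. Qed.

Lemma cvg_atN (f : T -> V) (a : V) : f y @[y --> x] --> a -> - f y @[y --> x] --> - a.
Proof. exact: cvgN. Qed.

Lemma cvg_atZ (f : T -> K) (g : T -> V) (a : K) (b : V) : f y @[y --> x] --> a ->
  g y @[y --> x] --> b -> f y *: g y @[y --> x] --> a *: b.
Proof. exact: cvgZ. Qed.

Lemma cvg_atM (f g : T -> K) (a b : K) : f y @[y --> x] --> a -> g y @[y --> x] --> b ->
  f y * g y @[y --> x] --> a * b.
Proof. exact: cvgM. Qed.

Lemma cvg_atV (f : T -> K) (a : K) : a != 0 -> f y @[y --> x] --> a ->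
  (f y)^-1 @[y --> x] --> a^-1.
Proof. exact: cvgV. Qed.

Lemma cvg_at_sum (I : Type) (r : seq I) (f : I -> T -> V) (a : I -> V) :
  (forall i, f i y @[y --> x] --> a i) ->
  \sum_(i <- r) f i y @[y --> x] --> \sum_(i <- r) a i.
Proof.
move=> H; elim: r => [|i r IH].
  rewrite big_nil; have -> : (fun y => \sum_(i <- [::]) f i y) = (fun=> 0).
    by apply/funext => y; rewrite big_nil.
  exact: cvg_at_cst.
rewrite big_cons; have -> : (fun y => \sum_(j <- i :: r) f j y) = (fun y => f i y + \sum_(j <- r)
  f j y).
  by apply/funext => y; rewrite big_cons.
exact: cvg_atD.
Qed.
End CvgAt.

(* [P] will be differentiability, respectively continuity, at [t0]. *)
Section Cramer.
Variables (R : realType) (t0 : R[i]) (P : (R[i] -> R[i]) -> Prop).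
Local Notation C := R[i].
Hypothesis P_cst : forall c : C, P (fun=> c).
Hypothesis P_add : forall f g, P f -> P g -> P (fun t => f t + g t).
Hypothesis P_mul : forall f g, P f -> P g -> P (fun t => f t * g t).
Hypothesis P_inv : forall f, f t0 != 0 -> P f -> P (fun t => (f t)^-1).
Hypothesis P_near : forall f g, (\forall t \near t0, f t = g t) -> P f -> P g.
Hypothesis P_neq0 : forall f, f t0 != 0 -> P f -> \forall t \near t0, f t != 0.

Lemma P_sum (I : Type) (r : seq I) (Q : pred I) (F : I -> C -> C) :
  (forall i, P (F i)) -> P (fun t => \sum_(i <- r | Q i) F i t).
Proof.
move=> HF; elim: r => [|i r IH].
  by have -> : (fun t => \sum_(i <- [::] | Q i) F i t) = (fun=> 0) by apply/funext => t; rewrite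
    big_nil.
have -> : (fun t => \sum_(j <- i :: r | Q j) F j t) =
    (if Q i then fun t => F i t + \sum_(j <- r | Q j) F j t else fun t => \sum_(j <- r | Q j) F j
      t).
  by apply/funext => t; rewrite big_cons; case: (Q i).
by case: (Q i) => //; exact: P_add.
Qed.

Lemma P_prod (I : Type) (r : seq I) (Q : pred I) (F : I -> C -> C) :
  (forall i, P (F i)) -> P (fun t => \prod_(i <- r | Q i) F i t).
Proof.
move=> HF; elim: r => [|i r IH].
  by have -> : (fun t => \prod_(i <- [::] | Q i) F i t) = (fun=> 1) by apply/funext => t; rewrite
    big_nil.
have -> : (fun t => \prod_(j <- i :: r | Q j) F j t) =
    (if Q i then fun t => F i t * \prod_(j <- r | Q j) F j t else fun t => \prod_(j <- r | Q j) F
      j t).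
  by apply/funext => t; rewrite big_cons; case: (Q i).
by case: (Q i) => //; exact: P_mul.
Qed.

Lemma P_det m (N : C -> 'M[C]_m) : (forall i j, P (fun t => N t i j)) -> P (fun t => \det (N t)).
Proof.
by move=> HN; apply: P_sum => s; apply: P_mul => //; apply: P_prod => i; exact: HN.
Qed.

(** Near t0, a N = U gives a = U adj N / det N. The adjugate is polynomial in the entries, so
    closure of [P] under ring operations, inversion and local equality suffices. *)
Lemma P_cramer m (N : C -> 'M[C]_m) (a U : C -> 'I_m -> C) :
  (forall i j, P (fun t => N t i j)) -> (forall j, P (fun t => U t j)) -> \det (N t0) != 0 ->
  (\forall t \near t0, forall j, \sum_i a t i * N t i j = U t j) ->
  forall j, P (fun t => a t j).
Proof.
move=> HN HU d0 E j.
have Pd := P_det HN.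
apply: (P_near (f := fun t => (\det (N t))^-1 * \sum_i U t i * (\adj (N t)) i j)).
  apply: filterS2 E (P_neq0 d0 Pd) => t Et dt.
  apply: (mulfI dt); rewrite mulVKf//.
  have -> : \sum_i U t i * (\adj (N t)) i j = (((\row_i a t i) *m N t) *m \adj (N t)) 0 j.
    rewrite [RHS]mxE; apply: eq_bigr => i _; rewrite -Et !mxE; congr (_ * _).
    by apply: eq_bigr => k _; rewrite !mxE.
  by rewrite -mulmxA mul_mx_adj mul_mx_scalar !mxE.
apply: P_mul; first exact: P_inv.
apply: P_sum => i; apply: P_mul => //.
have -> : (fun t => (\adj (N t)) i j) = (fun t => (-1) ^+ (j + i) * \det (row' j (col' i (N t)))).
  by apply/funext => t; rewrite mxE /cofactor.
apply: P_mul => //; apply: P_det => p q.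
by have -> : (fun t => row' j (col' i (N t)) p q) = (fun t => N t (lift j p) (lift i q))
  by apply/funext => t; rewrite !mxE.
Qed.
End Cramer.

Section CramerInstances.
Variable (R : realType).
Local Notation C := R[i].

Lemma derivable_continuous (V : normedModType C) (f : C -> V) (t : C) :
  derivable f t 1 -> f s @[s --> t] --> f t.
Proof. by move=> /derivable1_diffP/differentiable_continuous. Qed.

Lemma cvg_neq0 (f : C -> C) (t : C) : f t != 0 -> f s @[s --> t] --> f t ->
  \forall s \near t, f s != 0.
Proof.
move=> f0 /cvg_at_distP H.
have : 0 < `|f t| / 2 by rewrite divr_gt0// normr_gt0.
move/H; apply: filterS => s; apply: contraTneq => ->.
by rewrite subr0 lt_geF// ltr_pdivrMr// ltr_pMr ?normr_gt0// ltr1n.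
Qed.

Lemma is_derive_near_eq (V : normedModType C) (f g : C -> V) (t : C) (d : V) :
  (\forall s \near t, f s = g s) -> is_derive t 1 f d -> is_derive t 1 g d.
Proof.
move=> fg /is_derive_nearP H; apply/is_derive_nearP => e e0.
have ft := nbhs_singleton fg; move/near_shiftC in fg.
apply: filterS2 fg (H e e0) => h; rewrite [h *: 1]mulr1 => -> .
by rewrite ft.
Qed.

Lemma derivable_cramer m (t0 : C) (N : C -> 'M[C]_m) (a U : C -> 'I_m -> C) :
  (forall i j, derivable (fun t => N t i j) t0 1) -> (forall j, derivable (fun t => U t j) t0 1)
    ->
  \det (N t0) != 0 ->
  (\forall t \near t0, forall j, \sum_i a t i * N t i j = U t j) ->
  forall j, derivable (fun t => a t j) t0 1.
Proof.
apply: (@P_cramer _ t0 (fun f => derivable f t0 1)).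
- by move=> c; exact: derivable_cst.
- by move=> f g Hf Hg; have [] := is_deriveD (derivableP Hf) (derivableP Hg).
- by move=> f g Hf Hg; have [] := is_deriveM (derivableP Hf) (derivableP Hg).
- by move=> f f0 Hf; apply: derivableV.
- by move=> f g fg /derivableP Hf; have [] := is_derive_near_eq fg Hf.
- by move=> f f0 /derivable_continuous; exact: cvg_neq0.
Qed.

Lemma continuous_cramer m (t0 : C) (N : C -> 'M[C]_m) (a U : C -> 'I_m -> C) :
  (forall i j, N t i j @[t --> t0] --> N t0 i j) -> (forall j, U t j @[t --> t0] --> U t0 j) ->
  \det (N t0) != 0 ->
  (\forall t \near t0, forall j, \sum_i a t i * N t i j = U t j) ->
  forall j, a t j @[t --> t0] --> a t0 j.
Proof.
apply: (@P_cramer _ t0 (fun f => f t @[t --> t0] --> f t0)).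
- by move=> c; exact: cvg_at_cst.
- by move=> f g Hf Hg; exact: (cvg_atD Hf Hg).
- by move=> f g Hf Hg; exact: (cvg_atM Hf Hg).
- by move=> f f0 Hf; exact: (cvg_atV f0 Hf).
- move=> f g fg /cvg_at_distP Hf; apply/cvg_at_distP => e e0.
  have ft := nbhs_singleton fg; apply: filterS2 fg (Hf e e0) => t <-.
  by rewrite ft.
- by move=> f f0; exact: cvg_neq0.
Qed.
End CramerInstances.

(** * Gram matrices of independent families *)

Section Gram.
Variables (R : realType) (T : Type) (D : set T) (K : T -> T -> R[i]).
Variable M : rkhs D K.
Local Notation C := R[i].

Lemma ip_span_eq0 (I : finType) (f : M) (a : I -> C) (e : I -> M) :
  (forall i, ip f (e i) = 0) -> ip f (\sum_i a i *: e i) = 0.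
Proof. by move=> H; rewrite ip_sumr big1// => i _; rewrite ipZr H mulr0. Qed.

(** A combination annihilated by the Gram matrix is orthogonal to every e_j, hence to itself. *)
Lemma gram_unit m (e : 'I_m -> M) : lin_indep e ->
  (\matrix_(i, j) ip (e i) (e j)) \in unitmx.
Proof.
move=> He; rewrite -row_free_unit; apply: inj_row_free => a Ha.
apply/rowP => i; rewrite mxE; move: i; apply: He; apply: ip_eq0; apply: ip_span_eq0 => j.
have := congr1 (fun B : 'rV_m => B 0 j) Ha; rewrite !mxE => <-.
by rewrite ip_suml; apply: eq_bigr => i _; rewrite ipZl mxE.
Qed.

Lemma orth_projection m (e : 'I_m -> M) (f : M) : lin_indep e ->
  exists b : 'I_m -> C, forall j, ip (f - \sum_i b i *: e i) (e j) = 0.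
Proof.
move=> /gram_unit; set G := \matrix_(i, j) _ => Gu.
exists (fun i => ((\row_j ip f (e j)) *m invmx G) 0 i) => j.
have := mulmxKV Gu (\row_j ip f (e j)) => /(congr1 (fun B : 'rV_m => B 0 j)); rewrite !mxE => E.
rewrite ipBl ip_suml -[X in X - _]E; apply/eqP; rewrite subr_eq0; apply/eqP.
by apply: eq_bigr => i _; rewrite ipZl !mxE.
Qed.
End Gram.

(** * Orthogonal splittings of the jet bundle *)

Section OrthogonalSplitting.
Variables (R : realType) (T : Type) (D : set T) (K : T -> T -> R[i]).
Variable M : rkhs D K.
Local Notation C := R[i].

(* In the application [u i t] is the i-th jet of sigma_l at (t, t, t) and
   [d i t] its derivative with respect to z_1. *)
Variables (u d : nat -> C -> M) (k : nat) (Omega : set C).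
Hypothesis k0 : (0 < k)%N.
Hypothesis Omega_open : forall t, Omega t -> \forall s \near t, Omega s.
Hypothesis is_derive_u : forall i t, Omega t -> is_derive t 1 (u i) (u i.+1 t + d i t).
Hypothesis continuous_u : forall i t, Omega t -> u i s @[s --> t] --> u i t.
Hypothesis continuous_d : forall i t, Omega t -> d i s @[s --> t] --> d i t.
Hypothesis gram_d : forall t, Omega t -> exists A B : C, forall i j,
  ip (d i t) (u j t) = A * ip (u i t) (u j t) /\ ip (d i t) (d j t) = B * ip (u i t) (u j t).
Hypothesis indep_u : forall t, Omega t -> forall n, lin_indep (fun i : 'I_n => u i t).

Lemma ip_lin2 (x y : C) (f g h : M) : ip (x *: f + y *: g) h = x * ip f h + y * ip g h.
Proof. by rewrite ipDl !ipZl. Qed.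

(** In the application [q] and [c] are the matrices of the two complementary projections in the
    frame u_0, ..., u_(k-1), so that [comb q i] and [comb c i] are x_i and y_i. *)
Definition comb (q : 'I_k -> 'I_k -> C -> C) i t : M := \sum_j q i j t *: u j t.

Definition dcomb (q : 'I_k -> 'I_k -> C -> C) i t : M :=
  \sum_j ('D_1 (q i j) t *: u j t + q i j t *: (u j.+1 t + d j t)).

Lemma is_derive_comb q i t : Omega t -> (forall j, derivable (q i j) t 1) ->
  is_derive t 1 (comb q i) (dcomb q i t).
Proof.
move=> Ot Hq.
have -> : comb q i = \sum_j (fun t => q i j t *: u j t).
  by apply/funext => s; rewrite fct_sumE.
apply: is_derive_sum => j; apply: is_derive_scale; first exact: derivableP.
exact: is_derive_u.
Qed.

Definition orth_split (q c : 'I_k -> 'I_k -> C -> C) := [/\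
  forall i j t, Omega t -> derivable (q i j) t 1,
  forall i j t, Omega t -> derivable (c i j) t 1,
  forall i t, Omega t -> comb q i t + comb c i t = u i t &
  forall i j t, Omega t -> ip (comb q i t) (comb c j t) = 0].

Lemma orth_splitC q c : orth_split q c -> orth_split c q.
Proof.
by case=> H1 H2 H3 H4; split=> // [i t Ot|i j t Ot]; [rewrite addrC H3|exact/ip_eq0C/H4].
Qed.

Lemma comb_derive_eq0 q c : orth_split q c -> forall i j t, Omega t ->
  ip (dcomb q i t) (comb c j t) = 0 /\ ip (comb q i t) (dcomb c j t) = 0.
Proof.
case=> H1 H2 H3 H4 i j t Ot.
apply: (ip_derive_eq0 (is_derive_comb Ot (fun j => H1 i j t Ot)) (is_derive_comb Ot (fun i => H2
  j i t Ot))).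
have /near_shiftC := Omega_open Ot.
by apply: filterS => h Oh; exact: H4.
Qed.

Lemma dcomb_add q c : orth_split q c -> forall i t, Omega t ->
  dcomb q i t + dcomb c i t = u i.+1 t + d i t.
Proof.
case=> H1 H2 H3 H4 i t Ot.
have D1 := is_derive_comb Ot (fun j => H1 i j t Ot).
have D2 := is_derive_comb Ot (fun j => H2 i j t Ot).
have D3 := is_deriveD D1 D2.
have : is_derive t 1 (u i) (dcomb q i t + dcomb c i t).
  apply: is_derive_near_eq D3; apply: filterS (Omega_open Ot) => s Os; exact: H3.
by case=> _ <-; case: (is_derive_u i Ot) => _ <-.
Qed.

Lemma gram_det_neq0 t : Omega t -> \det (\matrix_(i < k, j < k) ip (u i t) (u j t)) != 0.
Proof.
by move=> Ot; rewrite -unitfE -unitmxE; exact: gram_unit (indep_u Ot (n := k)).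
Qed.

Lemma continuous_comb (q : 'I_k -> 'I_k -> C -> C) i t : Omega t -> (forall j, q i j s @[s --> t]
  --> q i j t) ->
  comb q i s @[s --> t] --> comb q i t.
Proof.
by move=> Ot Hq; apply: cvg_at_sum => j; apply: cvg_atZ; [exact: Hq|exact: continuous_u].
Qed.

(** By [comb_derive_eq0] the y-terms drop out of <x_i', u_m> = <x_i', x_m> = <u_(i+1) + d_i, x_m>.
    This is a linear system for the derivatives of the coefficients, with invertible Gram matrix and
    a right-hand side free of derivatives of [q]; its solution is continuous. *)
Lemma continuous_dcomb q c : orth_split q c -> forall i t, Omega t ->
  dcomb q i s @[s --> t] --> dcomb q i t.
Proof.
move=> S i t Ot; case: (S) => H1 H2 H3 H4.
have cq a b s : Omega s -> q a b r @[r --> s] --> q a b s by move=> Os;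
  exact/derivable_continuous/H1.
pose N s := \matrix_(a < k, b < k) ip (u a s) (u b s).
pose U s (m : 'I_k) := ip (u i.+1 s + d i s) (comb q m s) + \sum_j (- q i j s) * ip (u j.+1 s + d
  j s) (u m s).
have E s : Omega s -> forall m, \sum_j 'D_1 (q i j) s * N s j m = U s m.
  move=> Os m.
  have : ip (dcomb q i s) (u m s) = ip (u i.+1 s + d i s) (comb q m s).
    rewrite -(H3 m s Os) ipDr (comb_derive_eq0 S i m Os).1 addr0.
    have [_ /ip_eq0C e2] := comb_derive_eq0 S m i Os.
    by rewrite -(dcomb_add S i Os) ipDl e2 addr0.
  rewrite /U => <-; rewrite /dcomb ip_suml -big_split/=; apply: eq_bigr => j _.
  have -> := ip_lin2 ('D_1 (q i j) s) (q i j s) (u j s) (u j.+1 s + d j s) (u m s).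
  by rewrite mulNr addrK mxE.
have cD : forall j, 'D_1 (q i j) s @[s --> t] --> 'D_1 (q i j) t.
  apply: (@continuous_cramer R k t N (fun s j => 'D_1 (q i j) s) U).
  - move=> a b; rewrite mxE.
    have -> : (fun s => N s a b) = (fun s => ip (u a s) (u b s)) by apply/funext => s; rewrite
      mxE.
    by apply: cvg_ip; exact: continuous_u.
  - move=> m; apply: cvg_atD.
      apply: cvg_ip; first by apply: cvg_atD; [exact: continuous_u|exact: continuous_d].
      by apply: continuous_comb => // j; exact: cq.
    apply: cvg_at_sum => j; apply: cvg_atM; first by apply: cvg_atN; exact: cq.
    apply: cvg_ip; last exact: continuous_u.
    by apply: cvg_atD; [exact: continuous_u|exact: continuous_d].
  - exact: gram_det_neq0.
  - by apply: filterS (Omega_open Ot) => s Os m; exact: E.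
apply: cvg_at_sum => j; apply: cvg_atD; apply: cvg_atZ.
- exact: cD.
- exact: continuous_u.
- exact: cq.
- by apply: cvg_atD; [exact: continuous_u|exact: continuous_d].
Qed.

(* The second fundamental forms of the two summands are orthogonal. *)
Lemma dcomb_orth q c : orth_split q c -> forall i j t, Omega t ->
  ip (dcomb q i t) (dcomb c j t) = 0.
Proof.
move=> S i j t Ot; case: (S) => H1 H2 H3 H4.
set k1 := ip _ _.
apply: (@antiholomorphic_derivative_eq0 R (fun h => ip (comb q i (t + h)) (comb c j t))
   (fun h => ip (dcomb q i (t + h)) (comb c j t))).
  have /near_shiftC := Omega_open Ot; apply: filterS => h Oh.
  apply: is_derive_ipl; apply/is_derive_nearP => e e0.
  have /is_derive_nearP/(_ e e0) := is_derive_comb Oh (fun j => H1 i j _ Oh).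
  by apply: filterS => x; rewrite addrA.
move=> e e0.
have cX := @continuous_dcomb q c S i t Ot.
have DY := is_derive_comb Ot (fun i => H2 j i t Ot).
move/cvg_at_distP in cX; move/is_derive_nearP in DY.
pose n := `|dcomb c j t| + `|dcomb q i t| + 1.
have n0 : 0 < n by rewrite ltr_wpDl// addr_ge0.
have en : 0 < e / n by rewrite divr_gt0.
have O1 := Omega_open Ot; move/near_shiftC in O1.
have cX1 := cX 1 ltr01; move/near_shiftC in cX1.
have cX2 := cX _ en; move/near_shiftC in cX2.
have DY' := DY _ en.
near=> h.
have Oh : Omega (t + h) by near: h.
have X1 : `|dcomb q i t - dcomb q i (t + h)| <= 1 by near: h.
have X2 : `|dcomb q i t - dcomb q i (t + h)| <= e / n by near: h.
have Y1 : `|comb c j (t + h *: 1) - comb c j t - h *: dcomb c j t| <= e / n * `|h| by near: h.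
rewrite [_ *: 1]mulr1 in Y1.
(* Since <x_i'(t + h), y_j(t + h)> = 0, the vector y_j(t) may be replaced by minus the increment of
   y_j, which is h y_j'(t) + o(h). *)
have -> : ip (dcomb q i (t + h)) (comb c j t) + k1 * conjc h =
    conjc h * ip (dcomb q i t - dcomb q i (t + h)) (dcomb c j t)
    - ip (dcomb q i (t + h)) (comb c j (t + h) - comb c j t - h *: dcomb c j t).
  rewrite ipBl !ipBr (comb_derive_eq0 S i j Oh).1 ipZr /k1; ring.
apply: le_trans (ler_normB _ _) _.
apply: (@le_trans _ _ (`|h| * (e / n * `|dcomb c j t|) + (`|dcomb q i t| + 1) * (e / n * `|h|)));
  last first.
  suff -> : `|h| * (e / n * `|dcomb c j t|) + (`|dcomb q i t| + 1) * (e / n * `|h|) = e / n * n *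
    `|h|.
    by rewrite divfK ?gt_eqF.
  by rewrite /n; move: (e / _) => w; ring.
apply: lerD.
  rewrite normrM normcJ ler_wpM2l//; apply: le_trans (cauchy_schwarz _ _) _.
  by rewrite ler_wpM2r.
apply: le_trans (cauchy_schwarz _ _) _; apply: ler_pM => //.
rewrite -[dcomb q i (t + h)](subrK (dcomb q i t)) addrC; apply: le_trans (ler_normD _ _) _.
by rewrite lerD2l distrC.
Unshelve. all: by end_near. Qed.

Definition in_span t (f : M) := exists a : 'I_k -> C, f = \sum_i a i *: u i t.

Lemma in_spanD t f g : in_span t f -> in_span t g -> in_span t (f + g).
Proof.
move=> [a ->] [b ->]; exists (fun i => a i + b i).
by rewrite -big_split/=; apply: eq_bigr => i _; rewrite scalerDl.
Qed.

Lemma in_spanZ t x f : in_span t f -> in_span t (x *: f).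
Proof.
move=> [a ->]; exists (fun i => x * a i).
by rewrite scaler_sumr; apply: eq_bigr => i _; rewrite scalerA.
Qed.

Lemma in_span_sum t (I : finType) (P : pred I) (F : I -> M) :
  (forall i, P i -> in_span t (F i)) -> in_span t (\sum_(i | P i) F i).
Proof.
move=> H; apply: big_ind => //; last exact: in_spanD.
by exists (fun=> 0); rewrite big1// => i _; rewrite scale0r.
Qed.

Lemma in_span_u t i : (i < k)%N -> in_span t (u i t).
Proof.
move=> ik; exists (fun j => (j == Ordinal ik)%:R).
rewrite (bigD1 (Ordinal ik))//= eqxx scale1r big1 ?addr0// => j /negbTE ->.
by rewrite scale0r.
Qed.

Lemma in_span_orth q c : orth_split q c -> forall t f, Omega t -> in_span t f ->
  (forall j, ip f (comb c j t) = 0) -> exists a : 'I_k -> C, f = \sum_i a i *: comb q i t.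
Proof.
case=> H1 H2 H3 H4 t f Ot [a fE] Hf; exists a.
pose X := \sum_i a i *: comb q i t; pose Y := \sum_i a i *: comb c i t.
have fXY : f = X + Y.
  by rewrite fE /X /Y -big_split/=; apply: eq_bigr => i _; rewrite -scalerDr H3.
have fY : ip f Y = 0 by exact: ip_span_eq0.
have XY : ip X Y = 0.
  apply: ip_span_eq0 => i; rewrite ip_suml big1// => j _.
  by rewrite ipZl H4// mulr0.
suff Y0 : Y = 0 by rewrite fXY Y0 addr0.
by apply: ip_eq0; move: fY; rewrite fXY ipDl XY add0r.
Qed.

Lemma residual_neq0 n t (b : 'I_n -> C) : Omega t ->
  u n t - \sum_i b i *: u i t != 0.
Proof.
move=> Ot; apply/eqP => v0.
have := indep_u Ot (n := n.+1) (c := fun i : 'I_n.+1 => if unlift ord_max i is Some l then - b l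
  else 1).
have -> : \sum_(i < n.+1) (if unlift ord_max i is Some l then - b l else 1) *: u i t = 0.
  rewrite big_ord_recr/= unlift_none scale1r -[RHS]v0 addrC; congr (_ + _).
  rewrite -sumrN; apply: eq_bigr => l _.
  have -> : widen_ord (leqnSn n) l = lift ord_max l by apply/val_inj; rewrite /= /bump leqNgt
    ltn_ord.
  by rewrite liftK scaleNr.
by move=> /(_ erefl ord_max); rewrite unlift_none => /eqP; rewrite oner_eq0.
Qed.

Lemma split_last_coef q c : orth_split q c -> forall t, Omega t ->
  forall (last : 'I_k), last.+1 = k -> forall i m, q i last t = 0 \/ c m last t = 0.
Proof.
move=> S t Ot last lk i m; case: (S) => H1 H2 H3 H4.
have [A [B HAB]] := gram_d Ot.
have [b Hb] := orth_projection (u k t) (indep_u Ot (n := k)).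
set v := u k t - _ in Hb.
have vn0 : ip v v != 0.
  by apply: contraNneq (residual_neq0 b Ot) => /ip_eq0; rewrite -/v => ->.
(* By [gram_d] this correction makes d_j orthogonal to every u_i, and the Gram matrix of the [du j]
   is a scalar multiple of that of the u_j. *)
pose du j := d j t - A *: u j t.
have du_u i' j : ip (du i') (u j t) = 0 by rewrite ipBl ipZl (HAB i' j).1 subrr.
have du_v i' : ip (du i') v = 0.
  by rewrite /v ipBr du_u sub0r ip_span_eq0 ?oppr0.
have du_du i' j : ip (du i') (du j) = (B - A * conjc A) * ip (u i' t) (u j t).
  rewrite {2}/du ipBr ipZr du_u mulr0 subr0 /du ipBl ipZl (HAB i' j).2.
  rewrite (ip_conj (d j t)) (HAB j i').1 conjcM -ip_conj; ring.
(* The three parts are mutually orthogonal. Only the index [last] leaves the span of the frame,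
   through u_k, whose residual is v. *)
have dec r (i' : 'I_k) : exists2 f, in_span t f &
   dcomb r i' t = f + \sum_j r i' j t *: du j + r i' last t *: v.
  exists (\sum_j ('D_1 (r i' j) t *: u j t + r i' j t *: (A *: u j t)) +
     (\sum_(j | j != last) r i' j t *: u j.+1 t + r i' last t *: \sum_i b i *: u i t)).
    apply: in_spanD.
      apply: in_span_sum => j _; apply: in_spanD; do ?apply: in_spanZ; exact: in_span_u.
    apply: in_spanD.
      apply: in_span_sum => j jl; apply: in_spanZ; apply: in_span_u.
      rewrite ltn_neqAle ltn_ord andbT; apply: contraNneq jl => jl.
      by apply/eqP/val_inj; apply: succn_inj; exact: etrans jl (esym lk).
    by apply: in_spanZ; exists b.
  have E : \sum_j r i' j t *: u j.+1 t =
      \sum_(j | j != last) r i' j t *: u j.+1 t + r i' last t *: \sum_i b i *: u i t + r i' last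
        t *: v.
    rewrite (bigD1 last)//= addrC -addrA -scalerDr lk; congr (_ + _ *: _).
    by rewrite /v addrC subrK.
  transitivity (\sum_j ('D_1 (r i' j) t *: u j t + r i' j t *: (A *: u j t)) +
      \sum_j r i' j t *: u j.+1 t + \sum_j r i' j t *: du j).
    rewrite /dcomb -!big_split/=; apply: eq_bigr => j _.
    rewrite /du scalerBr scalerDr.
    move: ('D_1 (r i' j) t *: u j t) (r i' j t *: (A *: u j t)) (r i' j t *: u j.+1 t) (r i' j t
      *: d j t) => X1 X2 X3 X4.
    by rewrite [in RHS](addrC X4) [in RHS]addrA [in RHS](addrAC (X1 + X2)) addrK addrA.
  by rewrite E -!addrA; do 3! congr (_ + _); exact: addrC.
have [f Ff Ef] := dec q i; have [g Fg Eg] := dec c m.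
have Zs (r : 'I_k -> 'I_k -> C -> C) i' h : in_span t h -> ip (\sum_j r i' j t *: du j) h = 0.
  move=> [a ->]; apply: ip_span_eq0 => l; rewrite ip_suml big1// => j _.
  by rewrite ipZl du_u mulr0.
have vs h : in_span t h -> ip v h = 0.
  by move=> [a ->]; apply: ip_span_eq0 => l; exact: Hb.
have cs r i' : in_span t (comb r i' t) by exists (r i' ^~ t).
(* The frame part f of x_i' is orthogonal to every y_j, hence a combination of the x_j; the frame
   part g of y_m' is orthogonal to those, so f and g pair to 0. *)
have fx j : ip f (comb c j t) = 0.
  have [+ _] := comb_derive_eq0 S i j Ot.
  by rewrite Ef !ipDl ipZl Zs// vs// mulr0 !addr0.
have gx j : ip (comb q j t) g = 0.
  have [_ /ip_eq0C] := comb_derive_eq0 S j m Ot.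
  by rewrite Eg !ipDl ipZl Zs// vs// mulr0 !addr0 => /ip_eq0C.
have [a fa] := in_span_orth S Ot Ff fx.
have fg : ip f g = 0.
  by rewrite fa ip_suml big1// => j _; rewrite ipZl gx mulr0.
have ZZ : ip (\sum_j q i j t *: du j) (\sum_j c m j t *: du j) = 0.
  have -> : ip (\sum_j q i j t *: du j) (\sum_j c m j t *: du j) = (B - A * conjc A) * ip (comb q
    i t) (comb c m t).
    rewrite /comb !ip_suml mulr_sumr; apply: eq_bigr => j _.
    rewrite !ip_sumr mulr_sumr; apply: eq_bigr => l _.
    by rewrite !ipZl !ipZr du_du; ring.
  by rewrite H4// mulr0.
have Zv (r : 'I_k -> 'I_k -> C -> C) i' : ip (\sum_j r i' j t *: du j) v = 0.
  by rewrite ip_suml big1// => j _; rewrite ipZl du_v mulr0.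
have := dcomb_orth S i m Ot; rewrite Ef Eg !(ipDl, ipDr) !ipZl !ipZr.
rewrite fg ZZ !Zv (ip_eq0C (Zs _ _ _ Ff)) (ip_eq0C (vs _ Ff)) Zs// vs// (ip_eq0C (Zv _ _)).
rewrite !mulr0 !addr0 !add0r => /eqP; rewrite !mulf_eq0 (negbTE vn0) orbF conjc_eq0.
by case/orP => /eqP; [left|right].
Qed.

(** Let v be the residual of u_j against u_0, ..., u_(j-1). The y_i involve only these vectors, so v
    is orthogonal to them, is a combination of the x_i, and <y_i', v> = 0. In this pairing only the
    derivative of u_(j-1) contributes, and gives its coefficient times <u_j, v>. V is open so that
    coefficients vanishing on it have vanishing derivatives. *)
Lemma split_chain q c (j : nat) : orth_split q c -> (0 < j)%N -> (j < k)%N ->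
  forall V : set C, (forall t, V t -> \forall s \near t, V s) -> V `<=` Omega ->
  (forall t, V t -> forall i (m : 'I_k), (j <= m)%N -> c i m t = 0) ->
  forall t, V t -> forall i (m : 'I_k), (j <= m.+1)%N -> c i m t = 0.
Proof.
move=> S j0 jk V Vo VO Hc t Vt i m; rewrite leq_eqVlt => /orP[/eqP jm|]; last exact: Hc.
case: (S) => H1 H2 H3 H4; have Ot := VO _ Vt.
have [A [B HAB]] := gram_d Ot.
have [b Hb] := orth_projection (u j t) (indep_u Ot (n := j)).
set v := u j t - _ in Hb.
have dv p : ip (d p t) v = A * ip (u p t) v.
  rewrite /v !ipBr mulrBr (HAB p j).1; congr (_ - _).
  rewrite !ip_sumr mulr_sumr; apply: eq_bigr => l _; rewrite !ipZr (HAB p l).1; ring.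
have uv (p : nat) : (p < j)%N -> ip (u p t) v = 0.
  by move=> pj; apply: ip_eq0C; exact: (Hb (Ordinal pj)).
have vn0 : ip (u j t) v != 0.
  have -> : ip (u j t) v = ip v v.
    rewrite {2}/v ipBl ip_suml big1 ?subr0// => l _.
    by rewrite ipZl uv ?mulr0.
  by apply: contraNneq (residual_neq0 b Ot) => /ip_eq0; rewrite -/v => ->.
have [a va] : exists a : 'I_k -> C, v = \sum_i a i *: comb q i t.
  apply: (in_span_orth S Ot).
    rewrite /v -scaleN1r; apply: in_spanD; first exact: in_span_u.
    apply: in_spanZ; apply: in_span_sum => l _; apply: in_spanZ; apply: in_span_u.
    exact: ltn_trans (ltn_ord l) jk.
  move=> i'; rewrite ip_sumr big1// => p _; rewrite ipZr.
  have [pj|jp] := ltnP p j; first by rewrite (Hb (Ordinal pj)) mulr0.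
  by rewrite (Hc t Vt)// conjc0 mul0r.
have : ip (dcomb c i t) v = 0.
  rewrite va; apply: ip_span_eq0 => l.
  exact: (comb_derive_eq0 (orth_splitC S) i l Ot).1.
have mj : (m < j)%N by rewrite jm.
rewrite /dcomb ip_suml (bigD1 m)//= ip_lin2 ipDl dv (uv m mj) -jm mulr0 mulr0 addr0 add0r.
rewrite big1 ?addr0; last first.
  move=> p pm; rewrite ip_lin2 ipDl dv.
  have [pj|jp] := ltnP p j.
    have p1j : (p.+1 < j)%N.
      rewrite ltn_neqAle pj andbT jm eqSS.
      by apply: contraNneq pm => pm; apply/eqP/val_inj.
    by rewrite (uv p pj) (uv p.+1 p1j) !mulr0 !addr0 ?mulr0 ?addr0.
  rewrite (Hc t Vt)// mul0r addr0.
  have -> : 'D_1 (c i p) t = 0.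
    have H0 : \forall s \near t, cst 0 s = c i p s.
      by apply: filterS (Vo t Vt) => s Vs; rewrite (Hc s Vs).
    by case: (is_derive_near_eq H0 (is_derive_cst (0 : C) t 1)).
  by rewrite mul0r.
by move/eqP; rewrite mulf_eq0 (negbTE vn0) orbF => /eqP.
Qed.

Lemma split_vanish q c (last : 'I_k) : orth_split q c -> last.+1 = k ->
  forall V : set C, (forall t, V t -> \forall s \near t, V s) -> V `<=` Omega ->
  (forall t, V t -> forall i, c i last t = 0) ->
  forall t, V t -> forall i, comb c i t = 0.
Proof.
move=> S lk V Vo VO Hc t Vt i.
have H e : (e < k)%N -> forall t, V t -> forall i (m : 'I_k), (k - e.+1 <= m)%N -> c i m t = 0.
  elim: e => [_ s Vs i' m|e IH ek].
    move=> lm; have lm' : (last.+1 <= m.+1)%N by rewrite lk -add1n -leq_subLR.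
    have -> : m = last; last exact: Hc.
    by apply/val_inj/eqP; rewrite /= eqn_leq -ltnS lk ltn_ord.
  have j0 : (0 < k - e.+1)%N by rewrite subn_gt0.
  have jk : (k - e.+1 < k)%N by rewrite ltn_subrL k0.
  have := split_chain S j0 jk Vo VO (IH (ltnW ek)) => Hch s Vs i' m mk.
  by apply: Hch => //; rewrite -subnSK// ltnS.
rewrite /comb big1// => j _; have kk : (k.-1 < k)%N by rewrite ltn_predL.
by rewrite (H _ kk t Vt) ?scale0r// prednK// subnn.
Qed.

(** The u_(k-1)-coefficients of x_(k-1) and y_(k-1) add up to 1, so one of them is nonzero at t0 and
    on a neighbourhood; there [split_last_coef] makes the last column of the other matrix vanish. *)
Lemma orth_split_trivial q c t0 : orth_split q c -> Omega t0 ->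
  (forall i, comb q i t0 = 0) \/ (forall i, comb c i t0 = 0).
Proof.
move=> S Ot0; case: (S) => H1 H2 H3 H4.
have lk : (k.-1 < k)%N by rewrite ltn_predL.
pose last := Ordinal lk; have lastk : last.+1 = k by rewrite /= prednK.
have main q' c' m : orth_split q' c' -> q' m last t0 != 0 -> forall i, comb c' i t0 = 0.
  move=> S' qn0; case: (S') => H1' _ _ _.
  pose V : set C := [set t | Omega t /\ q' m last t != 0].
  apply: (split_vanish S' lastk (V := V)) => //.
  - move=> t [Ot qt]; have cq := derivable_continuous (H1' m last t Ot).
    by apply: filterS2 (Omega_open Ot) (cvg_neq0 qt cq) => s Os qs; split.
  - by move=> t [].
  - move=> t [Ot qt] i; case: (split_last_coef S' Ot lastk m i) => // q0.
    by rewrite q0 eqxx in qt.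
have [q0|q0] := eqVneq (q last last t0) 0; last by right; exact: main S q0.
left; apply: (main c q last (orth_splitC S)); apply/eqP => c0.
have := H3 last t0 Ot0; rewrite /comb -big_split/= => E.
have := indep_u Ot0 (n := k) (c := fun j => q last j t0 + c last j t0 - (j == last)%:R).
have -> : \sum_(j < k) (q last j t0 + c last j t0 - (j == last)%:R) *: u j t0 = 0.
  transitivity (\sum_(j < k) (q last j t0 *: u j t0 + c last j t0 *: u j t0) - u last t0).
    under eq_bigr do rewrite scalerBl scalerDl.
    rewrite big_split/= sumrN; congr (_ - _).
    rewrite (bigD1 last)//= eqxx scale1r big1 ?addr0// => j /negbTE ->.
    by rewrite scale0r.
  by rewrite E subrr.
move=> /(_ erefl last); rewrite q0 c0 eqxx addr0 sub0r => /eqP.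
by rewrite oppr_eq0 oner_eq0.
Qed.
End OrthogonalSplitting.

(** The coefficients are recovered by pairing with the frame frozen at t0: <e_i(t), e_j(t0)> is
    holomorphic in t, unlike <e_i(t), e_j(t)>, and at t0 it is the invertible Gram matrix. *)
Lemma coef_derivable (R : realType) (T : Type) (D : set T) (K : T -> T -> R[i])
    (M : rkhs D K) m (e : 'I_m -> R[i] -> M) (z : R[i] -> M) (a : R[i] -> 'I_m -> R[i])
    (t0 : R[i]) :
  (forall i, derivable (e i) t0 1) -> lin_indep (fun i => e i t0) -> derivable z t0 1 ->
  (\forall t \near t0, z t = \sum_i a t i *: e i t) ->
  forall j, derivable (fun t => a t j) t0 1.
Proof.
move=> He Hi Hz Ha.
apply: (@derivable_cramer R m t0 (fun t => \matrix_(i, j) ip (e i t) (e j t0)) a (fun t j => ip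
  (z t) (e j t0))).
- move=> i j; have -> : (fun t => (\matrix_(i, j) ip (e i t) (e j t0)) i j) = (fun t => ip (e i
    t) (e j t0)).
    by apply/funext => t; rewrite mxE.
  by have [] := is_derive_ipl (e j t0) (derivableP (He i)).
- by move=> j; have [] := is_derive_ipl (e j t0) (derivableP Hz).
- by rewrite -unitfE -unitmxE; exact: gram_unit.
- apply: filterS Ha => t -> j; rewrite ip_suml; apply: eq_bigr => i _.
  by rewrite ipZl mxE.
Qed.

(** * The bundles over the diagonal *)

Section Main.
Variables (R : realType) (alpha beta gamma : R).
Hypotheses (alpha_gt0 : 0 < alpha) (beta_gt0 : 0 < beta) (gamma_gt0 : 0 < gamma).
Variable M : rkhs (@D3 R) (K3 alpha beta gamma).
Local Notation C := R[i].
Local Notation pt := 'rV[C]_3.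
Implicit Types (z w u v h : pt) (x y t : C).
Local Notation jete := (jete M).
Local Notation ujet := (ujet M).
Local Notation ujet1 := (ujet1 M).

Let Djete := is_derive_jete alpha_gt0 beta_gt0 gamma_gt0 M.
Let Dujet := is_derive_ujet alpha_gt0 beta_gt0 gamma_gt0 M.

Lemma lin_span0 (I : finType) (e : I -> M) : lin_span e 0.
Proof. by exists (fun=> 0); rewrite big1// => i _; rewrite scale0r. Qed.

Lemma lin_spanD (I : finType) (e : I -> M) f g : lin_span e f -> lin_span e g -> lin_span e (f +
  g).
Proof.
move=> [a ->] [b ->]; exists (fun i => a i + b i).
by rewrite -big_split/=; apply: eq_bigr => i _; rewrite scalerDl.
Qed.

Lemma lin_spanZ (I : finType) (e : I -> M) x f : lin_span e f -> lin_span e (x *: f).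
Proof.
move=> [a ->]; exists (fun i => x * a i).
by rewrite scaler_sumr; apply: eq_bigr => i _; rewrite scalerA.
Qed.

Lemma lin_span_mem (I : finType) (e : I -> M) i : lin_span e (e i).
Proof.
exists (fun j => (j == i)%:R); rewrite (bigD1 i)//= eqxx scale1r big1 ?addr0// => j /negbTE ->.
by rewrite scale0r.
Qed.

Lemma sum_closed (P : set M) (I : Type) (r : seq I) (Q : pred I) (F : I -> M) :
  P 0 -> (forall f g, P f -> P g -> P (f + g)) -> (forall i, Q i -> P (F i)) ->
  P (\sum_(i <- r | Q i) F i).
Proof. by move=> P0 PD PF; apply: big_ind. Qed.

Lemma DeltaD3 w : Delta w -> D3 w. Proof. by case. Qed.
Lemma Delta23 w : Delta w -> w 0 i2 = w 0 i3. Proof. by case=> _ []. Qed.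

Definition pochc b c : C := (pochhammer beta b * pochhammer gamma c)%:C.

Lemma pochc_neq0 b c : pochc b c != 0.
Proof. by rewrite gt_eqF// ltcR mulr_gt0// poch_gt0. Qed.

Lemma jetE_frameE n (p : jet_index n) w : D3 w ->
  jetE_frame M n p w = pochc (val p).1 (val p).2 *: jete 0 (val p).1 (val p).2 w.
Proof. exact: iter_pd. Qed.

Lemma hol_frame_jetE n : hol_frame setT (jetE M n) (jetE_frame M n).
Proof.
move=> v /DeltaD3 Hv _; split => //.
  move=> p; rewrite /hol_on_Delta_at.
  have Hd := is_deriveZ (pochc (val p).1 (val p).2) (Djete 0 (val p).1 (val p).2 (const_mx 1) Hv).
  apply: (@ex_derive _ _ _ _ _ _ _ (is_derive_D3 Hv _ Hd)).
  by move=> u Hu; rewrite jetE_frameE.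
move=> c E p.
have inj : injective (fun p : jet_index n => ((val p).1 : nat, (val p).2 : nat)).
  move=> [[p1 p2] Hp] [[q1 q2] Hq] /= [/val_inj e1 /val_inj e2].
  by apply/val_inj; rewrite /= e1 e2.
have := @jete_indep R alpha beta gamma alpha_gt0 beta_gt0 gamma_gt0 M _ _ _ v
  (fun p => c p * pochc (val p).1 (val p).2) Hv inj _ p.
have -> : \sum_i (c i * pochc (val i).1 (val i).2) *: jete 0 (val i).1 (val i).2 v = 0.
  by rewrite -[RHS]E; apply: eq_bigr => i _; rewrite jetE_frameE// scalerA.
move=> /(_ erefl)/eqP; rewrite mulf_eq0 (negbTE (pochc_neq0 _ _)) orbF => /eqP; exact.
Qed.

Lemma jetEl_frameE' l k (i : 'I_k) w : D3 w -> jetEl_frame beta gamma M l k i w = ujet l i w.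
Proof. exact: jetEl_frameE. Qed.

Lemma hol_frame_jetEl l k : hol_frame setT (jetEl beta gamma M l k) (jetEl_frame beta gamma M l
  k).
Proof.
move=> v /DeltaD3 Hv _; split => //.
  move=> i; rewrite /hol_on_Delta_at.
  have h23 : (const_mx 1 : pt) 0 i2 = (const_mx 1 : pt) 0 i3 by rewrite !mxE.
  apply: (@ex_derive _ _ _ _ _ _ _ (is_derive_D3 Hv _ (Dujet l i Hv h23))).
  by move=> u Hu; rewrite jetEl_frameE'.
move=> c E; apply: (ujet_indep alpha_gt0 beta_gt0 gamma_gt0 (M := M) (l := l) (w := v)) => //.
by rewrite -[RHS]E; apply: eq_bigr => i _; rewrite jetEl_frameE'.
Qed.

Lemma jetEl_orth l m k k' w f g : l != m -> Delta w ->
  jetEl beta gamma M l k w f -> jetEl beta gamma M m k' w g -> ip f g = 0.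
Proof.
move=> lm /[dup] /DeltaD3 Hw /Delta23 w23 [a ->] [b ->].
apply: ip_span_eq0 => j; rewrite ip_suml big1// => i _.
rewrite ipZl !jetEl_frameE'//; have [lt|gt|eq] := ltngtP l m.
- by rewrite (ujet_orth alpha_gt0 beta_gt0 gamma_gt0)// mulr0.
- have /ip_eq0C -> : ip (ujet m j w) (ujet l i w) = 0 by apply: ujet_orth.
  by rewrite mulr0.
- by rewrite eq eqxx in lm.
Qed.

Lemma ujet_neq0 l i w : D3 w -> ujet l i w != 0.
Proof.
move=> Hw; apply/eqP => u0.
have := @ujet_indep R alpha beta gamma alpha_gt0 beta_gt0 gamma_gt0 M l i.+1 w (fun j => (j ==
  ord_max)%:R) Hw.
rewrite (bigD1 ord_max)//= eqxx scale1r u0 big1 ?addr0; last first.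
  by move=> j /negbTE ->; rewrite scale0r.
by move=> /(_ erefl ord_max)/eqP; rewrite eqxx oner_eq0.
Qed.

(** The dimension count in degree d: the d + 1 vectors [ujet l (d - l) w] are nonzero and mutually
    orthogonal, so the square matrix [B] expressing them through the d + 1 jets of that degree is
    invertible. *)
Lemma jete_in_ujets d b w : Delta w -> (b <= d)%N ->
  lin_span (fun l : 'I_d.+1 => ujet l (d - l) w) (jete 0 b (d - b) w).
Proof.
move=> /[dup] /DeltaD3 Hw /Delta23 w23 bd.
pose B : 'M[C]_d.+1 := \matrix_(l, b) ucoef beta gamma l (d - l) b.
have uE (l : 'I_d.+1) : ujet l (d - l) w = \sum_b B l b *: jete 0 b (d - b) w.
  rewrite /ujet /hom; have -> : (l + (d - l) = d)%N by rewrite subnKC// -ltnS.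
  by apply: eq_bigr => b' _; rewrite mxE.
have Bu : B \in unitmx.
  rewrite -row_free_unit; apply: inj_row_free => a Ha.
  have E : \sum_l a 0 l *: ujet l (d - l) w = 0.
    under eq_bigr do rewrite uE scaler_sumr.
    rewrite exchange_big/= big1// => b' _.
    under eq_bigr do rewrite scalerA.
    rewrite -scaler_suml; have := congr1 (fun X : 'rV_d.+1 => X 0 b') Ha.
    by rewrite !mxE => ->; rewrite scale0r.
  apply/rowP => m; rewrite mxE.
  have := congr1 (fun f => ip f (ujet m (d - m) w)) E.
  rewrite ip0l ip_suml (bigD1 m)//= big1 ?addr0.
    rewrite ipZl => /eqP; rewrite mulf_eq0 => /orP[/eqP//|/eqP/ip_eq0 u0].
    by have := ujet_neq0 m (d - m) Hw; rewrite u0 eqxx.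
  move=> l lm; rewrite ipZl; have [lt|gt|eq] := ltngtP l m.
  - by rewrite (ujet_orth alpha_gt0 beta_gt0 gamma_gt0)// mulr0.
  - have /ip_eq0C -> : ip (ujet m (d - m) w) (ujet l (d - l) w) = 0 by apply: ujet_orth.
    by rewrite mulr0.
  - by move/val_inj: eq lm => ->; rewrite eqxx.
have bd1 : (b < d.+1)%N by [].
exists (fun l => invmx B (Ordinal bd1) l).
under eq_bigr do rewrite uE scaler_sumr.
rewrite exchange_big/=.
under eq_bigr do (under eq_bigr do rewrite scalerA; rewrite -scaler_suml).
have I b' : \sum_i invmx B (Ordinal bd1) i * B i b' = (Ordinal bd1 == b')%:R.
  by have := congr1 (fun X : 'M[C]_(d.+1) => X (Ordinal bd1) b') (mulVmx Bu); rewrite !mxE.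
under eq_bigr do rewrite I.
rewrite (bigD1 (Ordinal bd1))//= eqxx scale1r big1 ?addr0// => b' /negbTE.
by rewrite eq_sym => ->; rewrite scale0r.
Qed.

Lemma jetE_orth_direct_sum n : (0 < n)%N ->
  orth_direct_sum M (jetE M n) (fun l : 'I_n => jetEl beta gamma M l (n - l)).
Proof.
move=> n0 w Dw; have Hw := DeltaD3 Dw; split.
  by move=> i j ij f g; apply: jetEl_orth.
have jm b c : (b + c < n)%N -> jetE M n w (jete 0 b c w).
  move=> bcn; have bn : (b < n)%N by rewrite (leq_ltn_trans _ bcn)// leq_addr.
  have cn : (c < n)%N by rewrite (leq_ltn_trans _ bcn)// leq_addl.
  have Hp : (Ordinal bn + Ordinal cn <= n.-1)%N by rewrite /= -ltnS prednK.
  pose p : jet_index n := exist _ (Ordinal bn, Ordinal cn) Hp.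
  have -> : jete 0 b c w = (pochc b c)^-1 *: jetE_frame M n p w.
    by rewrite jetE_frameE// scalerA mulVf ?pochc_neq0// scale1r.
  by apply: lin_spanZ; exact: (lin_span_mem (fun p => jetE_frame M n p w)).
apply/seteqP; split => f.
  move=> [c ->].
  pose S : set M := [set f0 : M | exists g : 'I_n -> M,
     (forall i : 'I_n, jetEl beta gamma M i (n - i) w (g i)) /\ f0 = \sum_i g i].
  have S0 : S 0 by exists (fun=> 0); split; [move=> i; exact: lin_span0|rewrite big1].
  have SD f1 f2 : S f1 -> S f2 -> S (f1 + f2).
    move=> [g1 [H1 ->]] [g2 [H2 ->]]; exists (fun i => g1 i + g2 i).
    split; first by move=> i; apply: lin_spanD; [exact: H1|exact: H2].
    by rewrite big_split.
  have SZ x f1 : S f1 -> S (x *: f1).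
    move=> [g1 [H1 ->]]; exists (fun i => x *: g1 i).
    split; first by move=> i; apply: lin_spanZ; exact: H1.
    by rewrite scaler_sumr.
  have Su l i : (l + i < n)%N -> S (ujet l i w).
    move=> lin; have ln : (l < n)%N by rewrite (leq_ltn_trans _ lin)// leq_addr.
    have inl : (i < n - l)%N by rewrite ltn_subRL.
    exists (fun l' => if l' == Ordinal ln then ujet l i w else 0); split.
      move=> l'; case: eqP => [->|_]; last exact: lin_span0.
      rewrite -(jetEl_frameE' l (Ordinal inl) Hw).
      exact: (lin_span_mem (fun i => jetEl_frame beta gamma M l (n - l) i w)).
    by rewrite -big_mkcond/= big_pred1_eq.
  apply: (@sum_closed S) => // p _; apply: (SZ); rewrite jetE_frameE//; apply: (SZ).
  have Hp : ((val p).1 + (val p).2 < n)%N.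
    by apply: leq_ltn_trans (valP p) _; rewrite prednK.
  have := jete_in_ujets Dw (leq_addr (val p).2 (val p).1); rewrite addKn => -[a ->].
  apply: (@sum_closed S) => // l _; apply: (SZ); apply: Su.
  by rewrite subnKC// -ltnS.
move=> [g [Hg ->]]; apply: (@sum_closed (jetE M n w)).
- exact: lin_span0.
- exact: lin_spanD.
move=> l _; have [a ->] := Hg l; apply: (@sum_closed (jetE M n w)).
- exact: lin_span0.
- exact: lin_spanD.
move=> i _; apply: lin_spanZ; rewrite jetEl_frameE' ?/ujet/hom//.
have lin : (l + i < n)%N by have := ltn_ord i; rewrite ltn_subRL.
apply: (@sum_closed (jetE M n w)).
- exact: lin_span0.
- exact: lin_spanD.
move=> b _; apply: lin_spanZ; apply: jm; rewrite subnKC// -ltnS; exact: ltn_ord.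
Qed.

(** * Irreducibility, over the disc parametrising Delta *)

Definition diag t : pt := const_mx t.

Lemma diagD t x : diag (t + x) = diag t + x *: const_mx 1.
Proof. by apply/rowP => i; rewrite !mxE mulr1. Qed.

Lemma Delta_diag t : `|t| < 1 -> Delta (diag t).
Proof. by move=> t1; split; [move=> i; rewrite mxE|rewrite !mxE]. Qed.

Lemma is_derive_diag (W : normedModType C) (f : pt -> W) t d :
  is_derive (diag t) (const_mx 1) f d -> is_derive t 1 (f \o diag) d.
Proof.
move=> /is_derive_nearP H; apply/is_derive_nearP => e /H; apply: filterS => x.
by rewrite [x *: 1]mulr1 /= diagD.
Qed.

Lemma near_diag (U : set pt) t : nbhs (diag t) U -> \forall s \near t, U (diag s).
Proof.
move=> HU; have H : diag t + x *: (const_mx 1 : pt) @[x --> (0 : C)] --> diag t.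
  apply/cvg_at_distP => e e0.
  have n0 : 0 < `|const_mx 1 : pt| + 1 by rewrite ltr_wpDl.
  apply: filterS (nbhs0_le (divr_gt0 e0 n0)) => x xe.
  rewrite opprD addNKr normrN normrZ; apply: le_trans (ler_wpM2r _ xe) _ => //.
  by rewrite mulrAC ler_pdivrMr// ler_wpM2l ?lerDl// ltW.
have H1 : \forall x \near (0 : C), U (diag t + x *: const_mx 1) by exact: H.
by apply/near_shiftC; apply: filterS H1 => x; rewrite diagD.
Qed.

(** The contradiction is reached in the fibre over the origin, so only the local frames of the two
    summands near that point matter. *)
Lemma jetEl_irreducible l k : (0 < k)%N -> irreducible_bundle M (jetEl beta gamma M l k).
Proof.
move=> k0 [r [G [HG Hsum]]].
have z1 : `|0 : C| < 1 by rewrite normr0 ltr01.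
have [r1 /(_ _ (Delta_diag z1))[U1 [e1 [[oU1 U10] F1]]]] := HG true.
have [r2 /(_ _ (Delta_diag z1))[U2 [e2 [[oU2 U20] F2]]]] := HG false.
pose Omega : set C := [set t | `|t| < 1 /\ U1 (diag t) /\ U2 (diag t)].
have Oz : Omega 0 by [].
have Oopen t : Omega t -> \forall s \near t, Omega s.
  move=> [t1 [Ut1 Ut2]].
  have n1 : \forall s \near t, U1 (diag s) by apply: near_diag; exact: open_nbhs_nbhs.
  have n2 : \forall s \near t, U2 (diag s) by apply: near_diag; exact: open_nbhs_nbhs.
  have n3 : \forall s \near t, `|s| < 1.
    have := D3_near (const_mx 1) (DeltaD3 (Delta_diag t1)) => H.
    by apply/near_shiftC; apply: filterS H => x /(_ i1); rewrite -diagD mxE.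
  by apply: filterS3 n1 n2 n3.
pose u i t := ujet l i (diag t); pose d i t := ujet1 l i (diag t).
have OD t : Omega t -> Delta (diag t) by move=> [t1 _]; exact: Delta_diag.
have O3 t : Omega t -> D3 (diag t) by move=> /OD/DeltaD3.
have Du i t : Omega t -> is_derive t 1 (u i) (u i.+1 t + d i t).
  move=> Ot; apply: is_derive_diag.
  have := @Dujet l i (diag t) (const_mx 1) (O3 t Ot).
  by rewrite !mxE !scale1r addrC; exact.
have cu i t : Omega t -> u i s @[s --> t] --> u i t.
  by move=> Ot; apply: derivable_continuous; have [] := Du i t Ot.
have cd i t : Omega t -> d i s @[s --> t] --> d i t.
  move=> Ot; apply: derivable_continuous.
  have := is_derive_hom alpha_gt0 beta_gt0 gamma_gt0 M (l + i) (ucoef beta gamma l i) 1 (h :=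
    const_mx 1) (O3 t Ot).
  rewrite !mxE => /(_ erefl) /(is_deriveZ alpha%:C) /is_derive_diag.
  by case.
have gd t : Omega t -> exists A B : C, forall i j,
    ip (d i t) (u j t) = A * ip (u i t) (u j t) /\ ip (d i t) (d j t) = B * ip (u i t) (u j t).
  move=> Ot; have [A [B HAB]] := gram_level1 alpha_gt0 beta_gt0 gamma_gt0 M (O3 t Ot).
  exists (alpha%:C * A), (alpha%:C * conjc alpha%:C * B) => i j.
  rewrite /d /u /ujet1 /ujet /hom; split.
    rewrite ipZl -mulrA; congr (_ * _); rewrite !ip_suml mulr_sumr; apply: eq_bigr => b _.
    rewrite !ip_sumr mulr_sumr; apply: eq_bigr => c _.
    by rewrite !ipZl !ipZr (HAB _ _ _ _).1; ring.
  rewrite ipZl ipZr -!mulrA; congr (_ * (_ * _)); rewrite !ip_suml mulr_sumr; apply: eq_bigr => b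
    _.
  rewrite !ip_sumr mulr_sumr; apply: eq_bigr => c _.
  by rewrite !ipZl !ipZr (HAB _ _ _ _).2; ring.
have iu t : Omega t -> forall n, lin_indep (fun i : 'I_n => u i t).
  move=> Ot n c; apply: ujet_indep => //; exact: O3.
have FE t f : Omega t -> jetEl beta gamma M l k (diag t) f <-> lin_span (fun i : 'I_k => u i t) f.
  move=> Ot; have E : (fun i : 'I_k => jetEl_frame beta gamma M l k i (diag t)) = (fun i : 'I_k
    => u i t).
    by apply/funext => i; rewrite jetEl_frameE'//; exact: O3.
  by rewrite /jetEl E.
have G1 t : Omega t -> [/\ forall p, derivable (e1 p \o diag) t 1, lin_indep (fun p => e1 p (diag
  t)) &
    G true (diag t) = lin_span (fun p => e1 p (diag t))].
  move=> Ot; have [h1 h2 h3] := F1 _ (OD t Ot) Ot.2.1; split => // p.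
  by have [] := is_derive_diag (derivableP (h1 p)).
have G2 t : Omega t -> [/\ forall p, derivable (e2 p \o diag) t 1, lin_indep (fun p => e2 p (diag
  t)) &
    G false (diag t) = lin_span (fun p => e2 p (diag t))].
  move=> Ot; have [h1 h2 h3] := F2 _ (OD t Ot) Ot.2.2; split => // p.
  by have [] := is_derive_diag (derivableP (h1 p)).
have G0 b t : Omega t -> G b (diag t) 0.
  by move=> Ot; case: b; [have [_ _ ->] := G1 t Ot|have [_ _ ->] := G2 t Ot]; exact: lin_span0.
have GF b t f : Omega t -> G b (diag t) f -> lin_span (fun i : 'I_k => u i t) f.
  move=> Ot Hf; apply/FE => //; have [_ ->] := Hsum _ (OD t Ot).
  exists (fun i => if i == b then f else 0); split.
    by move=> i; case: eqP => [->//|_]; exact: G0.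
  by rewrite -big_mkcond/= big_pred1_eq.
have Gorth t f g : Omega t -> G true (diag t) f -> G false (diag t) g -> ip f g = 0.
  by move=> Ot Hf Hg; have [H _] := Hsum _ (OD t Ot); exact: (H true false).
pose coefs := (('I_(r true) -> C) * ('I_(r false) -> C) * ('I_k -> C))%type.
(* Coefficients are first chosen point by point, without regularity: those of the two components of
   u_i in [e1] and [e2], and those of the first component in the frame u. Their differentiability
   follows later, because frames determine coefficients. *)
have ex (ti : C * 'I_k) : exists a : coefs, Omega ti.1 ->
    u ti.2 ti.1 = \sum_p a.1.1 p *: e1 p (diag ti.1) + \sum_p a.1.2 p *: e2 p (diag ti.1) /\
    \sum_p a.1.1 p *: e1 p (diag ti.1) = \sum_j a.2 j *: u j ti.1.
  case: ti => t i /=; have [Ot|nOt] := pselect (Omega t); last first.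
    by exists (fun=> 0, fun=> 0, fun=> 0).
  have : jetEl beta gamma M l k (diag t) (u i t).
    by apply/FE => //; exact: (lin_span_mem (fun i : 'I_k => u i t)).
  have [_ ->] := Hsum _ (OD t Ot); case=> g [Hg ug].
  have := Hg true; have [_ _ E1] := G1 t Ot; rewrite {1}E1 => -[a1 g1].
  have := Hg false; have [_ _ ->] := G2 t Ot => -[a2 g2].
  have [a3 g3] := GF true t _ Ot (Hg true).
  exists (a1, a2, a3) => _ /=; rewrite -g1 -g2 -g3 ug; split => //.
  by rewrite big_bool.
have [a Ha] := choice ex.
pose x i t : M := \sum_p (a (t, i)).1.1 p *: e1 p (diag t).
pose q (i j : 'I_k) t := (a (t, i)).2 j.
have xq i t : Omega t -> x i t = \sum_j q i j t *: u j t.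
  by move=> Ot; have [_] := Ha (t, i) Ot.
have Dx i t : Omega t -> derivable (x i) t 1.
  move=> Ot; have [d1 li1 E1] := G1 t Ot; have [d2 li2 E2] := G2 t Ot.
  (* The two frames are concatenated; orthogonality of the summands makes the result independent, so
     [coef_derivable] applies to the expansion of u_i. *)
  pose e (p : 'I_(r true + r false)%N) (s : C) : M := match fintype.split p with
    | inl p1 => e1 p1 (diag s) | inr p2 => e2 p2 (diag s) end.
  pose b (s : C) (p : 'I_(r true + r false)%N) : C := match fintype.split p with
    | inl p1 => (a (s, i)).1.1 p1 | inr p2 => (a (s, i)).1.2 p2 end.
  have sl p : fintype.split (lshift (r false) p) = inl p by exact: (unsplitK (inl p)).
  have sr p : fintype.split (rshift (r true) p) = inr p by exact: (unsplitK (inr p)).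
  have Db := @coef_derivable R _ _ _ M _ e (u i) b t _ _ _ _.
  have Da p : derivable (fun s => (a (s, i)).1.1 p) t 1.
    have -> : (fun s => (a (s, i)).1.1 p) = (fun s => b s (lshift (r false) p)).
      by apply/funext => s; rewrite /b sl.
    apply: Db.
    - by move=> p'; rewrite /e; case: (fintype.split p') => p''; [exact: d1|exact: d2].
    - move=> c; rewrite big_split_ord/= /e.
      under eq_bigr do rewrite sl.
      under [X in _ + X]eq_bigr do rewrite sr.
      set X := \sum_(_ < r true) _; set Y := \sum_(_ < r false) _ => XY.
      have HX : G true (diag t) X by rewrite E1; exists (fun p => c (lshift _ p)).
      have HY : G false (diag t) Y by rewrite E2; exists (fun p => c (rshift _ p)).
      have X0 : X = 0.
        apply: ip_eq0; have := Gorth t X Y Ot HX HY.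
        by rewrite (_ : Y = - X) ?ipNr; [move/eqP; rewrite oppr_eq0 => /eqP|apply/eqP; rewrite
          -addr_eq0 addrC XY].
      have Y0 : Y = 0 by move: XY; rewrite X0 add0r.
      move=> p'; rewrite -(splitK p'); case: (fintype.split p') => p'' /=.
        exact: (li1 _ X0).
      exact: (li2 _ Y0).
    - by have [] := Du i t Ot.
    - apply: filterS (Oopen t Ot) => s Os; rewrite big_split_ord/= /e /b.
      under eq_bigr do rewrite sl.
      under [X in _ + X]eq_bigr do rewrite sr.
      by have [] := Ha (s, i) Os.
  have -> : x i = \sum_p (fun s => (a (s, i)).1.1 p *: (e1 p \o diag) s).
    by apply/funext => s; rewrite fct_sumE.
  have [] // := is_derive_sum (fun p => is_derive_scale (derivableP (Da p)) (derivableP (d1 p))).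
have Dq i j t : Omega t -> derivable (q i j) t 1.
  move=> Ot; apply: (@coef_derivable R _ _ _ M _ (fun j : 'I_k => u j) (x i) (fun t j => q i j
    t)).
  - by move=> p; have [] := Du p t Ot.
  - exact: iu.
  - exact: Dx.
  - by apply: filterS (Oopen t Ot) => s; exact: xq.
pose c (i j : 'I_k) t : C := (i == j)%:R - q i j t.
have cE i t : comb u c i t = u i t - comb u q i t.
  rewrite /comb /c; under eq_bigr do rewrite scalerBl.
  rewrite big_split/= sumrN; congr (_ - _).
  rewrite (bigD1 i)//= eqxx scale1r big1 ?addr0// => j; rewrite eq_sym => /negbTE ->.
  by rewrite scale0r.
have qx i t : Omega t -> comb u q i t = x i t by move=> Ot; rewrite xq.
have cy i t : Omega t -> comb u c i t = \sum_p (a (t, i)).1.2 p *: e2 p (diag t).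
  by move=> Ot; rewrite cE qx//; have [-> _] := Ha (t, i) Ot; rewrite addrC addKr.
have qG i t : Omega t -> G true (diag t) (comb u q i t).
  by move=> Ot; have [_ _ ->] := G1 t Ot; rewrite qx//; exists (a (t, i)).1.1.
have cG i t : Omega t -> G false (diag t) (comb u c i t).
  by move=> Ot; have [_ _ ->] := G2 t Ot; rewrite cy//; exists (a (t, i)).1.2.
have S : orth_split u Omega q c.
  split.
  - exact: Dq.
  - move=> i j t Ot; have [H _] := is_deriveB (is_derive_cst ((i == j)%:R : C) t 1) (derivableP
      (Dq i j t Ot)).
    exact: H.
  - by move=> i t Ot; rewrite cE addrC subrK.
  - by move=> i j t Ot; apply: (Gorth t); [exact: Ot|exact: qG|exact: cG].
have uqc (i : 'I_k) t : u i t = comb u q i t + comb u c i t by rewrite cE addrC subrK.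
have spanG b f : (forall i : 'I_k, G b (diag 0) (u i 0)) -> lin_span (fun i : 'I_k => u i 0) f ->
  G b (diag 0) f.
  have [_ _ E1] := G1 0 Oz; have [_ _ E2] := G2 0 Oz.
  move=> H [m ->]; case: b H => H; [rewrite E1|rewrite E2]; apply: sum_closed.
  - exact: lin_span0.
  - exact: lin_spanD.
  - by move=> i _; apply: lin_spanZ; rewrite -E1.
  - exact: lin_span0.
  - exact: lin_spanD.
  - by move=> i _; apply: lin_spanZ; rewrite -E2.
have frame_neq0 m (e : 'I_m -> M) p : lin_indep e -> e p != 0.
  move=> li; apply/eqP => ep0.
  have := li (fun j => (j == p)%:R); rewrite (bigD1 p)//= eqxx scale1r ep0 big1 ?addr0; last
    first.
    by move=> j /negbTE ->; rewrite scale0r.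
  by move=> /(_ erefl p)/eqP; rewrite eqxx oner_eq0.
(* If all x_i vanish at 0, the whole fibre lies in [G false], so a frame vector of [G true], which
   exists by positive rank, is orthogonal to itself. The other case is symmetric. *)
case: (orth_split_trivial k0 Oopen Du cu cd gd iu S Oz) => H.
  have [_ li E1] := G1 0 Oz; pose p := Ordinal r1.
  have /eqP := frame_neq0 _ _ p li; apply; apply: ip_eq0; apply: (Gorth 0) => //.
    by rewrite E1; exact: (lin_span_mem (fun p => e1 p (diag 0))).
  apply: spanG; first by move=> i; rewrite uqc H add0r; exact: cG.
  by apply: (GF true) => //; rewrite E1; exact: (lin_span_mem (fun p => e1 p (diag 0))).
have [_ li E2] := G2 0 Oz; pose p := Ordinal r2.
have /eqP := frame_neq0 _ _ p li; apply; apply: ip_eq0; apply: (Gorth 0) => //; last first.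
  by rewrite E2; exact: (lin_span_mem (fun p => e2 p (diag 0))).
apply: spanG; first by move=> i; rewrite uqc H addr0; exact: qG.
by apply: (GF false) => //; rewrite E2; exact: (lin_span_mem (fun p => e2 p (diag 0))).
Qed.
End Main.

Theorem theorem4p6 (R : realType) (alpha beta gamma : R) (n : nat)
    (alpha_gt0 : 0 < alpha) (beta_gt0 : 0 < beta) (gamma_gt0 : 0 < gamma)
    (n_ge1 : (1 <= n)%N)
    (M : rkhs (@D3 R) (K3 alpha beta gamma)) :
  [/\ hol_frame setT (jetE M n) (jetE_frame M n),
      forall l : 'I_n,
        hol_frame setT (jetEl beta gamma M l (n - l))
          (jetEl_frame beta gamma M l (n - l)),
      orth_direct_sum M (jetE M n)
        (fun l : 'I_n => jetEl beta gamma M l (n - l)) &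
      forall l : 'I_n, irreducible_bundle M (jetEl beta gamma M l (n - l))].
Proof.
split.
- exact: hol_frame_jetE.
- by move=> l; exact: hol_frame_jetEl.
- exact: jetE_orth_direct_sum.
- by move=> l; apply: jetEl_irreducible; rewrite // subn_gt0.
Qed.
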